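(* With $\beta$ and the spaces $E_m$ fixed as in the context, there is a positive constant $C$ such that $$\|\mathcal{A}_m u-\mathcal{A}_{m'}v\|_{L^2(V)}\ge C\,\|\mathcal{A}_{m'}v\|_{L^2(V)}\,|m-m'|\qquad\text{for all } m,m'\in B,\ u\in E_m,\ v\in E_{m'},$$ and for such a constant $C$ the following holds: there is an integer $N$ such that for all $m,m'$ in $B$, all $u$ in $E_m$, all $v$ in $E_{m'}$, and all $k>N$ in $\mathbb{N}$, $$\left(\sum_{j=1}^{M_k}C'(j,k)\,\big|(\mathcal{A}_m u-\mathcal{A}_{m'}v)(P_{j,k})\big|^2\right)^{1/2}\;\ge\;\frac{C}{2}\left(\sum_{j=1}^{M_k}C'(j,k)\,\big|(\mathcal{A}_{m'}v)(P_{j,k})\big|^2\right)^{1/2}|m-m'| .$$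
   Context: Setting. $R$ and $V$ are two compact manifolds (possibly with boundary) embedded in $\mathbb{R}^d$, with surface measures $\sigma$ and $\sigma'$ respectively. $B$ is a compact subset of $\mathbb{R}^p$. For each $m\in B$, $\mathbf{H}_m : V\times R\to\mathbb{R}$ is an integration kernel, and $\mathcal{A}_m$ is the operator $$\mathcal{A}_m g(x)=\int_R \mathbf{H}_m(x,y)\,g(y)\,d\sigma(y),\qquad x\in V .$$ Norms. On $H^1_0(R)$ use $\|\phi\|=\big(\int_R|\nabla\phi|^2\,d\sigma\big)^{1/2}$, which by Poincaré's inequality is a norm equivalent to the usual one, with associated inner product $\langle\phi,\psi\rangle=\int_R\nabla\phi\cdot\nabla\psi\,d\sigma$. On $L^2(V)$ use $\|\psi\|=\big(\int_V|\psi|^2\,d\sigma'\big)^{1/2}$. $|\cdot|$ is the Euclidean norm on $\mathbb{R}^p$. Standing assumptions. (Regularity 1) $(m,x,y)\mapsto \mathbf{H}_m(x,y)$ is continuous on $B\times V\times R$, and the gradient in $x$, $(m,x,y)\mapsto\nabla_x\mathbf{H}_m(x,y)$, exists and is continuous on $B\times V\times R$. (Regularity 2) There is an open set $B'\subset\mathbb{R}^p$ with $B\subset B'$ (the kernels $\mathbf{H}_m$ being defined for $m\in B'$) such that the derivatives $\partial_{m_i}\mathbf{H}_m(x,y)$ and $\partial_{m_i}\nabla_x\mathbf{H}_m(x,y)$, $1\le i\le p$, exist and are continuous on $B'\times V\times R$. For a unit vector $\mathbf{q}\in\mathbb{R}^p$ and $m\in B'$, $\partial_{\mathbf{q}}\mathcal{A}_m=\nabla_m\mathcal{A}_m\cdot\mathbf{q}$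 denotes the directional derivative, i.e. the integral operator with kernel $\nabla_m\mathbf{H}_m(x,y)\cdot\mathbf{q}$. (Uniqueness 1) For all $m,m'\in B$ and $u,v\in H^1_0(R)$: if $\mathcal{A}_m u=\mathcal{A}_{m'}v$ in $L^2(V)$ and ($u\ne0$ or $v\neq0$), then $m=m'$ and $u=v$. In particular $\mathcal{A}_m$ is injective for all $m\in B$. (Uniqueness 2) For all unit vectors $\mathbf{q}\in\mathbb{R}^p$, all $m\in B$ and all $u,v\in H^1_0(R)$: $\partial_{\mathbf{q}}\mathcal{A}_m u=\mathcal{A}_m v$ implies $u=v=0$. (Quadrature) There is an increasing sequence of integers $M_n$ such that for each $n$ there are $M_n$ points $P_{j,n}\in V$ and $M_n$ coefficients $C'(j,n)\in\mathbb{R}$, $j=1,\dots,M_n$, such that for all $\phi\in C^1(V)$, $$\Big|\sum_{j=1}^{M_n}C'(j,n)\,\phi(P_{j,n})-\int_V\phi\,d\sigma'\Big|=O\big(M_n^{-1/\dim V}\big)\,\sup_V|\nabla\phi|,$$ the constant in $O(\cdot)$ being independent of $n$ and $\phi$. The spaces $E_m$. $\mathcal{A}_m$ is regarded as a compact linear operator $H^1_0(R)\to L^2(V)$, and $\mathcal{A}_m^*:L^2(V)\to H^1_0(R)$ is its adjoint with respect to the inner products above, so that $\mathcal{A}_m^*\mathcal{A}_m$ is compact and symmetric on $H^1_0(R)$. Fix $\beta>0$ such that $\|\mathcal{A}_m^*\mathcal{A}_m\|>\beta^2$ for all $m\in B$. $E_m\subset H^1_0(R)$ is the (finite dimensional)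 span of the eigenvectors of $\mathcal{A}_m^*\mathcal{A}_m$ corresponding to eigenvalues strictly greater than $\beta^2$. *)

(* Defs.v *)
From HB Require Import structures.
From mathcomp Require Import all_boot all_order all_algebra.
From mathcomp Require Import all_classical all_reals all_analysis.

Set Implicit Arguments.
Unset Strict Implicit.
Unset Printing Implicit Defensive.

Import Order.TTheory GRing.Theory Num.Theory.
Import numFieldNormedType.Exports.

Local Open Scope classical_set_scope.
Local Open Scope ring_scope.

(* The library norm on 'rV[R]_n is the sup norm, hence the Euclidean structure
   below. The topology (open, compact, nbhs, continuous) is the same. *)
Definition edot (R : realType) (n : nat) (u v : 'rV[R]_n) : R :=
  \sum_(i < n) u 0 i * v 0 i.

Definition enorm (R : realType) (n : nat) (u : 'rV[R]_n) : R :=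
  Num.sqrt (edot u u).

Notation borel R d := (g_sigma_algebraType (@open 'rV[R]_d)).

Section Submanifolds.
Variables (R : realType) (d : nat).
Implicit Types (M U W : set 'rV[R]_d) (x v : 'rV[R]_d).

Definition C1_on U (f : 'rV[R]_d -> 'rV[R]_d) : Prop :=
  forall x, U x ->
    differentiable f x /\ forall v, {for x, continuous (fun y => 'D_v f y)}.

(* The model [0, +oo[ x R^(k-1) x {0}^(d-k). *)
Definition half_slice (k : nat) : set 'rV[R]_d :=
  [set z | forall i : 'I_d, (i = 0%N :> nat -> 0 <= z 0 i) /\
                            ((k <= i)%N -> z 0 i = 0)].

(* [phi] is a C^1 diffeomorphism of the open set U onto an open set W mapping
   U `&` M onto W `&` half_slice k. *)
Definition slice_chart (k : nat) M U (phi : 'rV[R]_d -> 'rV[R]_d) : Prop :=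
  exists W psi,
    [/\ open U, open W, C1_on U phi, C1_on W psi &
    [/\ forall x, U x -> W (phi x) /\ psi (phi x) = x,
        forall z, W z -> U (psi z) /\ phi (psi z) = z &
        forall x, U x -> (M x <-> half_slice k (phi x))]].

(* Regularity C^1 is what surface measure, C^1(M) and H^1_0(M) require; smooth
   submanifolds are included. The boundary may be empty. *)
Definition compact_submanifold (k : nat) M : Prop :=
  [/\ (0 < k <= d)%N, compact M &
      forall x, M x -> exists U phi, slice_chart k M U phi /\ U x].

Definition boundary (k : nat) M : set 'rV[R]_d :=
  [set x | M x /\ exists U phi, [/\ slice_chart k M U phi, U x &
                  forall i : 'I_d, i = 0%N :> nat -> phi x 0 i = 0]].

(* At a boundary point this is the full k-dimensional tangent space. *)
Definition tangent (k : nat) M x : set 'rV[R]_d :=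
  [set v | exists U phi, [/\ slice_chart k M U phi, U x &
             forall i : 'I_d, (k <= i)%N -> ('D_v phi x) 0 i = 0]].

(* Gradient along M of a function of which only the values on M matter. *)
Definition is_tgrad (k : nat) M (f : 'rV[R]_d -> R) x (g : 'rV[R]_d) : Prop :=
  tangent k M x g /\
  forall e : R, 0 < e -> \forall y \near x, M y ->
    `|f y - f x - edot g (y - x)| <= e * enorm (y - x).

Definition tdifferentiable (k : nat) M (f : 'rV[R]_d -> R) x : Prop :=
  exists g, is_tgrad k M f x g.

Definition tgrad (k : nat) M (f : 'rV[R]_d -> R) x : 'rV[R]_d :=
  xget 0 [set g | is_tgrad k M f x g].

Definition C1_fun (k : nat) M (f : 'rV[R]_d -> R) : Prop :=
  (forall x, M x -> tdifferentiable k M f x) /\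
  {within M, continuous (tgrad k M f)}.

Definition C1c_fun (k : nat) M (f : 'rV[R]_d -> R) : Prop :=
  C1_fun k M f /\
  exists K, [/\ compact K, K `<=` M `\` boundary k M &
                forall x, M x -> ~ K x -> f x = 0].

(* Volume of the unit ball of R^k. *)
Fixpoint ball_volume (k : nat) : R :=
  match k with
  | 0 => 1
  | 1 => 2
  | k'.+2 => 2 * pi / k%:R * ball_volume k'
  end.

Definition ediam (A : set 'rV[R]_d) : R :=
  sup [set enorm (z.1 - z.2) | z in A `*` A].

Definition delta_cover (delta : R) (A : set 'rV[R]_d) :
    set (nat -> set 'rV[R]_d) :=
  [set U | A `<=` \bigcup_i U i /\
           forall i x y, U i x -> U i y -> enorm (x - y) <= delta].

Definition hausdorff_content (k : nat) (delta : R) (A : set 'rV[R]_d) : \bar R :=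
  ereal_inf [set (\sum_(i <oo) (ball_volume k * (ediam (U i) / 2) ^+ k)%:E)%E
            | U in delta_cover delta A].

Definition hausdorff (k : nat) (A : set 'rV[R]_d) : \bar R :=
  ereal_sup [set hausdorff_content k delta A | delta in [set t : R | 0 < t]].

(* The surface measure of M, as a Borel measure on R^d carried by M, is the
   restriction to M of the k-dimensional Hausdorff measure. *)
Definition surface_measure (k : nat) M (sigma : set (borel R d) -> \bar R) :
    Prop :=
  forall A : set (borel R d), measurable A -> sigma A = hausdorff k (A `&` M).

End Submanifolds.

Section FunctionSpaces.
Variables (R : realType) (d : nat).
Variable sigma : {measure set (borel R d) -> \bar R}.
Variables (k : nat) (M : set 'rV[R]_d).

Definition ae_on (P : 'rV[R]_d -> Prop) : Prop :=
  {ae sigma, forall x : borel R d, M x -> P x}.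

Definition l2dot (f g : 'rV[R]_d -> R) : R :=
  \int[sigma]_(x in (M : set (borel R d))) (f x * g x).

Definition l2norm (f : 'rV[R]_d -> R) : R := Num.sqrt (l2dot f f).

(* H^1_0(M), the closure of C^1_c(M minus its boundary) in H^1(M): an element is
   an L^2 limit of such functions whose gradients converge in L^2 as well,
   together with the limit of the gradients, which is its weak gradient. *)
Record H10 := {
  h_val :> 'rV[R]_d -> R ;
  h_grad : 'rV[R]_d -> 'rV[R]_d ;
  _ : measurable_fun (M : set (borel R d)) (h_val : borel R d -> R) ;
  _ : forall i, measurable_fun (M : set (borel R d))
                  ((fun x => h_grad x 0 i) : borel R d -> R) ;
  _ : exists phi : nat -> 'rV[R]_d -> R,
        [/\ forall n, C1c_fun k M (phi n),
            (\int[sigma]_(x in (M : set (borel R d)))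
               ((h_val x - phi n x) ^+ 2)%:E)%E @[n --> \oo] --> 0%E &
            (\int[sigma]_(x in (M : set (borel R d)))
               (enorm (h_grad x - tgrad k M (phi n) x) ^+ 2)%:E)%E
              @[n --> \oo] --> 0%E] }.

Definition h_dot (u v : H10) : R :=
  \int[sigma]_(x in (M : set (borel R d))) edot (h_grad u x) (h_grad v x).

Definition h_norm (u : H10) : R := Num.sqrt (h_dot u u).

(* [u = \sum_i c i *: e i] in H^1_0(M). *)
Definition h_lincomb (n : nat) (c : 'I_n -> R) (e : 'I_n -> H10) (u : H10) :
    Prop :=
  ae_on (fun x => u x = \sum_(i < n) c i * e i x /\
                  h_grad u x = \sum_(i < n) c i *: h_grad (e i) x).

Definition h_eq (u v : H10) : Prop :=
  ae_on (fun x => u x = v x /\ h_grad u x = h_grad v x).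

Definition h_eq0 (u : H10) : Prop :=
  ae_on (fun x => u x = 0 /\ h_grad u x = 0).

Definition poincare : Prop :=
  exists c : R, forall u : H10, l2norm u <= c * h_norm u.

End FunctionSpaces.

Section Operators.
Variables (R : realType) (d : nat).
Variable sigma : {measure set (borel R d) -> \bar R}.
Variables (k : nat) (S : set 'rV[R]_d).
Variable sigma' : {measure set (borel R d) -> \bar R}.
Variable V : set 'rV[R]_d.
Local Notation H10 := (H10 sigma k S).

Definition integral_op (K : 'rV[R]_d -> 'rV[R]_d -> R)
    (g : 'rV[R]_d -> R) (x : 'rV[R]_d) : R :=
  \int[sigma]_(y in (S : set (borel R d))) (K x y * g y).

Variable A : ('rV[R]_d -> R) -> 'rV[R]_d -> R.

(* [w = A^* f], for A : H^1_0(S) -> L^2(V). *)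
Definition adjoint_at (f : 'rV[R]_d -> R) (w : H10) : Prop :=
  forall phi : H10, l2dot sigma' V (A phi) f = h_dot phi w.

Definition normal_op_norm : \bar R :=
  ereal_sup [set t | exists u w : H10,
    [/\ h_norm u <= 1, adjoint_at (A u) w & t = (h_norm w)%:E]].

Definition normal_eigenvector (lambda : R) (u : H10) : Prop :=
  ~ h_eq0 u /\
  exists w, adjoint_at (A u) w /\
            h_lincomb (fun _ : 'I_1 => lambda) (fun _ : 'I_1 => u) w.

Definition eigenspan_above (t : R) (u : H10) : Prop :=
  exists (n : nat) (lambda c : 'I_n -> R) (e : 'I_n -> H10),
    (forall i, t < lambda i /\ normal_eigenvector (lambda i) (e i)) /\
    h_lincomb c e u.

End Operators.

Section Kernels.
Variables (R : realType) (d p : nat).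
Variable H : 'rV[R]_p -> 'rV[R]_d -> 'rV[R]_d -> R.
Variables (k : nat) (V S : set 'rV[R]_d).

Definition xgrad (m : 'rV[R]_p) (x y : 'rV[R]_d) : 'rV[R]_d :=
  tgrad k V (fun x' => H m x' y) x.

Definition regular1 (B : set 'rV[R]_p) : Prop :=
  [/\ {within B `*` V `*` S, continuous (fun z => H z.1.1 z.1.2 z.2)},
      forall m x y, B m -> V x -> S y ->
        tdifferentiable k V (fun x' => H m x' y) x &
      {within B `*` V `*` S, continuous (fun z => xgrad z.1.1 z.1.2 z.2)}].

Definition mpartial (i : 'I_p) (m : 'rV[R]_p) (x y : 'rV[R]_d) : R :=
  'D_(delta_mx 0 i) (fun m' => H m' x y) m.

Definition mpartial_xgrad (i : 'I_p) (m : 'rV[R]_p) (x y : 'rV[R]_d) :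
    'rV[R]_d :=
  'D_(delta_mx 0 i) (fun m' => xgrad m' x y) m.

Definition regular2 (B' : set 'rV[R]_p) : Prop :=
  (forall m x y, B' m -> V x -> S y ->
     tdifferentiable k V (fun x' => H m x' y) x) /\
  forall i : 'I_p,
    [/\ forall m x y, B' m -> V x -> S y ->
          derivable (fun m' => H m' x y) m (delta_mx 0 i),
        {within B' `*` V `*` S,
           continuous (fun z => mpartial i z.1.1 z.1.2 z.2)},
        forall m x y, B' m -> V x -> S y ->
          derivable (fun m' => xgrad m' x y) m (delta_mx 0 i) &
        {within B' `*` V `*` S,
           continuous (fun z => mpartial_xgrad i z.1.1 z.1.2 z.2)}].

Definition mdir (q m : 'rV[R]_p) (x y : 'rV[R]_d) : R :=
  \sum_(i < p) mpartial i m x y * q 0 i.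

End Kernels.

Definition quad (R : realType) (d : nat) (M : nat -> nat)
    (P : forall n, 'I_(M n) -> 'rV[R]_d) (c : forall n, 'I_(M n) -> R)
    (n : nat) (f : 'rV[R]_d -> R) : R :=
  \sum_(j < M n) c n j * f (P n j).

Definition quadrature (R : realType) (d : nat)
    (sigma' : {measure set (borel R d) -> \bar R})
    (k : nat) (V : set 'rV[R]_d) (M : nat -> nat)
    (P : forall n, 'I_(M n) -> 'rV[R]_d) (c : forall n, 'I_(M n) -> R) : Prop :=
  [/\ forall n, (0 < M n < M n.+1)%N,
      forall n j, V (P n j) &
      exists a : R, forall n (f : 'rV[R]_d -> R), C1_fun k V f ->
        `|quad P c n f - \int[sigma']_(x in (V : set (borel R d))) f x| <=
        a * (M n)%:R `^ (- (k%:R)^-1) *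
        sup [set enorm (tgrad k V f x) | x in V]].

(* Main.v *)
Require Import Defs.
From HB Require Import structures.
From mathcomp Require Import all_boot all_order all_algebra.
From mathcomp Require Import all_classical all_reals all_analysis.
From mathcomp Require Import measurable_realfun ring lra.
Import Order.TTheory GRing.Theory Num.Theory.
Import numFieldNormedType.Exports.
Local Open Scope classical_set_scope.
Local Open Scope ring_scope.

Set Implicit Arguments.
Unset Strict Implicit.
Unset Printing Implicit Defensive.

(** Write A for A_m, A' for A_m', and |.| for the norms of H^1_0(S) and L^2(V).

    All that is used of the spectral subspaces is that an element u of E_m
    starts a tower: a sequence with us 0 = u and us k = A^* A (us k.+1), along
    which A^* A stays invertible with |us k.+1| <= beta^-2 |us k| and
    beta |us k| <= |A (us k)| (span_tower). Neither the spectral theorem nor an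
    adjoint has to be constructed.

    A first consequence (tower_gap) is the a priori bound
    |u - v| <= c (|A (u - v)| + |m - m'| |v|) for u in E_m, v in E_m'. If the
    operators were equal, the differences x k of the two towers would satisfy
    x k = A^* A (x k.+1); were |A (x 0)| small relative to |x 0|, this would
    persist for all k and x k would outgrow the rate beta^(-2k) of towers.

    For the lower bound, suppose that no constant is suitable
    (counterex_false). Then there are u_n, v_n, with parameters m_n, m'_n at
    distance del_n, such that |A'_n v_n| = 1 and
    |A_n u_n - A'_n v_n| < del_n / (n + 1). As <phi, u_n> = <A_n phi, A_n (us_n 1)>
    and the limit operator is compact, u_n and v_n converge in norm along a
    free ultrafilter (tower_ulim). The limits satisfy A u = A' v with
    |A' v| = 1, so m = m' by the first uniqueness assumption. The quotients
    (u_n - v_n) / del_n are bounded by the a priori bound and converge as well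
    (quotient_ulim), to some w; dividing by del_n and passing to the limit
    gives A w + (d_q A) v = 0 where q, of norm 1, is the limit of
    (m_n - m'_n) / del_n. By the second uniqueness assumption v = 0, which
    contradicts |A' v| = 1.

    For the discrete bound let F = A u - A' v. The kernel and its gradient in x
    are bounded and Lipschitz in m (param_lipschitz), so |F| and |grad F| are
    at most K (|u - v| + |m - m'| |v|) everywhere on V, hence at most K' times
    the L^2 norm of F, by the a priori bound and the lower bound. The
    quadrature rule applied to F^2, whose gradient is 2 F grad F, therefore
    makes a relative error O(M_k^(-1 / dim V)), uniform in m, m', u, v
    (quad_sqr_error); the same holds for A' v. Relative errors of 1/4 are
    compensated by the factor 1/2 (discrete_bound).

    The analysis on which this rests: tangential gradients depend on no chart
    (tangent_form0) and obey a mean value inequality (local_mvt), so that they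
    commute with the integral (kernel_op_tgrad); compact submanifolds have
    finite Hausdorff measure (hausdorff_fin), which makes continuous functions
    square integrable; H^1_0(S) is a complete vector space for the gradient norm
    (sob_complete). *)

(** * Semi-inner products *)

(** The axioms hold on a subset D only: the pairing of L^2 is defined for all
    functions, but bilinear on square integrable ones. *)
Section SemiInner.
Context {R : realType} {X : lmodType R} (D : set X) (ip : X -> X -> R).
Hypothesis D_lin : forall a x y, D x -> D y -> D (a *: x + y).
Hypothesis D_0 : D 0.
Hypothesis ipC : forall x y, ip x y = ip y x.
Hypothesis ip_lin : forall a x y z, D x -> D y -> D z ->
  ip (a *: x + y) z = a * ip x z + ip y z.
Hypothesis ip_ge0 : forall x, D x -> 0 <= ip x x.

Definition snorm (x : X) : R := Num.sqrt (ip x x).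

Lemma snorm_ge0 x : 0 <= snorm x.
Proof. exact: sqrtr_ge0. Qed.

Lemma snorm_sq x : D x -> snorm x ^+ 2 = ip x x.
Proof. by move=> Dx; rewrite sqr_sqrtr// ip_ge0. Qed.

Lemma semi_ip0l z : D z -> ip 0 z = 0.
Proof.
by move=> Dz; have := ip_lin 1 D_0 D_0 Dz; rewrite scale1r addr0 mul1r; lra.
Qed.

Lemma semi_D_scale a x : D x -> D (a *: x).
Proof. by move=> Dx; rewrite -[_ *: _]addr0; exact: D_lin. Qed.

Lemma semi_D_add x y : D x -> D y -> D (x + y).
Proof. by move=> Dx; rewrite -[x]scale1r; exact: D_lin. Qed.

Lemma semi_D_sub x y : D x -> D y -> D (x - y).
Proof. by move=> Dx Dy; rewrite addrC -scaleN1r; exact: D_lin. Qed.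

Lemma semi_ipZl a x z : D x -> D z -> ip (a *: x) z = a * ip x z.
Proof.
by move=> Dx Dz; rewrite -[_ *: _]addr0 ip_lin// semi_ip0l// addr0.
Qed.

Lemma semi_ipDl x y z : D x -> D y -> D z -> ip (x + y) z = ip x z + ip y z.
Proof. by move=> Dx Dy Dz; rewrite -[x in LHS]scale1r ip_lin// mul1r. Qed.

Lemma semi_ip_expand a x y : D x -> D y ->
  ip (a *: x + y) (a *: x + y) = a ^+ 2 * ip x x + a *+ 2 * ip x y + ip y y.
Proof.
move=> Dx Dy; have Dxy := D_lin a Dx Dy.
rewrite ip_lin// [ip x _]ipC [ip y (_ + _)]ipC !ip_lin// [ip y x]ipC; ring.
Qed.

Lemma semi_cauchy_schwarz x y : D x -> D y -> `|ip x y| <= snorm x * snorm y.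
Proof.
move=> Dx Dy; rewrite -sqrtrM ?ip_ge0// -sqrtr_sqr ler_wsqrtr//.
have h a : 0 <= a ^+ 2 * ip x x + a *+ 2 * ip x y + ip y y.
  by rewrite -semi_ip_expand// ip_ge0//; exact: D_lin.
have [x0|x0] := eqVneq (ip x x) 0.
  rewrite x0 mul0r; have [->|xy0] := eqVneq (ip x y) 0; first by rewrite expr0n.
  (* The expansion is affine in a here, and equal to - 1 for this a. *)
  have := h (- ((ip y y + 1) / 2) / ip x y).
  by rewrite x0 mulr0 add0r mulrnAl mulfVK//; lra.
have := mulr_ge0 (ip_ge0 Dx) (h (- ip x y / ip x x)).
have : - ip x y / ip x x * ip x x = - ip x y by rewrite mulfVK.
move: (- ip x y / ip x x) => a; move: (ip x x) (ip y y) (ip x y) => q r t aq.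
have -> : q * (a ^+ 2 * q + a *+ 2 * t + r) = (a * q) ^+ 2 + a * q * t *+ 2 + q * r.
  by ring.
rewrite aq; lra.
Qed.

Lemma snormZ a x : D x -> snorm (a *: x) = `|a| * snorm x.
Proof.
move=> Dx; have Dax := semi_D_scale a Dx.
rewrite /snorm semi_ipZl// ipC semi_ipZl// mulrA -expr2 sqrtrM ?sqr_ge0//.
by rewrite sqrtr_sqr.
Qed.

Lemma ler_snormD x y : D x -> D y -> snorm (x + y) <= snorm x + snorm y.
Proof.
move=> Dx Dy; rewrite -(@ler_pXn2r _ 2)// ?nnegrE ?addr_ge0 ?snorm_ge0//.
rewrite snorm_sq; last exact: semi_D_add.
have := semi_ip_expand 1 Dx Dy; rewrite scale1r => ->.
rewrite sqrrD !snorm_sq// expr1n mul1r -mulr_natl mulr1.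
have := semi_cauchy_schwarz Dx Dy; rewrite ler_norml => /andP[_].
set p := snorm x * snorm y; lra.
Qed.

Lemma ler_snormB x y : D x -> D y -> snorm (x - y) <= snorm x + snorm y.
Proof.
move=> Dx Dy; apply: (le_trans (ler_snormD Dx _)).
  by rewrite -scaleN1r; exact: semi_D_scale.
by rewrite -scaleN1r snormZ// normrN1 mul1r.
Qed.

End SemiInner.

Section Euclidean.
Context {R : realType} {n : nat}.
Implicit Types (u v w : 'rV[R]_n).

Lemma edotC u v : edot u v = edot v u.
Proof. by apply: eq_bigr => i _; rewrite mulrC. Qed.

Lemma edot_lin a u v w : edot (a *: u + v) w = a * edot u w + edot v w.
Proof.
rewrite /edot mulr_sumr -big_split/=; apply: eq_bigr => i _.
by rewrite !mxE; ring.
Qed.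

Lemma edot_ge0 u : 0 <= edot u u.
Proof. by apply: sumr_ge0 => i _; rewrite -expr2 sqr_ge0. Qed.

Lemma enorm_ge0 u : 0 <= enorm u. Proof. exact: sqrtr_ge0. Qed.

Lemma enorm_sq u : enorm u ^+ 2 = edot u u.
Proof. by rewrite sqr_sqrtr// edot_ge0. Qed.

Lemma edotDl u v w : edot (u + v) w = edot u w + edot v w.
Proof. by have := edot_lin 1 u v w; rewrite scale1r mul1r. Qed.
Lemma edotZl a u w : edot (a *: u) w = a * edot u w.
Proof. by rewrite /edot mulr_sumr; apply: eq_bigr => i _; rewrite mxE mulrA. Qed.
Lemma edotBl u v w : edot (u - v) w = edot u w - edot v w.
Proof. by rewrite edotDl -scaleN1r edotZl mulN1r. Qed.
Lemma edotDr u v w : edot w (u + v) = edot w u + edot w v.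
Proof. by rewrite edotC edotDl !(edotC w). Qed.
Lemma edotZr a u w : edot w (a *: u) = a * edot w u.
Proof. by rewrite edotC edotZl !(edotC w). Qed.
Lemma edotBr u v w : edot w (u - v) = edot w u - edot w v.
Proof. by rewrite edotC edotBl !(edotC w). Qed.

Lemma ler_edot u v : `|edot u v| <= enorm u * enorm v.
Proof.
apply: (@semi_cauchy_schwarz _ _ setT (@edot R n)) => //.
- exact: edotC.
- by move=> *; exact: edot_lin.
- by move=> *; exact: edot_ge0.
Qed.

Lemma ler_enormD u v : enorm (u + v) <= enorm u + enorm v.
Proof.
apply: (@ler_snormD _ _ setT (@edot R n)) => //.
- exact: edotC.
- by move=> *; exact: edot_lin.
- by move=> *; exact: edot_ge0.
Qed.

Lemma enormZ a u : enorm (a *: u) = `|a| * enorm u.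
Proof.
apply: (@snormZ _ _ setT (@edot R n)) => //.
- exact: edotC.
- by move=> *; exact: edot_lin.
Qed.

Lemma enorm0 : enorm (0 : 'rV[R]_n) = 0.
Proof. by rewrite -(scale0r (0 : 'rV[R]_n)) enormZ normr0 mul0r. Qed.

Lemma rV_norm_coord u i : `|u 0 i| <= `|u|.
Proof.
rewrite [leRHS]/Num.norm/= mx_normrE; apply/bigmax_geP; right => /=.
by exists (0, i).
Qed.

Lemma rV_norm_le u (e : R) : 0 <= e -> (forall i, `|u 0 i| <= e) -> `|u| <= e.
Proof.
move=> e0 h; rewrite [leLHS]/Num.norm/= mx_normrE; apply/bigmax_leP; split => //.
by move=> [i j] _ /=; rewrite (ord1 i).
Qed.

Lemma coord_enorm u i : `|u 0 i| <= enorm u.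
Proof.
rewrite -sqrtr_sqr ler_wsqrtr// /edot (bigD1 i)//= -expr2 lerDl.
by apply: sumr_ge0 => j _; rewrite -expr2 sqr_ge0.
Qed.

Lemma norm_le_enorm u : `|u| <= enorm u.
Proof. by apply: rV_norm_le; [exact: enorm_ge0|exact: coord_enorm]. Qed.

Lemma enorm_le_sum u : enorm u <= \sum_(i < n) `|u 0 i|.
Proof.
have s0 : 0 <= \sum_(i < n) `|u 0 i| by apply: sumr_ge0.
rewrite -(@ler_pXn2r _ 2)// ?nnegrE ?enorm_ge0// enorm_sq /edot expr2 mulr_suml.
apply: ler_sum => i _; rewrite -expr2 -real_normK ?num_real// expr2.
by rewrite ler_wpM2l// (bigD1 i)//= lerDl sumr_ge0.
Qed.

Lemma enorm_le_norm u : enorm u <= n%:R * `|u|.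
Proof.
apply: (le_trans (enorm_le_sum u)).
rewrite (le_trans (ler_sum _ (fun i _ => rV_norm_coord u i)))//.
by rewrite sumr_const card_ord mulr_natl.
Qed.

Lemma enorm_eq0 u : enorm u = 0 -> u = 0.
Proof.
by move=> u0; apply/normr0_eq0/le_anti; rewrite normr_ge0 -u0 norm_le_enorm.
Qed.

End Euclidean.

(** * Pointwise Lipschitz functions and uniform continuity *)

(** The mean value inequality in a form which asks for no derivative: local
    increments along the segment are bounded by K, up to any e. *)
Lemma lipschitz_segment (R : realType) (W : normedModType R) (h : R -> W) (K : R) :
  (forall t e : R, 0 <= t <= 1 -> 0 < e ->
     \forall s \near t, 0 <= s <= 1 -> `|h s - h t| <= (K + e) * `|s - t|) ->
  `|h 1 - h 0| <= K.
Proof.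
move=> hK; apply/ler_addgt0Pr => e e0.
pose T := [set t : R | 0 <= t <= 1 /\ `|h t - h 0| <= (K + e) * t].
have T0 : T 0 by split; rewrite ?lexx ?ler01// subrr normr0 mulr0.
have supT : has_sup T by split; [exists 0|exists 1 => t [/andP[]]].
have c0 : 0 <= sup T by apply: sup_upper_bound.
have c1 : sup T <= 1 by apply: ge_sup; [exists 0|move=> t [/andP[]]].
have c01 : 0 <= sup T <= 1 by rewrite c0 c1.
have /nbhs_ballP[r /= r0 hr] := hK _ _ c01 e0.
have Tc : T (sup T).
  have [t Tt tr] := sup_adherent r0 supT.
  have ts : t <= sup T by apply: sup_upper_bound.
  case: (Tt) => t01 ht; split => //.
  have /hr/(_ t01) hh : ball (sup T) r t.
    by rewrite /ball/= ger0_norm ?subr_ge0//; lra.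
  rewrite (_ : h _ - _ = (h t - h 0) - (h t - h (sup T))); last first.
    by rewrite opprB [RHS]addrC addrA subrK.
  apply: (le_trans (ler_normB _ _)); apply: (le_trans (lerD ht hh)).
  by rewrite distrC ger0_norm ?subr_ge0// -mulrDr; have -> : t + (sup T - t) = sup T by ring.
have [c_lt1|c_ge1] := ltP (sup T) 1.
  pose s := Num.min 1 (sup T + r / 2).
  have cs : sup T < s by rewrite lt_min c_lt1 ltrDl divr_gt0.
  have s1 : s <= 1 by rewrite ge_min lexx.
  have sr : s <= sup T + r / 2 by rewrite ge_min lexx orbT.
  have s01 : 0 <= s <= 1 by rewrite s1 andbT (le_trans c0)// ltW.
  have /hr/(_ s01) hh : ball (sup T) r s.
    by rewrite /ball/= distrC ger0_norm ?subr_ge0 ?ltW//; lra.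
  have : T s.
    split=> //; rewrite -(subrK (h (sup T)) (h s)) -addrA.
    case: Tc => _ hc; apply: (le_trans (ler_normD _ _)).
    apply: (le_trans (lerD hh hc)).
    by rewrite [`|s - _|]ger0_norm ?subr_ge0 ?(ltW cs)// -mulrDr subrK.
  by move=> /(sup_upper_bound supT); rewrite leNgt cs.
have -> : 1 = sup T by apply/le_anti; rewrite c_ge1 c1.
case: Tc => _ hc; apply: (le_trans hc).
by have -> : sup T = 1 by [apply/le_anti; rewrite c_ge1 c1]; rewrite mulr1.
Qed.

Lemma lipschitz_convex (R : realType) (V W : normedModType R) (C : set V)
    (f : V -> W) (K : R) : 0 <= K ->
  (forall x y (t : R), C x -> C y -> 0 <= t <= 1 -> C (x + t *: (y - x))) ->
  (forall x e, C x -> 0 < e ->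
     \forall y \near x, C y -> `|f y - f x| <= (K + e) * `|y - x|) ->
  forall x y, C x -> C y -> `|f y - f x| <= K * `|y - x|.
Proof.
move=> K0 cvxC fK x y Cx Cy; set w := y - x.
have := @lipschitz_segment R W (fun t => f (x + t *: w)) (K * `|w|).
rewrite scale1r scale0r addr0 [x + w]addrC subrK; apply=> t e t01 e0.
pose e' := e / (`|w| + 1).
have w1 : 0 < `|w| + 1 by rewrite ltr_wpDl.
have e'0 : 0 < e' by rewrite divr_gt0.
have Cxt := cvxC _ _ _ Cx Cy t01.
have cg : (fun s : R => x + s *: w) @ t --> x + t *: w.
  by apply: cvgD; [exact: cvg_cst|apply: cvgZr_tmp; exact: cvg_id].
have : \forall s \near t, C (x + s *: w) -> `|f (x + s *: w) - f (x + t *: w)|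
    <= (K + e') * `|x + s *: w - (x + t *: w)|.
  exact: (cg _ (fK _ _ Cxt e'0)).
apply: filterS => s hs s01.
apply: (le_trans (hs (cvxC _ _ _ Cx Cy s01))).
rewrite (_ : _ - _ = (s - t) *: w); last first.
  by rewrite scalerBl opprD addrACA subrr add0r.
rewrite normrZ mulrA [leLHS]mulrAC ler_wpM2r//.
rewrite mulrDl lerD2l /e' mulrAC ler_pdivrMr// ler_wpM2l ?lerDl ?ltW//.
Qed.

(** Heine-Cantor: the near-covering form of compactness makes one radius serve
    at all points. *)
Lemma compact_unif (R : realType) (Z : pseudoMetricType R) (W : normedModType R)
    (K : set Z) (f : Z -> W) : compact K -> {within K, continuous f} ->
  forall e : R, 0 < e -> exists2 r : R, 0 < r &
    forall z z', K z -> K z' -> ball z r z' -> `|f z - f z'| < e.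
Proof.
move=> /compact_near_coveringP cK cf e e0.
pose P (r : R) z := K z -> forall z', K z' -> ball z r z' -> `|f z - f z'| < e.
have : \forall r \near (0 : R)^'+, K `<=` P r.
  apply: cK => z Kz.
  have e2 : 0 < e / 2 by rewrite divr_gt0.
  have hz : \forall y \near z, K y -> `|f z - f y| < e / 2.
    have /cvgrPdist_lt/(_ _ e2) := (subspace_continuousP K f).1 cf z Kz.
    by rewrite near_withinE.
  have /nbhs_ballP[r /= r0 hr] := hz.
  exists (ball z (r / 2), [set s | 0 < s < r / 2]) => /=.
    split; first by apply: nbhsx_ballx; rewrite divr_gt0.
    near=> t; apply/andP; split; near: t; first exact: nbhs_right_gt.
    by apply: nbhs_right_lt; rewrite divr_gt0.
  move=> [y s] /= [zy /andP[s0 sr]] Ky y' Ky' yy'.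
  have zy' : ball z r y'.
    by rewrite (splitr r); apply: ball_triangle zy _; apply: le_ball yy'; exact: ltW.
  have zy2 : ball z r y by apply: le_ball zy; lra.
  have := hr _ zy2 Ky; have := hr _ zy' Ky'; rewrite distrC => h1 h2.
  rewrite (_ : f y - f y' = - (f z - f y) + - (f y' - f z)); last first.
    by rewrite !opprB addrA subrK.
  by rewrite (splitr e) (le_lt_trans (ler_normD _ _))// !normrN [ltRHS]addrC ltrD// distrC -normrN opprB.
move=> h; near (0 : R)^'+ => r.
exists r => // z z' Kz Kz'; exact: (near h r _ z Kz Kz).
Unshelve. all: by end_near. Qed.

Lemma within_continuous_eq (T W : topologicalType) (S : set T) (f g : T -> W) :
  (forall x, S x -> f x = g x) -> {within S, continuous f} -> {within S, continuous g}.
Proof.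
move=> fg /(subspace_continuousP S f) cf.
apply/(subspace_continuousP S g) => x Sx; rewrite -fg//.
apply: cvg_trans (cf x Sx); apply: near_eq_cvg; rewrite near_withinE.
by apply: filterE => y Sy; rewrite fg.
Qed.

Lemma within_continuous_lin (R : realType) (T : topologicalType) (W : normedModType R)
    (S : set T) (a : R) (f g : T -> W) : {within S, continuous f} ->
  {within S, continuous g} -> {within S, continuous (fun x => a *: f x + g x)}.
Proof.
move=> /(subspace_continuousP S f) cf /(subspace_continuousP S g) cg.
apply/(subspace_continuousP S (fun x => a *: f x + g x)) => x Sx.
by apply: cvgD; [apply: cvgZl_tmp; exact: cf|exact: cg].
Qed.

Lemma within_continuous_fiber (T Z W : topologicalType) (B : set T) (K : set Z)
    (G : T -> Z -> W) m : {within B `*` K, continuous (fun z => G z.1 z.2)} -> B m ->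
  {within K, continuous (G m)}.
Proof.
move=> cG Bm; apply/(subspace_continuousP K (G m)) => z Kz N hN.
have [[A1 A2] [/= n1 n2] h] := (subspace_continuousP _ _).1 cG (m, z) (conj Bm Kz) N hN.
apply: filterS n2 => z' A2z' Kz'.
exact: (h (m, z') (conj (nbhs_singleton n1) A2z') (conj Bm Kz')).
Qed.

Lemma compact_within_bounded (R : realType) (Z : topologicalType) (W : normedModType R)
    (K : set Z) (f : Z -> W) : compact K -> {within K, continuous f} ->
  exists2 b : R, 0 <= b & forall z, K z -> `|f z| <= b.
Proof.
move=> cK cf; have /compact_bounded[b [_ hb]] := continuous_compact cf cK.
exists (`|b| + 1) => [|z Kz]; first by rewrite addr_ge0.
by apply: hb; [rewrite ltr_pwDr// ler_norm|exists z].
Qed.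

Lemma compact_net (R : realType) (Z : normedModType R) (K : set Z) (r : R) :
  compact K -> 0 < r ->
  exists s : seq Z, (forall z, z \in s -> K z) /\
    forall z, K z -> exists2 y, y \in s & ball y r z.
Proof.
move=> cK r0; have {}cK : cover_compact K by rewrite -compact_cover.
have [|z Kz|F sF cF] := cK Z K (fun z => (ball z r)^°).
- by move=> z _; exact: open_interior.
- by exists z => //; exact: nbhsx_ballx.
- exists (finmap.enum_fset F); split => [z zF|z /cF[y /= yF /interior_subset yz]].
    by have /set_mem := sF _ zF.
  by exists y.
Qed.

Lemma half_pow_small (R : realType) (K e : R) : 0 < e ->
  exists N, forall n, (N <= n)%N -> K * 2^-1 ^+ n <= e.
Proof.
move=> e0; have c : (K * 2^-1 ^+ n : R) @[n --> \oo] --> (K * 0 : R).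
  apply: cvgM; first exact: cvg_cst.
  by apply: cvg_expr; rewrite ger0_norm// invf_lt1// ltr1n.
have /cvgrPdist_le /(_ _ e0) [N _ hN] := c.
exists N => n Nn; have := hN n Nn; rewrite mulr0 sub0r normrN.
exact: le_trans (ler_norm _).
Qed.

(** * Limits along a free ultrafilter *)

(** Sequences in a compact set converge along an ultrafilter, which replaces
    the successive extraction of subsequences. *)
Lemma free_ultrafilter : exists2 U : set_system nat, UltraFilter U & \oo `<=` U.
Proof. by have [U [UU sU]] := @ultraFilterLemma nat \oo _; exists U. Qed.

Section Ultra.
Context {R : realType} (U : set_system nat) {UU : UltraFilter U}.

Lemma ultra_compact (Z : topologicalType) (K : set Z) (x : nat -> Z) :
  compact K -> (forall n, K (x n)) -> exists2 l, K l & x @ U --> l.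
Proof.
move=> cK Kx.
have KU : (x @ U) K by rewrite /fmap/=; apply: filterS (@filterT _ U _) => n _; exact: Kx.
have [l [Kl xl]] := cK (x @ U) _ KU; exists l => // B Bl.
have [//|UB] := in_ultra_setVsetC (x @^-1` B) UU.
by have [y [/= nBy By]] := xl (~` B) B UB Bl.
Qed.

Lemma ultra_bounded (x : nat -> R) (b : R) :
  (forall n, `|x n| <= b) -> exists l : R, x @ U --> l.
Proof.
move=> xb; have [|l _ xl] := @ultra_compact _ _ x (@segment_compact R (- b) b).
  by move=> n; rewrite /= in_itv/= -ler_norml.
by exists l.
Qed.

End Ultra.

(** * Square integrable functions *)

Section L2.
Context (dsp : measure_display) (T : measurableType dsp) (R : realType).
Variables (mu : {measure set T -> \bar R}) (M : set T).
Hypotheses (mM : measurable M) (finM : (mu M < +oo)%E).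
Implicit Types f g : T -> R.

Definition L2 : set (T -> R) := [set f : T -> R | measurable_fun M f /\
  mu.-integrable M (EFin \o (fun x => f x ^+ 2))].

Definition L2dot f g : R := \int[mu]_(x in M) (f x * g x).
Local Notation L2norm := (snorm L2dot).

Lemma measurable_funM f g : measurable_fun M f -> measurable_fun M g ->
  measurable_fun M (fun x => f x * g x).
Proof. by move=> mf mg; exact: measurable_realfun.measurable_funM. Qed.

Lemma integrable_cst (c : R) : mu.-integrable M (EFin \o (fun=> c)).
Proof.
apply/integrableP; split; first exact/measurable_EFinP/measurable_cst.
by rewrite integral_cst// lte_mul_pinfty.
Qed.

Lemma L2_dom f h : measurable_fun M f -> mu.-integrable M (EFin \o h) ->
  (forall x, M x -> `|f x| <= h x) -> mu.-integrable M (EFin \o f).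
Proof.
move=> mf ih fh; apply: le_integrable ih => //; first exact/measurable_EFinP.
by move=> x Mx /=; rewrite lee_fin (le_trans (fh x Mx))// ler_norm.
Qed.

Lemma L2_bounded f (b : R) : measurable_fun M f -> (forall x, M x -> `|f x| <= b) ->
  L2 f.
Proof.
move=> mf fb; split => //; apply: (@L2_dom _ (fun=> b ^+ 2)).
- by under eq_fun do rewrite expr2; exact: measurable_funM.
- exact: integrable_cst.
- by move=> x Mx; rewrite normrX lerXn2r ?nnegrE ?fb// (le_trans _ (fb x Mx)).
Qed.

Lemma L2_cst (c : R) : L2 (fun=> c).
Proof. by apply: (@L2_bounded _ `|c|). Qed.

Lemma L2_mul f g : L2 f -> L2 g -> mu.-integrable M (EFin \o (fun x => f x * g x)).
Proof.
move=> [mf if2] [mg ig2].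
apply: (@L2_dom _ (fun x => f x ^+ 2 + g x ^+ 2)).
- exact: measurable_funM.
- by have := integrableD mM if2 ig2.
- move=> x _; rewrite normrM -[f x ^+ 2]real_normK ?num_real//.
  rewrite -[g x ^+ 2]real_normK ?num_real//.
  have := sqr_ge0 (`|f x| - `|g x|); rewrite sqrrB.
  have := sqr_ge0 `|f x|; have := sqr_ge0 `|g x|; lra.
Qed.

Lemma L2_integrable f : L2 f -> mu.-integrable M (EFin \o f).
Proof.
by move=> /L2_mul /(_ (L2_cst 1)); under [X in _ \o X]eq_fun do rewrite mulr1.
Qed.

Lemma L2_lin (a : R) f g : L2 f -> L2 g -> L2 (a *: f + g).
Proof.
move=> Lf Lg; case: (Lf) => mf _; case: (Lg) => mg _.
have mafg : measurable_fun M (a *: f + g).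
  by apply: measurable_realfun.measurable_funD => //; apply: measurable_funM => //; exact: measurable_cst.
split => //; apply: (@L2_dom _ (fun x => a ^+ 2 * (f x * f x) + (2 * a) * (f x * g x)
    + g x * g x)).
- by under eq_fun do rewrite expr2; exact: measurable_funM.
- have h1 := integrableZl mM (a ^+ 2) (L2_mul Lf Lf).
  have h2 := integrableZl mM (2 * a) (L2_mul Lf Lg).
  by have := integrableD mM (integrableD mM h1 h2) (L2_mul Lg Lg).
- move=> x _; rewrite ger0_norm ?sqr_ge0//= le_eqVlt.
  apply/orP; left; apply/eqP.
  by rewrite (_ : (_ + g) x = a * f x + g x)//; ring.
Qed.

Lemma L2_0 : L2 0.
Proof. exact: (L2_cst 0). Qed.

Lemma L2dotC f g : L2dot f g = L2dot g f.
Proof. by apply: eq_Rintegral => x _; rewrite mulrC. Qed.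

Lemma L2dot_lin a f g h : L2 f -> L2 g -> L2 h ->
  L2dot (a *: f + g) h = a * L2dot f h + L2dot g h.
Proof.
move=> Lf Lg Lh; rewrite /L2dot -RintegralZl//; last exact: L2_mul.
rewrite -RintegralD//; last 2 first.
  by have := integrableZl mM a (L2_mul Lf Lh).
  exact: L2_mul.
by apply: eq_Rintegral => x _; rewrite mulrDl mulrA.
Qed.

Lemma L2dot_ge0 f : L2 f -> 0 <= L2dot f f.
Proof. by move=> _; apply: Rintegral_ge0 => x _; rewrite -expr2 sqr_ge0. Qed.

Lemma L2_cauchy_schwarz f g : L2 f -> L2 g -> `|L2dot f g| <= L2norm f * L2norm g.
Proof.
apply: (@semi_cauchy_schwarz _ _ L2 L2dot).
- exact: L2_lin. - exact: L2dotC. - exact: L2dot_lin.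
- exact: L2dot_ge0.
Qed.

Lemma L2normD f g : L2 f -> L2 g -> L2norm (f + g) <= L2norm f + L2norm g.
Proof.
apply: (@ler_snormD _ _ L2 L2dot).
- exact: L2_lin. - exact: L2dotC. - exact: L2dot_lin.
- exact: L2dot_ge0.
Qed.

Lemma L2normZ a f : L2 f -> L2norm (a *: f) = `|a| * L2norm f.
Proof.
apply: (@snormZ _ _ L2 L2dot).
- exact: L2_lin. - exact: L2_0. - exact: L2dotC. - exact: L2dot_lin.
Qed.

Lemma L2_sub f g : L2 f -> L2 g -> L2 (f - g).
Proof. by move=> Lf Lg; rewrite addrC -scaleN1r; exact: L2_lin. Qed.

Lemma L2_add f g : L2 f -> L2 g -> L2 (f + g).
Proof. by move=> Lf Lg; rewrite -[f]scale1r; exact: L2_lin. Qed.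

Lemma L2_scale a f : L2 f -> L2 (a *: f).
Proof. by move=> Lf; rewrite -[_ *: _]addr0; apply: L2_lin => //; exact: L2_0. Qed.

Lemma L2norm_sq f : L2 f -> L2norm f ^+ 2 = L2dot f f.
Proof. by move=> Lf; rewrite sqr_sqrtr// L2dot_ge0. Qed.

Lemma L2norm_sqE f : L2 f -> (\int[mu]_(x in M) (f x ^+ 2)%:E)%E = (L2norm f ^+ 2)%:E.
Proof.
move=> Lf; rewrite L2norm_sq// /L2dot /Rintegral fineK.
  by apply: eq_integral => x _; rewrite expr2.
have : mu.-integrable M (EFin \o (fun x => f x * f x)) by exact: L2_mul.
by move=> /(integrable_fin_num mM).
Qed.

Lemma L2norm0_ae f : L2 f -> L2norm f = 0 -> {ae mu, forall x, M x -> f x = 0}.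
Proof.
move=> Lf f0; have [mf if2] := Lf.
have i0 : (\int[mu]_(x in M) (f x ^+ 2)%:E = 0)%E.
  by rewrite L2norm_sqE// f0 expr0n.
have [h _] := @ae_eq_integral_abs _ _ _ mu M mM (EFin \o (fun x => f x ^+ 2)) (measurable_int _ if2).
have := h _; rewrite /ae_eq => h'.
apply: filterS (h' _) => [x hx Mx|].
  by have /= [/eqP] := hx Mx; rewrite sqrf_eq0 => /eqP.
by rewrite -i0; apply: eq_integral => x _; rewrite /= ger0_norm ?sqr_ge0.
Qed.

Lemma L2_ae0_dot f g : L2 f -> L2 g -> {ae mu, forall x, M x -> f x = 0} -> L2dot f g = 0.
Proof.
move=> [mf _] [mg _] f0; rewrite /L2dot /Rintegral (@ae_eq_integral _ _ _ mu M (cst 0%E)).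
- by rewrite integral0.
- exact: mM.
- by apply/measurable_EFinP; exact: measurable_funM.
- exact: measurable_cst.
- by apply: filterS f0 => x fx Mx; rewrite fx//= mul0r.
Qed.

Lemma L2norm_le_cst f (b : R) : measurable_fun M f -> 0 <= b ->
  (forall x, M x -> `|f x| <= b) -> L2norm f <= Num.sqrt (fine (mu M)) * b.
Proof.
move=> mf b0 fb.
have Lf := L2_bounded mf fb.
rewrite -[b in leRHS](@ger0_norm _ b)// -sqrtr_sqr -sqrtrM ?fine_ge0// ler_wsqrtr//.
rewrite mulrC -Rintegral_cst//; apply: le_Rintegral => //.
- exact: L2_mul.
- exact: integrable_cst.
- move=> x Mx; rewrite -expr2 -real_normK ?num_real//.
  by rewrite lerXn2r ?nnegrE ?fb.
Qed.

Lemma L2_norm_fun f : L2 f -> L2 (fun x => `|f x|).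
Proof.
move=> [mf if2]; split; first exact: measurableT_comp.
by under [X in _ \o X]eq_fun do rewrite real_normK ?num_real//.
Qed.

Lemma L1_le_L2 f : L2 f ->
  \int[mu]_(x in M) `|f x| <= Num.sqrt (fine (mu M)) * L2norm f.
Proof.
move=> Lf; have := L2_cauchy_schwarz (L2_norm_fun Lf) (L2_cst 1).
rewrite ger0_norm; last by apply: Rintegral_ge0 => x _; rewrite mulr1.
rewrite [X in _ <= X -> _]mulrC => h; move: (h).
rewrite (_ : L2dot _ _ = \int[mu]_(x in M) `|f x|); last first.
  by apply: eq_Rintegral => x _; rewrite mulr1.
move=> /le_trans; apply; rewrite (_ : L2norm (fun x => `|f x|) = L2norm f).
  rewrite ler_wpM2r ?sqrtr_ge0// /snorm ler_wsqrtr//.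
  by rewrite /L2dot Rintegral_cst// !mul1r.
congr Num.sqrt; apply: eq_Rintegral => x _; rewrite -!expr2 real_normK ?num_real//.
Qed.

Lemma limn_einf_le (u : (\bar R)^nat) (c : \bar R) :
  (forall n, (u n <= c)%E) -> (limn_einf u <= c)%E.
Proof.
move=> uc; rewrite limn_einf_lim; apply: lime_le; first exact: is_cvg_einfs.
apply: nearW => n; apply: (le_trans _ (uc n)).
by apply: ereal_inf_lbound; exists n => /=.
Qed.

(** Riesz-Fischer. The limit is a pointwise limit outside the null set where the
    series of increments diverges; the error is bounded by Fatou's lemma. *)
Lemma L2_complete (f : nat -> T -> R) : (forall n, L2 (f n)) ->
  (forall n, L2norm (f n.+1 - f n) <= 2^-1 ^+ n) ->
  exists2 g, L2 g & forall n, L2norm (g - f n) <= 2 * 2^-1 ^+ n.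
Proof.
move=> Lf fS.
pose h n x : \bar R := `|f n.+1 x - f n x|%:E.
have LS n : L2 (f n.+1 - f n) by exact: L2_sub.
have mh n : measurable_fun M (h n).
  by apply/measurable_EFinP; apply: (L2_norm_fun (LS n)).1.
have h0 n x : M x -> (0 <= h n x)%E by move=> _; rewrite lee_fin.
pose G x := (\sum_(0 <= n <oo) h n x)%E.
have mG : measurable_fun M G.
  by apply: (@ge0_emeasurable_sum _ _ _ _ h xpredT) => [k x Mx _|k _]; [exact: h0|exact: mh].
have iG : (\int[mu]_(x in M) G x < +oo)%E.
  rewrite /G integral_nneseries//.
  pose s := Num.sqrt (fine (mu M)).
  apply: (@le_lt_trans _ _ (\sum_(0 <= n <oo) (s * 2^-1 ^+ n)%:E)%E).
    apply: lee_nneseries => [n *|n *].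
      by apply: integral_ge0 => x Mx; exact: h0.
    have := L1_le_L2 (LS n); rewrite -lee_fin /Rintegral fineK; last first.
      apply: (integrable_fin_num mM).
      exact: (L2_integrable (L2_norm_fun (LS n))).
    move=> /le_trans; apply; rewrite lee_fin ler_wpM2l ?sqrtr_ge0//.
  apply: (@le_lt_trans _ _ (2 * s)%:E); last exact: ltry.
  apply: lime_le.
    by apply: is_cvg_nneseries => k _ _; rewrite lee_fin mulr_ge0 ?sqrtr_ge0 ?exprn_ge0.
  apply: nearW => n; rewrite sumEFin lee_fin -mulr_sumr mulrC ler_wpM2r ?sqrtr_ge0//.
  suff -> : \sum_(0 <= i < n) 2^-1 ^+ i = 2 - 2 * 2^-1 ^+ n :> R.
    by rewrite gerBl mulr_ge0// exprn_ge0.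
  elim: n => [|n IH]; first by rewrite big_nil expr0; ring.
  by rewrite big_nat_recr//= IH exprS; lra.
have aeG : {ae mu, forall x, M x -> G x \is a fin_num}.
  apply: integrable_ae => //; apply/integrableP; split => //.
  rewrite (_ : (\int[mu]_(x in M) _)%E = (\int[mu]_(x in M) G x)%E)//.
  apply: eq_integral => x /set_mem Mx; rewrite gee0_abs//.
  by apply: nneseries_ge0 => n _ _; exact: h0.
have cf x : M x -> G x \is a fin_num -> cvgn (f ^~ x).
  move=> Mx Gx; pose u := telescope (f ^~ x).
  have -> : f ^~ x = (fun n => f 0%N x + series u n).
    by apply/funext => n; rewrite [LHS](eq_sum_telescope (f ^~ x)).
  apply: is_cvgD; first exact: is_cvg_cst.
  apply: normed_cvg; apply: nondecreasing_is_cvgn.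
    by apply/nondecreasing_seqP => n; rewrite /= seriesSr lerDl.
  exists (fine (G x)) => _ [n _ <-]; rewrite -lee_fin fineK// /series/= -sumEFin.
  by apply: (nneseries_lim_ge n) => *; rewrite lee_fin.
have geo n k : L2norm (f (n + k)%N - f n) <= 2 * 2^-1 ^+ n.
  suff : L2norm (f (n + k)%N - f n) <= 2 * 2^-1 ^+ n - 2 * 2^-1 ^+ (n + k).
    by move=> /le_trans; apply; rewrite gerBl mulr_ge0// exprn_ge0.
  elim: k => [|k IH].
    rewrite addn0 !subrr /snorm (_ : L2dot 0 0 = 0) ?sqrtr0//.
    exact: (semi_ip0l L2_0 L2dot_lin L2_0).
  rewrite -(subrK (f (n + k)%N) (f _)) -addrA addnS.
  apply: (le_trans (L2normD (LS _) _)); first exact: L2_sub.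
  apply: (le_trans (lerD (fS _) IH)); rewrite exprS; lra.
pose N := [set x | M x /\ G x \is a fin_num].
have mN : measurable N by exact: emeasurable_fin_num.
(* Cut off outside N, for the pointwise limit to exist on all of M. *)
pose f' n x := f n x * \1_N x.
pose g x := limn (f' ^~ x).
have cvf' x : M x -> f' ^~ x @ \oo --> g x.
  move=> Mx; suff : cvgn (f' ^~ x) by [].
  have [Nx|Nx] := pselect (N x); last first.
    rewrite (_ : f' ^~ x = fun=> 0); first exact: is_cvg_cst.
    by apply/funext => n; rewrite /f' indicE memNset// mulr0.
  rewrite (_ : f' ^~ x = f ^~ x); first by apply: cf; case: Nx.
  by apply/funext => n; rewrite /f' indicE mem_set// mulr1.
have aef : {ae mu, forall x, M x -> forall n, f' n x = f n x}.
  move: aeG; apply: filterS => x Gx Mx n; rewrite /f' indicE mem_set ?mulr1//.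
  by split => //; exact: Gx.
have mf' n : measurable_fun M (f' n).
  by apply: measurable_funM; [exact: (Lf n).1|exact: measurable_indic].
have mg : measurable_fun M g.
  exact: (measurable_realfun.measurable_fun_cvg mf' cvf').
have gf n : (\int[mu]_(x in M) ((g x - f n x) ^+ 2)%:E <= ((2 * 2^-1 ^+ n) ^+ 2)%:E)%E.
  pose u l x := ((f' (n + l)%N x - f n x) ^+ 2)%:E.
  rewrite (_ : (\int[mu]_(x in M) _)%E =
      (\int[mu]_(x in M) limn_einf (u ^~ x))%E); last first.
    apply: eq_integral => x /set_mem Mx; apply/esym.
    apply: (cvg_limn_einf_sup _).1; apply: cvg_EFin; first exact: nearW.
    have : f' (n + l)%N x @[l --> \oo] --> g x.
      by have := cvf' _ Mx; rewrite -(cvg_shiftn n); under eq_fun do rewrite addnC.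
    move=> c1; rewrite (_ : _ \o _ = fun l => (f' (n + l)%N x - f n x) * (f' (n + l)%N x - f n x)).
      by rewrite expr2; apply: cvgM; apply: cvgB => //; exact: cvg_cst.
    by apply/funext => l; rewrite /u/= expr2.
  have mu_ l : measurable_fun M (u l).
    apply/measurable_EFinP; under eq_fun do rewrite expr2.
    by apply: measurable_funM; apply: measurable_funB => //; exact: (Lf n).1.
  apply: (le_trans (fatou _ _ _ _)) => //.
    by move=> l x _; rewrite lee_fin sqr_ge0.
  apply: limn_einf_le => l.
  rewrite (_ : (\int[mu]_(x in M) _)%E = (L2norm (f (n + l)%N - f n) ^+ 2)%:E).
    by rewrite lee_fin lerXn2r// nnegrE ?sqrtr_ge0// mulr_ge0// exprn_ge0.
  rewrite -L2norm_sqE; last exact: L2_sub.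
  apply: ae_eq_integral => //.
    apply/measurable_EFinP; under eq_fun do rewrite expr2.
    by apply: measurable_funM; apply: measurable_funB; exact: (Lf _).1.
  by move: aef; apply: filterS => x hx Mx; rewrite /u hx.
have Lgf n : L2 (g - f n).
  have mgf : measurable_fun M (g - f n) by apply: measurable_funB => //; exact: (Lf n).1.
  split => //; apply/integrableP; split.
    apply/measurable_EFinP; under eq_fun do rewrite expr2.
    exact: measurable_funM.
  apply: (@le_lt_trans _ _ ((2 * 2^-1 ^+ n) ^+ 2)%:E); last exact: ltry.
  apply: le_trans (gf n); rewrite le_eqVlt; apply/orP; left; apply/eqP.
  by apply: eq_integral => x _; rewrite gee0_abs// lee_fin sqr_ge0.
exists g => [|n]; first by rewrite -(subrK (f 0%N) g); apply: L2_add.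
have := gf n; rewrite (_ : (\int[mu]_(x in M) _)%E = (L2norm (g - f n) ^+ 2)%:E).
  by rewrite lee_fin ler_pXn2r// nnegrE ?sqrtr_ge0// mulr_ge0// exprn_ge0.
by rewrite -L2norm_sqE.
Qed.

End L2.

(** * Charts and tangential gradients *)

Lemma diff_eps (R : realType) (V W : normedModType R) (f : V -> W) (x : V) :
  differentiable f x -> forall e : R, 0 < e ->
  \forall y \near x, `|f y - f x - 'd f x (y - x)| <= e * `|y - x|.
Proof.
move=> /diff_locallyP [_ /eqaddoP h] e e0; apply/nbhs0P.
have := h e e0; apply: filterS => u /=.
by rewrite [x + u]addrC addrK opprD addrA !fctE.
Qed.

Lemma derive_compE (R : realType) (V W Z : normedModType R) (f : V -> W) (g : W -> Z)
    (x v : V) : differentiable f x -> differentiable g (f x) ->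
  'D_v (g \o f) x = 'D_('D_v f x) g (f x).
Proof.
move=> df dg; have dgf := differentiable_comp df dg.
by rewrite !deriveE// diff_comp.
Qed.

Lemma mul_div_le (R : realType) (a c : R) : 0 <= a -> 0 <= c -> a * (c / (a + 1)) <= c.
Proof.
by move=> a0 c0; rewrite mulrA ler_pdivrMr ?ltr_wpDl// mulrC ler_wpM2l// lerDl.
Qed.

Section Charts.
Context {R : realType} {d : nat}.
Implicit Types (M U W : set 'rV[R]_d) (x v : 'rV[R]_d).

(** A tangent vector, up to sign, is the velocity of a curve drawn on M; at a
    boundary point only one of the two signs may point into M. *)
Lemma tangent_curve (k : nat) M x v : (0 < d)%N -> M x -> tangent k M x v ->
  exists (s : R) (g : R -> 'rV[R]_d), (s = 1 \/ s = -1) /\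
    forall e : R, 0 < e -> \forall t \near 0^'+,
      M (g t) /\ enorm (g t - x - t *: (s *: v)) <= e * t.
Proof.
move=> d0 Mx [U [phi [[W [psi [oU oW C1phi C1psi [phiK psiK sl]]]] Ux tv]]].
have [dphi _] := C1phi _ Ux.
have [Wz psiz] := phiK _ Ux.
have [dpsi _] := C1psi _ Wz.
set z0 := phi x in Wz psiz dpsi *; set w := 'D_v phi x in tv *.
pose i0 := Ordinal d0.
pose s : R := if 0 <= w 0 i0 then 1 else -1.
have s1 : s = 1 \/ s = -1 by rewrite /s; case: ifP; [left|right].
have sw : 0 <= s * w 0 i0.
  rewrite /s; case: ifPn; first by rewrite mul1r.
  by rewrite -ltNge mulN1r oppr_ge0 => /ltW.
have dpw : 'D_w psi z0 = v.
  rewrite /w -derive_compE// (@near_eq_derive _ _ _ (psi \o phi) id).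
    by rewrite derive_id.
  by apply: filterS (open_nbhs_nbhs (conj oU Ux)) => y Uy; case: (phiK _ Uy).
exists s, (fun t => psi (z0 + t *: (s *: w))); split => // e e0.
have c : (fun t : R => z0 + t *: (s *: w)) @ 0^'+ --> z0.
  rewrite -[X in _ --> X]addr0 -(scale0r (s *: w)); apply: cvgD; first exact: cvg_cst.
  by apply: cvgZr_tmp; apply: cvg_at_right_filter; exact: cvg_id.
have Wt : \forall t \near 0^'+, W (z0 + t *: (s *: w)).
  exact: (c _ (open_nbhs_nbhs (conj oW Wz))).
have dn0 : 0 < d%:R :> R by rewrite ltr0n.
have e'0 : 0 < e / (`|s *: w| + 1) / d%:R by rewrite !divr_gt0// ltr_wpDl.
have ht : \forall t \near 0^'+, enorm (psi (z0 + t *: (s *: w)) - x - t *: (s *: v)) <= e * t.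
  have : \forall t \near 0^'+, `|psi (z0 + t *: (s *: w)) - psi z0 - 'd psi z0 (z0 + t *: (s *: w) - z0)| <=
     e / (`|s *: w| + 1) / d%:R * `|z0 + t *: (s *: w) - z0|.
    exact: (c _ (diff_eps dpsi e'0)).
  move=> h; near=> t.
  have t0 : 0 < t by near: t; exact: nbhs_right_gt.
  have : `|psi (z0 + t *: (s *: w)) - psi z0 - 'd psi z0 (z0 + t *: (s *: w) - z0)| <=
     e / (`|s *: w| + 1) / d%:R * `|z0 + t *: (s *: w) - z0| by near: t; exact: h.
  have -> : z0 + t *: (s *: w) - z0 = t *: (s *: w) by rewrite addrC addKr.
  have -> : 'd psi z0 (t *: (s *: w)) = t *: (s *: v).
    by rewrite linearZ/= linearZ/= -deriveE// dpw.
  rewrite psiz (normrZ t) (gtr0_norm t0) => h'.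
  apply: (le_trans (enorm_le_norm _)); apply: (le_trans (ler_wpM2l (ltW dn0) h')).
  rewrite mulrA [d%:R * _]mulrC divfK ?gt_eqF// mulrCA.
  rewrite [_ * `|s *: w|]mulrC [e * t]mulrC.
  by rewrite ler_wpM2l ?(ltW t0)// mul_div_le// ltW.
near=> t; split; last by near: t.
have Wzt : W (z0 + t *: (s *: w)) by near: t.
have t0 : 0 < t by near: t; exact: nbhs_right_gt.
have [Ut phipsi] := psiK _ Wzt.
rewrite (sl _ Ut) phipsi => i; have [z1 z2] := (sl _ Ux).1 Mx i.
split=> [i_0|ki]; rewrite !mxE.
  rewrite addr_ge0 ?z1//; apply: mulr_ge0; first exact: ltW.
  by rewrite (_ : i = i0)//; exact: val_inj.
by rewrite z2// tv// !mulr0 addr0.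
Unshelve. all: by end_near. Qed.

Lemma le0_of_scaled (K L : R) : 0 <= K -> (forall e, 0 < e -> L <= e * K) -> L <= 0.
Proof.
move=> K0 h; apply/ler_addgt0Pr => e e0; rewrite add0r.
apply: (le_trans (h (e / (K + 1)) _)); first by rewrite divr_gt0// ltr_wpDl.
by rewrite mulrC mul_div_le// ltW.
Qed.

(** The form is evaluated along a curve with velocity v, up to sign. *)
Lemma tangent_form0 (k : nat) M x v (l : 'rV[R]_d -> R) (K : R) : (0 < d)%N ->
  M x -> tangent k M x v ->
  (forall a u w, l (a *: u + w) = a * l u + l w) ->
  (forall u, `|l u| <= K * enorm u) ->
  (forall e : R, 0 < e -> \forall y \near x, M y ->
     `|l (y - x)| <= e * enorm (y - x)) ->
  l v = 0.
Proof.
move=> d0 Mx tv ll lK hl; have [s [g [s1 hg]]] := tangent_curve d0 Mx tv.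
have K0 : 0 <= K * enorm v by apply: le_trans (lK v).
have lv (a : R) u : l (a *: u) = a * l u.
  have l0 : l 0 = 0 by have := ll 1 0 0; rewrite scale1r addr0 mul1r; lra.
  by rewrite -[_ *: _]addr0 ll l0 addr0.
have ls : `|l (s *: v)| = `|l v|.
  by rewrite lv normrM; case: s1 => ->; rewrite ?normrN normr1 mul1r.
have es : enorm (s *: v) = enorm v.
  by rewrite enormZ; case: s1 => ->; rewrite ?normrN normr1 mul1r.
apply/eqP; rewrite -normr_le0.
apply: (@le0_of_scaled (`|K| + enorm v + 1)).
  by rewrite addr_ge0// addr_ge0// enorm_ge0.
move=> e e_gt0.
wlog e1 : e e_gt0 / e <= 1.
  move=> H; have [/H|/ltW e1] := leP e 1; first exact.
  apply: (le_trans (H 1 ltr01 (lexx _))); rewrite ler_wpM2r//.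
  by rewrite addr_ge0// addr_ge0// enorm_ge0.
have gx : g t @[t --> 0^'+] --> x.
  apply/cvgrPdist_le => e' e'0; near=> t.
  have t0 : 0 < t by near: t; exact: nbhs_right_gt.
  have [_ h] : M (g t) /\ enorm (g t - x - t *: (s *: v)) <= 1 * t.
    by near: t; exact: hg.
  rewrite distrC; apply: (le_trans (norm_le_enorm _)).
  rewrite -(subrK (t *: (s *: v)) (g t - x)).
  apply: (le_trans (ler_enormD _ _)); apply: (le_trans (lerD h (lexx _))).
  rewrite enormZ es gtr0_norm// mul1r.
  have -> : t + t * enorm v = t * (1 + enorm v) by ring.
  rewrite -ler_pdivlMr ?ltr_pwDl ?enorm_ge0//; near: t.
  by apply: nbhs_right_le; rewrite divr_gt0// ltr_pwDl ?enorm_ge0.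
have lg := gx _ (hl e e_gt0).
near (0 : R)^'+ => t.
have t0 : 0 < t by near: t; exact: nbhs_right_gt.
have [Mg h] : M (g t) /\ enorm (g t - x - t *: (s *: v)) <= e * t.
  by near: t; exact: hg.
have lg' : `|l (g t - x)| <= e * enorm (g t - x).
  have : M (g t) -> `|l (g t - x)| <= e * enorm (g t - x) by near: t; exact: lg.
  exact.
have gn : enorm (g t - x) <= t * (1 + enorm v).
  rewrite -(subrK (t *: (s *: v)) (g t - x)).
  apply: (le_trans (ler_enormD _ _)); apply: (le_trans (lerD h (lexx _))).
  rewrite enormZ es gtr0_norm// mulrDr mulr1 lerD2r.
  by rewrite ler_piMl// ltW.
have : t * `|l v| <= t * (e * (`|K| + enorm v + 1)).
  rewrite -ls -[t in leLHS]gtr0_norm// -normrM -lv.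
  rewrite (_ : t *: (s *: v) = (-1) *: (g t - x - t *: (s *: v)) + (g t - x)); last first.
    by rewrite scaleN1r opprB subrK.
  rewrite ll mulN1r; apply: (le_trans (ler_normD _ _)); rewrite normrN.
  have h1 : `|l (g t - x - t *: (s *: v))| <= `|K| * (e * t).
    apply: (le_trans (lK _)); apply: (@le_trans _ _ (`|K| * enorm (g t - x - t *: (s *: v)))).
      by rewrite ler_wpM2r ?enorm_ge0// ler_norm.
    by rewrite ler_wpM2l.
  have h2 : e * enorm (g t - x) <= e * (t * (1 + enorm v)) by rewrite ler_wpM2l// ltW.
  apply: (le_trans (lerD h1 (le_trans lg' h2))).
  by rewrite le_eqVlt; apply/orP; left; apply/eqP; ring.
by rewrite ler_pM2l.
Unshelve. all: by end_near. Qed.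

(** The last coordinates of a chart are constant along M, so that their
    differentials are forms to which tangent_form0 applies. *)
Lemma tangent_chart (k : nat) M x v U phi : (0 < d)%N -> M x -> tangent k M x v ->
  slice_chart k M U phi -> U x ->
  forall i : 'I_d, (k <= i)%N -> ('D_v phi x) 0 i = 0.
Proof.
move=> d0 Mx tv [W [psi [oU oW C1phi C1psi [phiK psiK sl]]]] Ux i ki.
have [dphi _] := C1phi _ Ux; rewrite deriveE//.
have [K K0 hK] := linear_lipschitz (diff_continuous dphi).
apply: (@tangent_form0 k M x v (fun u => 'd phi x u 0 i) K) => //.
- by move=> a u w; rewrite linearP !mxE.
- move=> u; apply: (le_trans (rV_norm_coord _ _)); apply: (le_trans (hK u)).
  by rewrite ler_pM2l// norm_le_enorm.
move=> e e0; have := diff_eps dphi e0; have := open_nbhs_nbhs (conj oU Ux).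
apply: filterS2 => y Uy hy My.
have [_ y0] := (sl _ Uy).1 My i; have [_ x0] := (sl _ Ux).1 Mx i.
have := le_trans (rV_norm_coord _ i) hy; rewrite !mxE y0// x0// subrr add0r normrN.
by move=> /le_trans; apply; rewrite ler_pM2l// norm_le_enorm.
Qed.

Lemma tangent_lin (k : nat) M x (a : R) v w : compact_submanifold k M -> M x ->
  tangent k M x v -> tangent k M x w -> tangent k M x (a *: v + w).
Proof.
move=> [/andP[k0 kd] _ hM] Mx tv tw; have d0 := leq_trans k0 kd.
have [U [phi [ch Ux]]] := hM _ Mx; exists U, phi; split => // i ki.
have tvi := tangent_chart d0 Mx tv ch Ux ki.
have twi := tangent_chart d0 Mx tw ch Ux ki.
case: ch => [W [psi [_ _ C1phi _ _]]]; have [dphi _] := C1phi _ Ux.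
by rewrite deriveE// linearP !mxE -!deriveE// tvi twi mulr0 addr0.
Qed.

Lemma tangent0 (k : nat) M x : compact_submanifold k M -> M x -> tangent k M x 0.
Proof.
move=> [_ _ hM] Mx; have [U [phi [ch Ux]]] := hM _ Mx; exists U, phi; split => // i ki.
by rewrite derive0 mxE.
Qed.

(** First order expansion along M, without any tangency of the gradient. *)
Definition expands M (f : 'rV[R]_d -> R) x (g : 'rV[R]_d) : Prop :=
  forall e : R, 0 < e -> \forall y \near x, M y ->
    `|f y - f x - edot g (y - x)| <= e * enorm (y - x).

Lemma expands_lin M f f' x g g' (a : R) : expands M f x g -> expands M f' x g' ->
  expands M (fun y => a * f y + f' y) x (a *: g + g').
Proof.
move=> h h' e e0.
have e'0 : 0 < e / 2 / (`|a| + 1) by rewrite !divr_gt0// ltr_wpDl.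
have e''0 : 0 < e / 2 by rewrite divr_gt0.
have := h _ e'0; have := h' _ e''0; apply: filterS2 => y hy' hy My.
have {}hy := hy My; have {}hy' := hy' My.
rewrite edotDl edotZl (_ : _ - _ = a * (f y - f x - edot g (y - x)) +
  (f' y - f' x - edot g' (y - x))); last by ring.
apply: (le_trans (ler_normD _ _)); rewrite [in leRHS](splitr e) mulrDl lerD//.
rewrite normrM; apply: (le_trans (ler_wpM2l (normr_ge0 _) hy)).
by rewrite mulrA ler_wpM2r ?enorm_ge0// mul_div_le// ltW.
Qed.

Lemma expands_near M f x g : expands M f x g ->
  forall e : R, 0 < e -> \forall y \near x, M y -> `|f y - f x| <= e.
Proof.
move=> h e e0; have := h 1 ltr01.
have c : \forall y \near x, enorm (y - x) * (1 + enorm g) <= e.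
  have e'0 : 0 < e / (1 + enorm g) / (d%:R + 1).
    by rewrite !divr_gt0// ?ltr_pwDl ?ltr_wpDl ?enorm_ge0.
  have : \forall y \near x, `|x - y| < e / (1 + enorm g) / (d%:R + 1).
    by apply/nbhs_normP; exists (e / (1 + enorm g) / (d%:R + 1)).
  apply: filterS => y /ltW yx; rewrite -ler_pdivlMr ?ltr_pwDl ?enorm_ge0//.
  apply: (le_trans (enorm_le_norm _)); rewrite distrC.
  apply: (le_trans (ler_wpM2l (ler0n _ _) yx)); rewrite mul_div_le ?ler0n//.
  by rewrite divr_ge0 ?(ltW e0)// addr_ge0 ?enorm_ge0.
move: c; apply: filterS2 => y c hy My.
rewrite -(subrK (edot g (y - x)) (f y - f x)).
apply: (le_trans (ler_normD _ _)); apply: (le_trans (lerD (hy My) (ler_edot _ _))).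
by rewrite -mulrDl mulrC.
Qed.

Lemma expands_sqr M f x g : expands M f x g ->
  expands M (fun y => f y ^+ 2) x ((2 * f x) *: g).
Proof.
move=> h e e0.
have c0 : 0 <= 1 + enorm g by rewrite addr_ge0 ?enorm_ge0.
have b0 : 0 <= 2 * `|f x| by rewrite mulr_ge0.
have e20 : 0 < e / 2 by rewrite divr_gt0.
have e10 : 0 < e / 2 / (1 + enorm g + 1) by rewrite divr_gt0// ltr_wpDl.
have e30 : 0 < e / 2 / (2 * `|f x| + 1) by rewrite divr_gt0// ltr_wpDl.
move: (h _ ltr01) (h _ e30) (expands_near h e10); apply: filterS3 => y h1 h2 h3 My.
rewrite edotZl (_ : _ - _ = (f y - f x) * (f y - f x) +
  2 * f x * (f y - f x - edot g (y - x))); last by ring.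
apply: (le_trans (ler_normD _ _)); rewrite [in leRHS](splitr e) [leRHS]mulrDl !normrM lerD//.
  have : `|f y - f x| <= (1 + enorm g) * enorm (y - x).
    rewrite -(subrK (edot g (y - x)) (f y - f x)) mulrDl.
    exact: (le_trans (ler_normD _ _) (lerD (h1 My) (ler_edot _ _))).
  move=> /(ler_pM (normr_ge0 _) (normr_ge0 _) (h3 My)) /le_trans; apply.
  by rewrite mulrA ler_wpM2r ?enorm_ge0// mulrC mul_div_le// ltW.
rewrite normr_nat; apply: (le_trans (ler_wpM2l b0 (h2 My))).
by rewrite mulrA ler_wpM2r ?enorm_ge0// mul_div_le// ltW.
Qed.

(** The difference g - g' is a tangent vector on which the form it defines
    vanishes. *)
Lemma expands_unique k M f x g g' : (0 < d)%N -> M x -> tangent k M x g -> tangent k M x g' ->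
  expands M f x g -> expands M f x g' -> g = g'.
Proof.
move=> d0 Mx tg tg' h h'; apply/eqP; rewrite -subr_eq0; apply/eqP.
apply: enorm_eq0; rewrite /enorm; suff -> : edot (g - g') (g - g') = 0 by rewrite sqrtr0.
have kill v : tangent k M x v -> edot (g - g') v = 0.
  move=> tv; apply: (@tangent_form0 k M x v (edot (g - g')) (enorm (g - g'))) => //.
  - by move=> a u w; rewrite edotDr edotZr.
  - by move=> u; exact: ler_edot.
  move=> e e0; have e20 : 0 < e / 2 by rewrite divr_gt0.
  have := h _ e20; have := h' _ e20; apply: filterS2 => y hy hy' My.
  rewrite edotBl (_ : _ - _ = (f y - f x - edot g' (y - x)) - (f y - f x - edot g (y - x))).
    apply: (le_trans (ler_normB _ _)); apply: (le_trans (lerD (hy My) (hy' My))).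
    by rewrite -mulrDl -splitr.
  by ring.
by rewrite edotBr !kill// subrr.
Qed.

Lemma tgradP k M f x g : (0 < d)%N -> M x -> is_tgrad k M f x g -> tgrad k M f x = g.
Proof.
move=> d0 Mx hg; rewrite /tgrad; case: xgetP => [g' _ hg'|/(_ g)//].
by case: hg hg' => tg h [tg' h']; exact: (expands_unique d0 Mx tg' tg h' h).
Qed.

Lemma is_tgrad_tgrad k M f x : tdifferentiable k M f x -> is_tgrad k M f x (tgrad k M f x).
Proof. by move=> [g hg]; rewrite /tgrad; case: xgetP => [g' _ //|/(_ g)]. Qed.

Lemma is_tgrad_lin k M f f' x g g' (a : R) : compact_submanifold k M -> M x ->
  is_tgrad k M f x g -> is_tgrad k M f' x g' ->
  is_tgrad k M (fun y => a * f y + f' y) x (a *: g + g').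
Proof.
move=> hM Mx [tg h] [tg' h']; split; first exact: tangent_lin.
exact: expands_lin.
Qed.

Lemma is_tgrad_sqr k M f x g : compact_submanifold k M -> M x ->
  is_tgrad k M f x g -> is_tgrad k M (fun y => f y ^+ 2) x ((2 * f x) *: g).
Proof.
move=> hM Mx [tg h]; split; last exact: expands_sqr.
by have := tangent_lin (2 * f x) hM Mx tg (tangent0 hM Mx); rewrite addr0.
Qed.

Lemma tdiff_continuous k M f : (forall x, M x -> tdifferentiable k M f x) ->
  {within M, continuous f}.
Proof.
move=> h; apply/subspace_continuousP => x Mx; have [g [_ hg]] := h _ Mx.
apply/cvgrPdist_le => e e0; rewrite near_withinE.
by have := expands_near hg e0; apply: filterS => y hy My; rewrite distrC hy.
Qed.

End Charts.
Section Param.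
Context {R : realType} {d : nat}.
Implicit Types (M U W : set 'rV[R]_d) (x v : 'rV[R]_d).

Lemma ball_norm_nbhs (x : 'rV[R]_d) (r : R) : 0 < r -> \forall y \near x, `|y - x| < r.
Proof. by move=> r0; apply/nbhs_normP; exists r => // y /=; rewrite distrC. Qed.

Lemma C1_lipschitz U (f : 'rV[R]_d -> 'rV[R]_d) x : open U -> C1_on U f -> U x ->
  exists r K : R, [/\ 0 < r, 0 <= K, forall y, `|y - x| < r -> U y &
    forall y z, `|y - x| < r -> `|z - x| < r -> `|f z - f y| <= K * `|z - y|].
Proof.
move=> oU C1f Ux.
pose Ki (i : 'I_d) := `|'D_(delta_mx 0 i) f x| + 1.
pose K := \sum_(i < d) Ki i.
have K0 : 0 <= K by apply: sumr_ge0 => i _; rewrite addr_ge0.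
have nb : \forall y \near x, U y /\ forall i, `|'D_(delta_mx 0 i) f y| <= Ki i.
  apply: filterI; first exact: open_nbhs_nbhs.
  have := @filter_forall _ 'I_d (fun i y => `|'D_(delta_mx 0 i) f y| <= Ki i) (nbhs x) _.
  apply => i.
  have [_ /(_ (delta_mx 0 i)) cf] := C1f _ Ux.
  have /cvgrPdist_le /(_ 1 ltr01) := cf.
  apply: filterS => y hy; rewrite -(subrK ('D_(delta_mx 0 i) f x) ('D_(delta_mx 0 i) f y)).
  by rewrite (le_trans (ler_normD _ _))// addrC lerD2l distrC.
have /nbhs_normP [r /= r0 hr] := nb.
have hr' y : `|y - x| < r -> U y /\ forall i, `|'D_(delta_mx 0 i) f y| <= Ki i.
  by move=> yr; apply: hr; rewrite /= distrC.
exists r, K; split => // [y /hr'[]//|y z yr zr].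
apply: (@lipschitz_convex _ _ _ [set y | `|y - x| < r] f K) => //.
- move=> u w t /= ur wr /andP[t0 t1].
  rewrite (_ : _ - _ = (1 - t) *: (u - x) + t *: (w - x)); last first.
    by apply/rowP => i; rewrite !mxE; ring.
  apply: (le_lt_trans (ler_normD _ _)); rewrite !normrZ !ger0_norm ?subr_ge0//.
  have [->|t0'] := eqVneq t 0; first by rewrite subr0 mul0r addr0 mul1r.
  have tp : 0 < t by rewrite lt_neqAle eq_sym t0'.
  have h1 : (1 - t) * `|u - x| <= (1 - t) * r by rewrite ler_wpM2l ?subr_ge0// ltW.
  have h2 : t * `|w - x| < t * r by rewrite ltr_pM2l.
  lra.
- move=> u e /= ur e0; have [Uu Du] := hr' _ ur; have [df _] := C1f _ Uu.
  have := diff_eps df e0; apply: filterS => w hw _.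
  rewrite -(subrK ('d f u (w - u)) (f w - f u)) mulrDl addrC [leRHS]addrC.
  apply: (le_trans (ler_normD _ _)); rewrite addrC lerD//.
  rewrite {1}(row_sum_delta (w - u)) linear_sum/=.
  apply: (le_trans (ler_norm_sum _ _ _)); rewrite /K mulr_suml; apply: ler_sum => i _.
  rewrite linearZ/= -deriveE// normrZ mulrC; apply: ler_pM => //.
  exact: rV_norm_coord.
Qed.

(** A chart seen from the parameter side: near each of its points M is the
    bi-Lipschitz image of the convex set where a half slice meets a ball. *)
Lemma chart_param (k : nat) M x0 : compact_submanifold k M -> M x0 ->
  exists (z0 : 'rV[R]_d) (psi : 'rV[R]_d -> 'rV[R]_d) (r L : R),
  let C := [set z | half_slice k z /\ `|z - z0| < r] in
  [/\ 0 < r, 1 <= L, psi z0 = x0 /\ C z0,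
   forall z, C z -> M (psi z) &
   (forall z z', C z -> C z' -> `|psi z' - psi z| <= L * `|z' - z|) /\
   \forall x \near x0, M x -> exists2 z, C z & psi z = x /\ `|z - z0| <= L * `|x - x0|].
Proof.
move=> [kd _ hM] Mx; have [U [phi [ch Ux]]] := hM _ Mx.
case: ch => [W [psi [oU oW C1phi C1psi [phiK psiK sl]]]].
have [Wz psiz] := phiK _ Ux.
have [r1 [K1 [r10 K10 rU lphi]]] := C1_lipschitz oU C1phi Ux.
have [r2 [K2 [r20 K20 rW lpsi]]] := C1_lipschitz oW C1psi Wz.
have K0 : 0 <= K1 + K2 + 1 by rewrite !addr_ge0.
exists (phi x0), psi, r2, (K1 + K2 + 1) => C; split => //.
- by rewrite lerDr addr_ge0.
- by split => //; split; [exact/(sl _ Ux)|rewrite subrr normr0].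
- move=> z [hz zr]; have [Uz pz] := psiK _ (rW _ zr); apply/(sl _ Uz).
  by rewrite pz.
split=> [z z' [_ zr] [_ zr']|].
  by apply: (le_trans (lpsi _ _ zr zr')); rewrite ler_wpM2r// -addrA addrCA lerDl addr_ge0.
have r10' : 0 < Num.min r1 (r2 / (K1 + 1)) by rewrite lt_min r10 divr_gt0// ltr_wpDl.
have := ball_norm_nbhs x0 r10'; apply: filterS => x; rewrite lt_min => /andP[xr1 xr2] Mx1.
have Ux1 := rU _ xr1; have [Wx psix] := phiK _ Ux1.
have h : `|phi x - phi x0| <= K1 * `|x - x0| by apply: lphi => //; rewrite subrr normr0.
exists (phi x); last first.
  by split => //; apply: (le_trans h); rewrite ler_wpM2r// -addrA lerDl addr_ge0.
split; first exact/(sl _ Ux1).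
apply: (le_lt_trans h); move: xr2; rewrite ltr_pdivlMr ?ltr_wpDl// mulrC.
by apply: le_lt_trans; rewrite ler_wpM2r// lerDl.
Qed.

Lemma half_slice_convex (k : nat) (z0 : 'rV[R]_d) (r : R) z z' (t : R) :
  (half_slice k z /\ `|z - z0| < r) -> (half_slice k z' /\ `|z' - z0| < r) ->
  0 <= t <= 1 -> half_slice k (z + t *: (z' - z)) /\ `|z + t *: (z' - z) - z0| < r.
Proof.
move=> [hz zr] [hz' zr'] /andP[t0 t1].
have e : z + t *: (z' - z) = (1 - t) *: z + t *: z'.
  by apply/rowP => i; rewrite !mxE; ring.
split.
  move=> i; rewrite e !mxE; have [a b] := hz i; have [a' b'] := hz' i.
  split=> [i0|ki]; last by rewrite b// b'// !mulr0 addr0.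
  by rewrite addr_ge0// mulr_ge0 ?subr_ge0 ?a ?a'.
rewrite (_ : _ - _ = (1 - t) *: (z - z0) + t *: (z' - z0)); last first.
  by apply/rowP => i; rewrite !mxE; ring.
apply: (le_lt_trans (ler_normD _ _)); rewrite !normrZ !ger0_norm ?subr_ge0//.
have [->|t0'] := eqVneq t 0; first by rewrite subr0 mul0r addr0 mul1r.
have tp : 0 < t by rewrite lt_neqAle eq_sym t0'.
have h1 : (1 - t) * `|z - z0| <= (1 - t) * r by rewrite ler_wpM2l ?subr_ge0// ltW.
have h2 : t * `|z' - z0| < t * r by rewrite ltr_pM2l.
lra.
Qed.

(** In the chart of chart_param the segment from z0 to z stays in a convex part
    of the half slice, where the mean value inequality applies. The constants
    come from the chart, which makes the estimate uniform in f. *)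
Lemma local_mvt (k : nat) M x0 : compact_submanifold k M -> M x0 ->
  exists r0 L : R, [/\ 0 < r0, 1 <= L &
   forall (rho eta : R) (f : 'rV[R]_d -> R) (g : 'rV[R]_d -> 'rV[R]_d),
     0 < rho <= r0 -> 0 <= eta ->
     (forall x, M x -> `|x - x0| < L * rho -> expands M f x (g x) /\ enorm (g x) <= eta) ->
     forall x, M x -> `|x - x0| < rho -> `|f x - f x0| <= eta * L * `|x - x0|].
Proof.
move=> hM Mx; have [z0 [psi [r [L [r0 L1 [psiz Cz0] Mpsi [lpsi /nbhs_normP [r1 /= r10 hr1]]]]]]] :=
  chart_param hM Mx.
have d0 : (0 < d)%N by case: hM => /andP[k0 kd] _ _; exact: leq_trans kd.
have dR : 1 <= d%:R :> R by rewrite (ler_nat _ 1).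
have L0 : 0 < L by exact: lt_le_trans L1.
have LL : L <= L * L by rewrite ler_pMr.
pose L' := d%:R * (L * L).
have L'0 : 0 < L' by rewrite mulr_gt0 ?mulr_gt0// ltr0n.
have LL' : L * L <= L' by rewrite /L' ler_pMl// mulr_gt0.
exists (Num.min r1 (r / L)), L'; split => //.
- by rewrite lt_min r10 divr_gt0.
- by rewrite (le_trans L1)// (le_trans LL).
move=> rho eta f g /andP[rho0 rho1] eta0 hfg x Mx1 xr.
move: rho1; rewrite le_min => /andP[rho1 rho2].
have [|z Cz [zx zz0]] := hr1 x _ Mx1.
  by rewrite /= distrC (lt_le_trans xr).
have zz0' : `|z - z0| < L * rho by rewrite (le_lt_trans zz0)// ltr_pM2l.
pose C := [set w | half_slice k w /\ `|w - z0| < L * rho].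
have rr : L * rho <= r by rewrite mulrC -ler_pdivlMr.
have sC w : C w -> half_slice k w /\ `|w - z0| < r.
  by move=> [hw wr]; split => //; exact: lt_le_trans rr.
have C0 : C z0 by split; [case: Cz0|rewrite subrr normr0 mulr_gt0].
have C1 : C z by split => //; case: Cz.
have := @lipschitz_convex R _ _ C (fun w => f (psi w)) (eta * (d%:R * L)) _ _ _ z0 z C0 C1.
rewrite psiz zx => h; have {}h : `|f x - f x0| <= eta * (d%:R * L) * `|z - z0|.
  apply: h.
  - by rewrite !mulr_ge0// ltW.
  - by move=> u w t; exact: half_slice_convex.
  move=> u e Cu e0; have [Cu1 ur] := Cu.
  have ul : `|psi u - x0| < L' * rho.
    rewrite -psiz; apply: (le_lt_trans (lpsi _ _ Cz0 (sC _ Cu))).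
    apply: (@lt_le_trans _ _ (L * (L * rho))); first by rewrite ltr_pM2l.
    by rewrite mulrA ler_pM2r.
  have [hf gu] := hfg _ (Mpsi _ (sC _ Cu)) ul.
  have dL0 : 0 < d%:R * L by rewrite mulr_gt0// ltr0n.
  have e'0 : 0 < e / (d%:R * L) by rewrite divr_gt0.
  have /nbhs_normP [s /= s0 hs] := hf _ e'0.
  have sL0 : 0 < s / L by rewrite divr_gt0.
  apply: filterS (ball_norm_nbhs u sL0) => w wu Cw.
  have lw := lpsi _ _ (sC _ Cu) (sC _ Cw).
  have en : enorm (psi w - psi u) <= d%:R * L * `|w - u|.
    by rewrite -mulrA (le_trans (enorm_le_norm _))// ler_wpM2l.
  rewrite -(subrK (edot (g (psi u)) (psi w - psi u)) (f (psi w) - f (psi u))).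
  apply: (le_trans (ler_normD _ _)); rewrite addrC mulrDl lerD//.
    apply: (le_trans (ler_edot _ _)); rewrite -mulrA; apply: ler_pM => //; exact: enorm_ge0.
  have hh : `|f (psi w) - f (psi u) - edot (g (psi u)) (psi w - psi u)| <=
     e / (d%:R * L) * enorm (psi w - psi u).
    apply: hs (Mpsi _ (sC _ Cw)); rewrite /= distrC (le_lt_trans lw)//.
    by rewrite mulrC -ltr_pdivlMr.
  apply: (le_trans hh); apply: (le_trans (ler_wpM2l (ltW e'0) en)).
  by rewrite mulrA divfK// gt_eqF.
apply: (le_trans h); rewrite -!mulrA ler_wpM2l//.
rewrite ler_wpM2l//; apply: (@le_trans _ _ (L * (L * `|x - x0|))).
  by rewrite ler_wpM2l// ltW.
by rewrite mulrA.
Qed.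

End Param.

(** * A compact submanifold has finite surface measure *)

Section FiniteMeasure.
Context {R : realType} {d : nat}.
Implicit Types (A M U : set 'rV[R]_d).

Lemma ball_volume_ge0 k : 0 <= ball_volume R k.
Proof.
suff : 0 <= ball_volume R k /\ 0 <= ball_volume R k.+1 by case.
elim: k => [|k [IH1 IH2]]; first by split => /=.
split => //; rewrite [ball_volume _ _.+2]/=; apply: mulr_ge0 => //.
by rewrite divr_ge0// mulr_ge0// pi_ge0.
Qed.

Lemma ediam_le U (D : R) : 0 <= D ->
  (forall x y, U x -> U y -> enorm (x - y) <= D) -> 0 <= ediam U <= D.
Proof.
move=> D0 UD; rewrite /ediam; have [[x Ux]|U0] := pselect (exists x, U x).
  have ne : [set enorm (z.1 - z.2) | z in U `*` U] 0.
    by exists (x, x) => //=; rewrite subrr enorm0.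
  have ub : ubound [set enorm (z.1 - z.2) | z in U `*` U] D.
    by move=> _ [[a b] [/= Ua Ub] <-]; exact: UD.
  apply/andP; split; last by apply: ge_sup => //; exists 0.
  by apply: sup_upper_bound => //; split; [exists 0|exists D].
rewrite (_ : [set _ | _ in _] = set0) ?sup0 ?lexx//.
by apply/seteqP; split => // _ [[a b] [/= Ua _] _]; case: U0; exists a.
Qed.

Lemma hausdorff_content_le (T : finType) (k : nat) (U : T -> set 'rV[R]_d) A (delta D : R) :
  (0 < k)%N -> 0 <= D <= delta -> A `<=` \bigcup_t U t ->
  (forall t x y, U t x -> U t y -> enorm (x - y) <= D) ->
  (hausdorff_content k delta A <= (#|T|%:R * (ball_volume R k * (D / 2) ^+ k))%:E)%E.
Proof.
move=> k0 /andP[D0 Dd] AU UD.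
pose V i := nth set0 [seq U t | t <- enum T] i.
have VD i x y : V i x -> V i y -> enorm (x - y) <= D.
  rewrite /V; have [iT|iT] := ltnP i (size (enum T)); last first.
    by rewrite nth_default// size_map.
  have t0 : T by case: (enum T) iT => // t.
  by rewrite (nth_map t0)//; exact: UD.
have Vd := fun i => ediam_le D0 (VD i).
set c := ball_volume R k * (D / 2) ^+ k.
have c0 : 0 <= c by rewrite mulr_ge0 ?ball_volume_ge0// exprn_ge0// divr_ge0.
pose u i := ball_volume R k * (ediam (V i) / 2) ^+ k.
have u0 i : 0 <= u i.
  by rewrite mulr_ge0 ?ball_volume_ge0// exprn_ge0// divr_ge0//; case/andP: (Vd i).
have uc i : u i <= c.
  rewrite ler_wpM2l ?ball_volume_ge0// lerXn2r ?nnegrE ?divr_ge0//; first by case/andP: (Vd i).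
  by rewrite ler_wpM2r ?invr_ge0//; case/andP: (Vd i).
have uN i : (#|T| <= i)%N -> u i = 0.
  move=> iT; rewrite /u /V nth_default; last by rewrite size_map -cardT.
  have /andP[] := @ediam_le set0 0 (lexx _) (fun _ _ (h : set0 _) => match h with end).
  move=> h1 h2; rewrite (le_anti (introT andP (conj h2 h1))) mul0r expr0n.
  by rewrite (gtn_eqF k0) mulr0.
apply: (@le_trans _ _ (\sum_(i <oo) (u i)%:E)%E).
  apply: ereal_inf_lbound; exists V => //; split.
    move=> x /AU [t _ Ux]; exists (index t (enum T)) => //=.
    by rewrite /V (nth_map t) ?index_mem ?mem_enum// nth_index ?mem_enum.
  by move=> i x y Vx Vy; apply: le_trans Dd; exact: VD Vx Vy.
apply: lime_le; first by apply: is_cvg_nneseries => i _ _; rewrite lee_fin.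
apply: nearW => n; rewrite sumEFin lee_fin.
suff : \sum_(0 <= i < n) u i <= (minn n #|T|)%:R * c.
  by move=> /le_trans; apply; rewrite ler_wpM2r// ler_nat geq_minr.
elim: n => [|n IH]; first by rewrite big_nil min0n mul0r.
rewrite big_nat_recr//=; have [nT|nT] := ltnP n #|T|.
  have -> : (minn n.+1 #|T| = (minn n #|T|).+1)%N.
    by rewrite (minn_idPl nT) (minn_idPl (ltnW nT)).
  by rewrite -addn1 natrD mulrDl mul1r lerD.
rewrite uN// addr0 (le_trans IH)// (minn_idPr nT) (minn_idPr _)//.
exact: leq_trans nT _.
Qed.

(** The last coordinates of a half slice vanish, so that it is cut by cutting the
    first k coordinates only; hence the number N^k of cells. *)
Lemma half_slice_cells (k : nat) (z0 : 'rV[R]_d) (r : R) (N : nat) : (k <= d)%N ->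
  0 < r -> (0 < N)%N ->
  exists cell : {ffun 'I_k -> 'I_N} -> set 'rV[R]_d,
    (forall z, half_slice k z -> `|z - z0| < r -> exists c, cell c z) /\
    forall c z z', cell c z -> cell c z' -> half_slice k z -> half_slice k z' ->
      `|z - z'| <= 2 * r / N%:R.
Proof.
move=> kd r0 N0; set h := 2 * r / N%:R.
have NR : 0 < N%:R :> R by rewrite ltr0n.
have h0 : 0 < h by rewrite divr_gt0// mulr_gt0.
pose q (z : 'rV[R]_d) (i : 'I_k) : R := (z 0 (widen_ord kd i) - z0 0 (widen_ord kd i) + r) / h.
exists (fun (c : {ffun 'I_k -> 'I_N}) => [set z : 'rV[R]_d | forall i, (c i)%:R <= q z i < (c i).+1%:R]); split.
  move=> z hz zr.
  have qz i : 0 <= q z i < N%:R.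
    have := le_lt_trans (rV_norm_coord (z - z0) (widen_ord kd i)) zr.
    rewrite !mxE ltr_norml => /andP[h1 h2]; rewrite /q divr_ge0 ?(ltW h0)//=; last by lra.
    rewrite ltr_pdivrMr// /h mulrCA mulfV ?gt_eqF// mulr1; lra.
  have tr i : (Num.truncn (q z i) < N)%N.
    have /andP[q0 q1] := qz i; have /andP[t1 t2] := truncn_itv q0.
    by rewrite -(ltr_nat R); exact: le_lt_trans q1.
  exists [ffun i => Ordinal (tr i)] => i; rewrite ffunE/=.
  by apply: truncn_itv; case/andP: (qz i).
move=> c z z' cz cz' hz hz'; apply: rV_norm_le => [|j]; first exact: ltW.
rewrite !mxE; have [jk|kj] := ltnP j k; last first.
  by rewrite (hz j).2// (hz' j).2// subrr normr0 ltW.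
have /andP[a1 a2] := cz (Ordinal jk); have /andP[b1 b2] := cz' (Ordinal jk).
have -> : z 0 j - z' 0 j = (q z (Ordinal jk) - q z' (Ordinal jk)) * h.
  rewrite /q (_ : widen_ord _ _ = j); last exact: val_inj.
  by rewrite -mulrBl divfK ?gt_eqF//; ring.
rewrite normrM (gtr0_norm h0) ler_piMl ?(ltW h0)// ler_norml.
by move: a2 b2; rewrite -addn1 natrD => a2 b2; apply/andP; split; lra.
Qed.

(** Finitely many charts cover M. The N^k cells of each are mapped to sets of
    diameter O(1/N), and the sum of the N^k terms O(1/N)^k does not grow with
    N. *)
Lemma hausdorff_fin (k : nat) M : compact_submanifold k M -> (hausdorff k M < +oo)%E.
Proof.
move=> hM; have [/andP[k0 kd] cM _] := hM.
have d0 : (0 < d)%N by exact: leq_trans kd.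
pose pr (x0 : 'rV[R]_d) (D : 'rV[R]_d * ('rV[R]_d -> 'rV[R]_d) * R * R) :=
  let: (z0, psi, r, L) := D in let C := [set z | half_slice k z /\ `|z - z0| < r] in
  M x0 -> [/\ 0 < r, 1 <= L, forall z z', C z -> C z' -> `|psi z' - psi z| <= L * `|z' - z| &
   \forall x \near x0, M x -> exists2 z, C z & psi z = x].
have /choice [D hD] : forall x0, exists D, pr x0 D.
  move=> x0; have [Mx|Mx] := pselect (M x0); last by exists (0, id, 0, 0) => Mx'.
  have [z0 [psi [r [L [r0 L1 _ _ [lpsi nM]]]]]] := chart_param hM Mx.
  exists (z0, psi, r, L) => C _; split => //.
  by apply: filterS nM => x h /h [z Cz [zx _]]; exists z.
pose nb x0 := let: (z0, psi, r, L) := D x0 in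
  [set x | M x -> exists2 z, (half_slice k z /\ `|z - z0| < r) & psi z = x].
have nbx x0 : M x0 -> nbhs x0 (nb x0).
  by move=> Mx; have := hD x0; rewrite /nb /pr; case: (D x0) => [[[z0 psi] r] L] /(_ Mx) [].
have cvM : cover_compact M by rewrite -compact_cover.
have [|x Mx|F sF cF] := cvM _ M (fun x => (nb x)°).
- by move=> x _; exact: open_interior.
- by exists x => //; exact: nbx.
pose s := finmap.enum_fset F.
have sM j : (j < size s)%N -> M (nth 0 s j).
  by move=> js; have := sF _ (mem_nth 0 js); rewrite inE.
pose K x : R := let: (_, _, r, L) := D x in d%:R * L * (2 * r).
have K0 x : M x -> 0 < K x.
  move=> Mx; have := hD x; rewrite /K /pr; case: (D x) => [[[z0 psi] r] L] /(_ Mx) [r0 L1 _ _].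
  by rewrite !mulr_gt0 ?ltr0n// (lt_le_trans _ L1).
pose Kt := \sum_(j < size s) K (nth 0 s j).
have Kt0 : 0 <= Kt by apply: sumr_ge0 => j _; apply: ltW; apply: K0; exact: sM.
have KKt j : (j < size s)%N -> K (nth 0 s j) <= Kt.
  move=> js; rewrite /Kt (bigD1 (Ordinal js))//= lerDl.
  by apply: sumr_ge0 => i _; apply: ltW; apply: K0; exact: sM.
apply: (@le_lt_trans _ _ ((size s)%:R * (ball_volume R k * (Kt / 2) ^+ k))%:E); last exact: ltry.
apply: ge_ereal_sup => _ [delta /= delta0 <-].
(* Cells of side 2 r / N have images of diameter at most Kt / N <= delta. *)
pose N := (Num.truncn (Kt / delta)).+1.
have NR : 0 < N%:R :> R by rewrite ltr0n.
have KN : Kt / N%:R <= delta.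
  rewrite ler_pdivrMr// mulrC -ler_pdivrMr// ltW//.
  by have /andP[] := @truncn_itv R (Kt / delta) (divr_ge0 Kt0 (ltW delta0)).
pose T : finType := ('I_(size s) * {ffun 'I_k -> 'I_N})%type.
have : forall x, exists cell : {ffun 'I_k -> 'I_N} -> set 'rV[R]_d,
    M x -> let: (z0, psi, r, L) := D x in
    (forall z, half_slice k z -> `|z - z0| < r -> exists c, cell c z) /\
    forall c z z', cell c z -> cell c z' -> half_slice k z -> half_slice k z' ->
      `|z - z'| <= 2 * r / N%:R.
  move=> x; have [Mx|Mx] := pselect (M x); last by exists (fun=> set0).
  have := hD x; rewrite /pr; case: (D x) => [[[z0 psi] r] L] /(_ Mx) [r0 _ _ _].
  by have [cell hcell] := @half_slice_cells k z0 r N kd r0 isT; exists cell.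
move=> /choice [cell hcell].
pose U (t : T) := let x := nth 0 s t.1 in let: (z0, psi, r, L) := D x in
  psi @` [set z | [/\ half_slice k z, `|z - z0| < r & cell x t.2 z]].
have := @hausdorff_content_le T k U M delta (Kt / N%:R) k0.
rewrite KN divr_ge0 ?(ltW NR)//= => /(_ isT) h.
apply: (le_trans (h _ _)); clear h.
- move=> x Mx; have [y /= yF] := cF x Mx; move=> /interior_subset yx.
  have ys : (index y s < size s)%N by rewrite index_mem.
  have My : M y by have := sF _ yF; rewrite inE.
  have := hcell y My; move: yx; rewrite /nb.
  case E : (D y) => [[[z0 psi] r] L] /(_ Mx) [z [hz zr] zx] [/(_ z hz zr) [c cz] _].
  by exists (Ordinal ys, c) => //; rewrite /U/= nth_index// E; exists z.
- move=> [[j js] c] x y; rewrite /U/=.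
  have Mj := sM _ js; have := hcell _ Mj; have := hD (nth 0 s j); have := KKt _ js.
  rewrite /pr /K; case: (D _) => [[[z0 psi] r] L] LK /(_ Mj) [r0 L1 lpsi _] [_ hc].
  move=> [z [hz zr cz] <-] [z' [hz' zr' cz'] <-].
  apply: (le_trans (enorm_le_norm _)).
  apply: (@le_trans _ _ (d%:R * (L * (2 * r / N%:R)))).
    rewrite ler_wpM2l//; apply: (le_trans (lpsi z' z _ _)) => //.
    by rewrite ler_wpM2l ?(le_trans _ L1)//; exact: (hc c).
  by rewrite !mulrA ler_wpM2r ?invr_ge0 ?(ltW NR)// -!mulrA mulrA.
- rewrite lee_fin card_prod card_ord card_ffun !card_ord natrM -mulrA.
  rewrite ler_wpM2l// mulrCA ler_wpM2l ?ball_volume_ge0// natrX -exprMn.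
  rewrite (_ : N%:R * _ = Kt / 2)//.
  by rewrite [Kt / _ / _]mulrAC mulrCA mulfV ?gt_eqF// mulr1.
Qed.

Lemma borel_closed (A : set (borel R d)) : closed (A : set 'rV[R]_d) -> measurable A.
Proof.
move=> cA; rewrite -(setCK A); apply: measurableC; apply: sub_sigma_algebra.
by rewrite /=; exact/closed_openC.
Qed.

Lemma submanifold_measurable k M : compact_submanifold k M -> measurable (M : set (borel R d)).
Proof.
by move=> [_ cM _]; apply: borel_closed; apply: compact_closed => //; exact: norm_hausdorff.
Qed.

Lemma surface_measure_fin k M (sigma : {measure set (borel R d) -> \bar R}) :
  compact_submanifold k M -> surface_measure k M sigma -> (sigma M < +oo)%E.
Proof.
move=> hM hs; rewrite hs; last exact: submanifold_measurable hM.
by rewrite setIid; exact: hausdorff_fin.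
Qed.

(** Preimages of open sets are traces on M of open sets. *)
Lemma within_continuous_measurable M (f : 'rV[R]_d -> R) :
  closed M -> {within M, continuous f} ->
  measurable_fun (M : set (borel R d)) (f : borel R d -> R).
Proof.
move=> cM cf; apply: (measurability (RGenInftyO.G (R := R))); first exact: RGenInftyO.measurableE.
move=> _ [_ [y ->] <-].
have mM : measurable (M : set (borel R d)) by exact: borel_closed.
have oy : open (`]-oo, y[%classic : set R) by exact: interval_open.
have [V oV VM] := (open_subspaceP M _).1 ((continuousP _).1 cf _ oy).
rewrite setIC -VM; apply: measurableI => //.
exact: sub_sigma_algebra.
Qed.

End FiniteMeasure.

(** * H^1_0 as a complete semi-inner product space *)

Section Sobolev.
Context {R : realType} {d : nat} (k : nat) (S : set 'rV[R]_d).
Variable (sigma : {measure set (borel R d) -> \bar R}).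
Hypotheses (hS : compact_submanifold k S) (hsigma : surface_measure k S sigma).
Implicit Types (f : 'rV[R]_d -> R) (g : 'rV[R]_d -> 'rV[R]_d).
Local Notation LS := (@L2 _ (borel R d) R sigma S).
Local Notation nrm := (snorm (@L2dot _ (borel R d) R sigma S)).
Local Notation co g i := (fun x => g x 0 i).

Let mS : measurable (S : set (borel R d)).
Proof. exact: submanifold_measurable hS. Qed.

Let finS : (sigma S < +oo)%E.
Proof. exact: surface_measure_fin hS hsigma. Qed.

Let d0 : (0 < d)%N.
Proof. by case: hS => /andP[k0 kd] _ _; exact: leq_trans kd. Qed.

Let cS : compact S. Proof. by case: hS. Qed.

Let clS : closed S. Proof. by apply: compact_closed => //; exact: norm_hausdorff. Qed.

Lemma within_continuous_L2 f : {within S, continuous f} -> LS f.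
Proof.
move=> cf; have [b b0 fb] := compact_within_bounded cS cf.
by apply: (L2_bounded mS finS (b := b)) => //; exact: within_continuous_measurable.
Qed.

Lemma within_continuous_coord (g : 'rV[R]_d -> 'rV[R]_d) i :
  {within S, continuous g} -> {within S, continuous (co g i)}.
Proof.
move=> cg; apply/subspace_continuousP => x Sx.
have /cvgrPdist_le h := (subspace_continuousP S g).1 cg x Sx.
apply/cvgrPdist_le => e e0; apply: filterS (h e e0) => y.
by move=> /(le_trans (rV_norm_coord _ i)); rewrite !mxE.
Qed.

Lemma C1_fun_L2 f : C1_fun k S f -> LS f /\ forall i, LS (co (tgrad k S f) i).
Proof.
move=> [df cg]; split; first exact/within_continuous_L2/(tdiff_continuous df).
by move=> i; apply/within_continuous_L2/within_continuous_coord.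
Qed.

Lemma C1_fun_lin (a : R) f f' : C1_fun k S f -> C1_fun k S f' ->
  C1_fun k S (a *: f + f') /\ forall x, S x ->
    tgrad k S (a *: f + f') x = a *: tgrad k S f x + tgrad k S f' x.
Proof.
move=> [df cg] [df' cg'].
have tg x : S x -> is_tgrad k S (a *: f + f') x (a *: tgrad k S f x + tgrad k S f' x).
  by move=> Sx; apply: is_tgrad_lin => //; apply: is_tgrad_tgrad; [exact: df|exact: df'].
have E x : S x -> tgrad k S (a *: f + f') x = a *: tgrad k S f x + tgrad k S f' x.
  by move=> Sx; apply: tgradP (tg _ Sx).
split; last exact: E.
split; first by move=> x Sx; exists (a *: tgrad k S f x + tgrad k S f' x); exact: tg.
apply: (@within_continuous_eq _ _ _ (fun x => a *: tgrad k S f x + tgrad k S f' x)).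
  by move=> x Sx; rewrite E.
exact: within_continuous_lin.
Qed.

Lemma C1c_fun_lin (a : R) f f' : C1c_fun k S f -> C1c_fun k S f' ->
  C1c_fun k S (a *: f + f').
Proof.
move=> [cf [K [cK KS Kf]]] [cf' [K' [cK' KS' Kf']]]; split; first exact: (C1_fun_lin a cf cf').1.
exists (K `|` K'); split; [exact: compactU|by move=> x [/KS|/KS']|].
move=> x Sx /not_orP[nK nK']; rewrite /= -[_ x]/(a * f x + f' x).
by rewrite Kf// Kf'// mulr0 addr0.
Qed.

Lemma C1c_fun0 : C1c_fun k S (fun=> 0).
Proof.
have tg x : S x -> is_tgrad k S (fun=> 0) x 0.
  move=> Sx; split; first exact: tangent0.
  move=> e e0; apply/nbhs_normP; exists (1 : R); first exact: ltr01; move=> y _ _; rewrite subrr sub0r normrN.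
  rewrite (_ : edot 0 _ = 0) ?normr0 ?mulr_ge0 ?enorm_ge0 ?(ltW e0)//.
  by rewrite /edot big1// => i _; rewrite mxE mul0r.
split; last by exists set0; split => //; exact: compact0.
split; first by move=> x Sx; exists 0; exact: tg.
apply: (@within_continuous_eq 'rV[R]_d 'rV[R]_d S (fun=> 0)).
  by move=> x Sx; rewrite (tgradP d0 Sx (tg _ Sx)).
by apply: continuous_subspaceT; exact: cst_continuous.
Qed.

(** The membership conditions of H^1_0, first as they stand, then with real
    L^2 norms in place of convergent extended real integrals. *)
Definition isH10 f g : Prop :=
  [/\ measurable_fun (S : set (borel R d)) (f : borel R d -> R),
      forall i, measurable_fun (S : set (borel R d)) ((fun x => g x 0 i) : borel R d -> R) &
      exists phi : nat -> 'rV[R]_d -> R,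
        [/\ forall n, C1c_fun k S (phi n),
            (\int[sigma]_(x in (S : set (borel R d)))
               ((f x - phi n x) ^+ 2)%:E)%E @[n --> \oo] --> 0%E &
            (\int[sigma]_(x in (S : set (borel R d)))
               (enorm (g x - tgrad k S (phi n) x) ^+ 2)%:E)%E
              @[n --> \oo] --> 0%E]].

Definition isH10_eps f g : Prop :=
  [/\ LS f, forall i, LS (co g i) & forall e : R, 0 < e -> exists phi,
     [/\ C1c_fun k S phi, nrm (f - phi) <= e &
         forall i, nrm (co g i - co (tgrad k S phi) i) <= e]].

Lemma L2_of_integral f (b : R) : measurable_fun (S : set (borel R d)) (f : borel R d -> R) ->
  0 <= b ->
  (\int[sigma]_(x in (S : set (borel R d))) (f x ^+ 2)%:E <= (b ^+ 2)%:E)%E ->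
  LS f /\ nrm f <= b.
Proof.
move=> mf b0 fb; have Lf : LS f.
  split => //; apply/integrableP; split.
    apply/measurable_EFinP; under eq_fun do rewrite expr2.
    exact: measurable_funM.
  apply: (@le_lt_trans _ _ (b ^+ 2)%:E); last exact: ltry.
  apply: le_trans fb; rewrite le_eqVlt; apply/orP; left; apply/eqP.
  by apply: eq_integral => x _; rewrite gee0_abs// lee_fin sqr_ge0.
split => //; move: fb; rewrite (L2norm_sqE mS Lf) lee_fin.
by rewrite ler_pXn2r// nnegrE ?snorm_ge0.
Qed.

Lemma enorm_integral g : (forall i, LS (co g i)) ->
  (\int[sigma]_(x in (S : set (borel R d))) (enorm (g x) ^+ 2)%:E)%E =
  (\sum_(i < d) nrm (co g i) ^+ 2)%:E.
Proof.
move=> Lg; under eq_integral => x _ do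
  rewrite enorm_sq /edot -sumEFin.
rewrite ge0_integral_sum//.
- rewrite -sumEFin; apply: eq_bigr => i _; rewrite -(L2norm_sqE mS (Lg i)).
  by apply: eq_integral => x _; rewrite expr2.
- by move=> i; apply/measurable_EFinP; apply: measurable_funM; exact: (Lg i).1.
- by move=> i x _; rewrite lee_fin -expr2 sqr_ge0.
Qed.

Lemma enorm_measurable g :
  (forall i, measurable_fun (S : set (borel R d)) (co g i : borel R d -> R)) ->
  measurable_fun (S : set (borel R d)) ((fun x => enorm (g x) ^+ 2) : borel R d -> R).
Proof.
move=> mg; rewrite (_ : (fun _ => _) = fun x => \sum_(i < d) (co g i x * co g i x)).
  by apply: measurable_sum => i; exact: measurable_funM.
by apply/funext => x; rewrite enorm_sq.
Qed.

Lemma isH10P f g : isH10 f g <-> isH10_eps f g.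
Proof.
split.
  move=> [mf mg [phi [Cphi phif phig]]].
  have key (e : R) : 0 < e -> exists n,
      (LS (f - phi n) /\ nrm (f - phi n) <= e) /\
      forall i, LS (co g i - co (tgrad k S (phi n)) i) /\
        nrm (co g i - co (tgrad k S (phi n)) i) <= e.
    move=> e0; have e20 : 0 < e ^+ 2 by rewrite exprn_gt0.
    have nf := phif _ (@nbhs_open_ereal_lt R 0 (fun=> e ^+ 2) e20).
    have ng := phig _ (@nbhs_open_ereal_lt R 0 (fun=> e ^+ 2) e20).
    have [n [n1 n2]] : exists n, (\int[sigma]_(x in (S : set (borel R d))) ((f x - phi n x) ^+ 2)%:E < (e ^+ 2)%:E)%E /\
        (\int[sigma]_(x in (S : set (borel R d)))
               (enorm (g x - tgrad k S (phi n) x) ^+ 2)%:E < (e ^+ 2)%:E)%E.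
      case: nf => n1 _ h1; case: ng => n2 _ h2; exists (maxn n1 n2); split.
        by apply: h1; rewrite /= leq_maxl.
      by apply: h2; rewrite /= leq_maxr.
    exists n.
    have [Lphi Ltg] := C1_fun_L2 (Cphi n).1; split.
      apply: (L2_of_integral _ (ltW e0)); last exact: ltW n1.
      by apply: measurable_funB => //; exact: Lphi.1.
    have mgt i : measurable_fun (S : set (borel R d))
        (co (fun x => g x - tgrad k S (phi n) x) i : borel R d -> R).
      rewrite (_ : (fun _ => _) = co g i - co (tgrad k S (phi n)) i).
        by apply: measurable_funB => //; exact: (Ltg i).1.
      by apply/funext => x; rewrite !mxE.
    move=> i; apply: (L2_of_integral _ (ltW e0)).
      by apply: measurable_funB => //; exact: (Ltg i).1.
    apply: le_trans (ltW n2); apply: ge0_le_integral => //.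
    - by move=> x _; rewrite lee_fin sqr_ge0.
    - apply/measurable_EFinP; under eq_fun do rewrite expr2.
      by apply: measurable_funM; apply: measurable_funB => //; exact: (Ltg i).1.
    - apply/measurable_EFinP.
      exact: (@enorm_measurable (fun x => g x - tgrad k S (phi n) x)).
    move=> x _; rewrite lee_fin enorm_sq /edot (bigD1 i)//= !mxE -expr2 lerDl.
    by apply: sumr_ge0 => j _; rewrite -expr2 sqr_ge0.
  have [n0 [[L1 _] Lg1]] := key 1 ltr01.
  have [Lphi Ltg] := C1_fun_L2 (Cphi n0).1.
  split.
  - rewrite -(subrK (phi n0) f); exact: L2_add.
  - move=> i; rewrite -(subrK (co (tgrad k S (phi n0)) i) (co g i)).
    by apply: L2_add => //; case: (Lg1 i).
  move=> e /key [n [[_ h] hg]]; exists (phi n); split => // i; by case: (hg i).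
move=> [Lf Lg he].
have /choice [phi hphi] : forall n : nat, exists phi, [/\ C1c_fun k S phi, nrm (f - phi) <= 2^-1 ^+ n &
         forall i, nrm (co g i - co (tgrad k S phi) i) <= 2^-1 ^+ n].
  by move=> n; apply: he; rewrite exprn_gt0.
split; [exact: Lf.1|by move=> i; exact: (Lg i).1|exists phi].
have half0 : (2^-1 ^+ n : R) @[n --> \oo] --> 0.
  by apply: cvg_expr; rewrite ger0_norm// invf_lt1// ltr1n.
have half02 (c : R) : c * (2^-1 ^+ n) ^+ 2 @[n --> \oo] --> (0 : R).
  rewrite -(mulr0 c) -[X in _ * X](mulr0 0); under eq_fun do rewrite expr2.
  by apply: cvgM; [exact: cvg_cst|exact: cvgM].
have sq (c : R) (u : nat -> R) : (forall n, 0 <= u n <= c * (2^-1 ^+ n) ^+ 2) ->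
    (u n)%:E @[n --> \oo] --> 0%E.
  move=> hu; apply: cvg_EFin; first exact: nearW.
  apply: (@squeeze_cvgr _ _ _ _ (fun=> 0) (fun n => c * (2^-1 ^+ n) ^+ 2)) => //.
    by apply: nearW => n /=.
  exact: cvg_cst.
split; first by move=> n; case: (hphi n).
- have E n : (\int[sigma]_(x in (S : set (borel R d))) ((f x - phi n x) ^+ 2)%:E)%E =
      (nrm (f - phi n) ^+ 2)%:E.
    rewrite -L2norm_sqE//; apply: L2_sub => //.
    by have [[Cp _] _ _] := hphi n; case: (C1_fun_L2 Cp).
  under eq_fun do rewrite E; apply: (sq 1) => n; have [_ h _] := hphi n.
  by rewrite sqr_ge0 mul1r ler_pXn2r// nnegrE ?snorm_ge0// exprn_ge0.
- have Lgn n i : LS (co g i - co (tgrad k S (phi n)) i).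
    apply: L2_sub => //.
    by have [[Cp _] _ _] := hphi n; case: (C1_fun_L2 Cp).
  have E n : (\int[sigma]_(x in (S : set (borel R d)))
      (enorm (g x - tgrad k S (phi n) x) ^+ 2)%:E)%E =
      (\sum_(i < d) nrm (co g i - co (tgrad k S (phi n)) i) ^+ 2)%:E.
    have E i : co (fun x => g x - tgrad k S (phi n) x) i = co g i - co (tgrad k S (phi n)) i.
      by apply/funext => x; rewrite !mxE.
    rewrite (@enorm_integral (fun x => g x - tgrad k S (phi n) x)).
      by congr EFin; apply: eq_bigr => i _; rewrite E.
    by move=> i; rewrite E.
  under eq_fun do rewrite E; apply: (sq d%:R) => n; have [_ _ h] := hphi n.
  rewrite sumr_ge0 => [/=|i _]; last exact: sqr_ge0.
  rewrite mulr_natl -[X in _ *+ X]card_ord -sumr_const; apply: ler_sum => i _.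
  by rewrite ler_pXn2r// nnegrE ?snorm_ge0// exprn_ge0.
Qed.

Lemma isH10_lin (a : R) f g f' g' : isH10 f g -> isH10 f' g' ->
  isH10 (a *: f + f') (a *: g + g').
Proof.
move=> /isH10P [Lf Lg hf] /isH10P [Lf' Lg' hf']; apply/isH10P.
have cE i : co (a *: g + g') i = a *: co g i + co g' i.
  by apply/funext => x; rewrite !mxE.
split; [exact: L2_lin|by move=> i; rewrite cE; exact: L2_lin|].
move=> e e0; have e20 : 0 < e / 2 by rewrite divr_gt0.
have e30 : 0 < e / 2 / (`|a| + 1) by rewrite divr_gt0// ltr_wpDl.
have [phi [Cphi h1 h2]] := hf _ e30; have [phi' [Cphi' h1' h2']] := hf' _ e20.
have [Lphi Ltg] := C1_fun_L2 Cphi.1; have [Lphi' Ltg'] := C1_fun_L2 Cphi'.1.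
have key u u' v v' : LS u -> LS v -> LS u' -> LS v' -> nrm (u - v) <= e / 2 / (`|a| + 1) ->
    nrm (u' - v') <= e / 2 -> nrm (a *: u + u' - (a *: v + v')) <= e.
  move=> Lu Lv Lu' Lv' hu hu'.
  rewrite (_ : _ - _ = a *: (u - v) + (u' - v')); last first.
    by rewrite scalerBr opprD addrACA.
  have Luv : LS (u - v) by exact: L2_sub.
  apply: (le_trans (L2normD mS _ _)); [exact: L2_scale|exact: L2_sub|].
  rewrite (splitr e) lerD// L2normZ//.
  apply: (le_trans (ler_wpM2l (normr_ge0 _) hu)); rewrite mul_div_le// ltW//.
exists (a *: phi + phi'); split; [exact: C1c_fun_lin|exact: key|].
move=> i; rewrite cE.
have [_ E] := C1_fun_lin a Cphi.1 Cphi'.1.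
rewrite (_ : nrm _ = nrm (a *: co g i + co g' i -
    (a *: co (tgrad k S phi) i + co (tgrad k S phi') i))); first exact: key.
congr Num.sqrt; apply: eq_Rintegral => x /set_mem Sx.
rewrite -![(_ - _) x]/(_ x - _ x).
by rewrite /= E// !mxE.
Qed.

Lemma isH10_0 : isH10 0 0.
Proof.
apply/isH10P; have Cz := C1c_fun0.
have L0 : LS (fun=> 0) by exact: L2_cst.
have c0 i : co (0 : 'rV[R]_d -> 'rV[R]_d) i = fun=> 0 by apply/funext => x; rewrite mxE.
split => //; first by move=> i; rewrite c0.
move=> e e0; exists (fun=> 0); split => //.
  rewrite subrr (_ : nrm 0 = 0) ?ltW// /snorm.
  by rewrite (semi_ip0l (@L2_0 _ _ _ sigma S mS finS) (L2dot_lin mS))// sqrtr0.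
move=> i; rewrite (_ : nrm _ = 0) ?ltW// /snorm (_ : L2dot _ _ _ _ = 0) ?sqrtr0//.
rewrite /L2dot (_ : Rintegral _ _ _ = \int[sigma]_(x in (S : set (borel R d))) 0).
  by rewrite Rintegral_cst// mul0r.
apply: eq_Rintegral => x /set_mem Sx; rewrite -![(_ - _) x]/(_ x - _ x) c0.
rewrite (_ : tgrad k S _ x = 0) ?mxE ?subrr ?mul0r//.
apply: tgradP => //; split; first exact: tangent0.
move=> e' e'0; apply/nbhs_normP; exists (1 : R); first exact: ltr01; move=> y _ _; rewrite subrr sub0r normrN.
rewrite (_ : edot 0 _ = 0) ?normr0 ?mulr_ge0 ?enorm_ge0 ?(ltW e'0)//.
by rewrite /edot big1// => j _; rewrite mxE mul0r.
Qed.

(** The L^2 limits of the functions and of the gradients are approached by test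
    functions which approximate a far enough term of the sequence. *)
Lemma isH10_complete (f : nat -> 'rV[R]_d -> R) (g : nat -> 'rV[R]_d -> 'rV[R]_d) :
  (forall n, isH10 (f n) (g n)) ->
  (forall n, nrm (f n.+1 - f n) <= 2^-1 ^+ n) ->
  (forall n i, nrm (co (g n.+1) i - co (g n) i) <= 2^-1 ^+ n) ->
  exists f' g', isH10 f' g' /\ forall n i, nrm (co g' i - co (g n) i) <= 2 * 2^-1 ^+ n.
Proof.
move=> hfg hf hg; have hE n := (isH10P (f n) (g n)).1 (hfg n).
have Lf n : LS (f n) by case: (hE n).
have Lg n i : LS (co (g n) i) by case: (hE n).
have [f' Lf' f'f] := L2_complete mS finS Lf hf.
have /choice [g' hg'] : forall i : 'I_d, exists h : 'rV[R]_d -> R, LS h /\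
    forall n, nrm (h - co (g n) i) <= 2 * 2^-1 ^+ n.
  move=> i; have [h Lh hh] := L2_complete mS finS (fun n => Lg n i) (fun n => hg n i).
  by exists h.
pose G x : 'rV[R]_d := \row_i g' i x.
have GE i : co G i = g' i by apply/funext => x; rewrite mxE.
exists f', G; split; last by move=> n i; rewrite GE; case: (hg' i).
apply/isH10P; split => //; first by move=> i; rewrite GE; case: (hg' i).
move=> e e0; have e20 : 0 < e / 2 by rewrite divr_gt0.
have [n hn] : exists n, 2 * 2^-1 ^+ n <= e / 2.
  have half0 : (2 * 2^-1 ^+ n : R) @[n --> \oo] --> (2 * 0 : R).
    apply: cvgM; first exact: cvg_cst.
    by apply: cvg_expr; rewrite ger0_norm// invf_lt1// ltr1n.
  have /cvgrPdist_le /(_ _ e20) := half0; move=> [n _ /(_ n (leqnn n))].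
  rewrite /= mulr0 sub0r normrN => h; exists n; exact: le_trans (ler_norm _) h.
have [phi [Cphi h1 h2]] : exists phi,
     [/\ C1c_fun k S phi, nrm (f n - phi) <= e / 2 &
         forall i, nrm (co (g n) i - co (tgrad k S phi) i) <= e / 2].
  by case: (hE n) => _ _; apply.
have [Lphi Ltg] := C1_fun_L2 Cphi.1.
have key u v w : LS u -> LS v -> LS w -> nrm (u - v) <= 2 * 2^-1 ^+ n ->
    nrm (v - w) <= e / 2 -> nrm (u - w) <= e.
  move=> Lu Lv Lw h h'; rewrite (_ : u - w = (u - v) + (v - w)); last by rewrite subrKA.
  apply: (le_trans (L2normD mS (L2_sub mS Lu Lv) (L2_sub mS Lv Lw))).
  by rewrite (splitr e) lerD// (le_trans h).
exists phi; split => //; first exact: (key _ (f n)).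
by move=> i; rewrite GE; case: (hg' i) => Li hi; exact: (key _ (co (g n) i)).
Qed.

End Sobolev.

(** The space H^1_0(S), with the hypotheses on S as parameters, so that pointwise
    operations make it a vector space. *)
Definition sobolev (R : realType) (d k : nat) (S : set 'rV[R]_d)
  (sigma : {measure set (borel R d) -> \bar R})
  (hS : compact_submanifold k S) (hsigma : surface_measure k S sigma) : Type :=
  H10 sigma k S.

Section SobolevLmodule.
Context {R : realType} {d : nat} (k : nat) (S : set 'rV[R]_d).
Variable (sigma : {measure set (borel R d) -> \bar R}).
Hypotheses (hS : compact_submanifold k S) (hsigma : surface_measure k S sigma).
Local Notation X := (sobolev hS hsigma).

Lemma H10_ext (u v : H10 sigma k S) : h_val u = h_val v -> h_grad u = h_grad v -> u = v.
Proof.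
case: u => f g p1 p2 p3; case: v => f' g' q1 q2 q3 /= e1 e2; subst f' g'.
by rewrite (Prop_irrelevance p1 q1) (Prop_irrelevance p2 q2) (Prop_irrelevance p3 q3).
Qed.

Lemma H10_isH10 (u : H10 sigma k S) : isH10 k S sigma (h_val u) (h_grad u).
Proof. by case: u => f g p1 p2 p3; split. Qed.

Lemma mkH10_sig f g (h : isH10 k S sigma f g) : {u : X | h_val u = f /\ h_grad u = g}.
Proof. by case: h => p1 p2 p3; exists (Build_H10 p1 p2 p3). Qed.

(** Taken from an opaque existence proof, so that mkH10_val and mkH10_grad are
    the only access to the pointwise operations. *)
Definition mkH10 f g (h : isH10 k S sigma f g) : X := sval (mkH10_sig h).

Lemma mkH10_val f g (h : isH10 k S sigma f g) : h_val (mkH10 h) = f.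
Proof. by rewrite /mkH10; case: (mkH10_sig h) => u []. Qed.

Lemma mkH10_grad f g (h : isH10 k S sigma f g) : h_grad (mkH10 h) = g.
Proof. by rewrite /mkH10; case: (mkH10_sig h) => u []. Qed.

HB.instance Definition _ := gen_eqMixin X.
HB.instance Definition _ := gen_choiceMixin X.

Lemma isH10_add (u v : X) :
  isH10 k S sigma (h_val u + h_val v) (h_grad u + h_grad v).
Proof.
have := isH10_lin hS hsigma 1 (H10_isH10 u) (H10_isH10 v).
by rewrite !scale1r.
Qed.

Lemma isH10_scale (a : R) (u : X) : isH10 k S sigma (a *: h_val u) (a *: h_grad u).
Proof.
have := isH10_lin hS hsigma a (H10_isH10 u) (isH10_0 hS hsigma).
by rewrite !addr0.
Qed.

Lemma isH10_opp (u : X) : isH10 k S sigma (- h_val u) (- h_grad u).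
Proof. by have := isH10_scale (-1) u; rewrite !scaleN1r. Qed.

Definition sob_add (u v : X) : X := mkH10 (isH10_add u v).
Definition sob_opp (u : X) : X := mkH10 (isH10_opp u).
Definition sob_zero : X := mkH10 (isH10_0 hS hsigma).
Definition sob_scale (a : R) (u : X) : X := mkH10 (isH10_scale a u).

Lemma sob_addA : associative sob_add.
Proof. by move=> u v w; apply: H10_ext; rewrite ?mkH10_val ?mkH10_grad; exact: addrA. Qed.
Lemma sob_addC : commutative sob_add.
Proof. by move=> u v; apply: H10_ext; rewrite ?mkH10_val ?mkH10_grad; exact: addrC. Qed.
Lemma sob_add0 : left_id sob_zero sob_add.
Proof. by move=> u; apply: H10_ext; rewrite ?mkH10_val ?mkH10_grad; exact: add0r. Qed.
Lemma sob_addN : left_inverse sob_zero sob_opp sob_add.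
Proof. by move=> u; apply: H10_ext; rewrite ?mkH10_val ?mkH10_grad; exact: addNr. Qed.

HB.instance Definition _ := GRing.isZmodule.Build X sob_addA sob_addC sob_add0 sob_addN.

Lemma sob_scaleA (a b : R) (u : X) : sob_scale a (sob_scale b u) = sob_scale (a * b) u.
Proof. by apply: H10_ext; rewrite ?mkH10_val ?mkH10_grad; exact: scalerA. Qed.
Lemma sob_scale1 : left_id 1 sob_scale.
Proof. by move=> u; apply: H10_ext; rewrite ?mkH10_val ?mkH10_grad; exact: scale1r. Qed.
Lemma sob_scaleDr : right_distributive sob_scale +%R.
Proof. by move=> a u v; apply: H10_ext; rewrite ?mkH10_val ?mkH10_grad; exact: scalerDr. Qed.
Lemma sob_scaleDl (u : X) : {morph sob_scale^~ u : a b / a + b}.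
Proof. by move=> a b; apply: H10_ext; rewrite ?mkH10_val ?mkH10_grad; exact: scalerDl. Qed.

HB.instance Definition _ := GRing.Zmodule_isLmodule.Build R X
  sob_scaleA sob_scale1 sob_scaleDr sob_scaleDl.

Lemma sob_valD (u v : X) x : h_val (u + v) x = h_val u x + h_val v x.
Proof. by rewrite mkH10_val. Qed.
Lemma sob_valZ a (u : X) x : h_val (a *: u) x = a * h_val u x.
Proof. by rewrite mkH10_val. Qed.
Lemma sob_gradD (u v : X) x : h_grad (u + v) x = h_grad u x + h_grad v x.
Proof. by rewrite mkH10_grad. Qed.
Lemma sob_gradZ a (u : X) x : h_grad (a *: u) x = a *: h_grad u x.
Proof. by rewrite mkH10_grad. Qed.
Lemma sob_grad0 x : h_grad (0 : X) x = 0.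
Proof. by rewrite mkH10_grad. Qed.

Lemma sob_grad_sum n (c : 'I_n -> R) (e : 'I_n -> X) x :
  h_grad (\sum_i c i *: e i) x = \sum_i c i *: h_grad (e i) x.
Proof.
apply: (big_ind2 (fun (u : X) (r : 'rV[R]_d) => h_grad u x = r)) => //.
- exact: sob_grad0.
- by move=> u r v s <- <-; rewrite sob_gradD.
- by move=> i _; rewrite sob_gradZ.
Qed.

Let mS : measurable (S : set (borel R d)).
Proof. exact: submanifold_measurable hS. Qed.
Let finS : (sigma S < +oo)%E.
Proof. exact: surface_measure_fin hS hsigma. Qed.

Lemma sob_L2 (u : X) : @L2 _ (borel R d) R sigma S (h_val u).
Proof. by have /(isH10P hS hsigma) [] := H10_isH10 u. Qed.

Lemma sob_grad_L2 (u : X) i : @L2 _ (borel R d) R sigma S (fun x => h_grad u x 0 i).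
Proof. by have /(isH10P hS hsigma) [] := H10_isH10 u. Qed.

Lemma h_dotE (u v : X) : h_dot u v = \sum_(i < d)
  @L2dot _ (borel R d) R sigma S (fun x => h_grad u x 0 i) (fun x => h_grad v x 0 i).
Proof.
pose F (i : 'I_d) (x : borel R d) := h_grad u x 0 i * h_grad v x 0 i.
have iF i : sigma.-integrable S (EFin \o F i).
  exact: (L2_mul mS (sob_grad_L2 u i) (sob_grad_L2 v i)).
rewrite /h_dot /edot /L2dot; move: (index_enum _) => s.
suff : sigma.-integrable S (EFin \o (fun x => \sum_(i <- s) F i x)) /\
  \int[sigma]_(x in S) (\sum_(i <- s) F i x) = \sum_(i <- s) \int[sigma]_(x in S) F i x.
  by case.
elim: s => [|i s [IH1 IH2]].
  rewrite big_nil; split.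
    by under [X in _ \o X]eq_fun do rewrite big_nil; exact: integrable_cst.
  by under eq_Rintegral do rewrite big_nil; rewrite Rintegral_cst// mul0r.
split.
  under [X in _ \o X]eq_fun do rewrite big_cons.
  by have := integrableD mS (iF i) IH1.
under eq_Rintegral do rewrite big_cons.
by rewrite RintegralD// IH2 big_cons.
Qed.

Lemma h_dotC (u v : X) : h_dot u v = h_dot v u.
Proof. by apply: eq_Rintegral => x _; rewrite edotC. Qed.

Lemma h_dot_lin a (u v w : X) : h_dot (a *: u + v : X) w = a * h_dot u w + h_dot v w.
Proof.
rewrite !h_dotE mulr_sumr -big_split/=; apply: eq_bigr => i _.
rewrite -L2dot_lin//; do ?exact: sob_grad_L2.
by congr L2dot; apply/funext => x; rewrite sob_gradD sob_gradZ !mxE.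
Qed.

Lemma h_dot_ge0 (u : X) : 0 <= h_dot u u.
Proof. by apply: Rintegral_ge0 => x _; exact: edot_ge0. Qed.

Lemma grad_le_h_norm (u : X) i :
  snorm (@L2dot _ (borel R d) R sigma S) (fun x => h_grad u x 0 i) <= h_norm u.
Proof.
rewrite /snorm /h_norm ler_wsqrtr// h_dotE (bigD1 i)//= lerDl.
by apply: sumr_ge0 => j _; apply: L2dot_ge0 => //; exact: sob_grad_L2.
Qed.

Lemma h_normZ a (u : X) : h_norm (a *: u : X) = `|a| * h_norm u.
Proof.
apply: (@snormZ R X setT (fun u v : X => h_dot u v)) => //; first exact: h_dotC.
by move=> *; exact: h_dot_lin.
Qed.

Lemma ler_h_normD (u v : X) : h_norm (u + v : X) <= h_norm u + h_norm v.
Proof.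
apply: (@ler_snormD R X setT (fun u v : X => h_dot u v)) => //; first exact: h_dotC.
  by move=> *; exact: h_dot_lin.
by move=> *; exact: h_dot_ge0.
Qed.

Lemma h_dot_cs (u v : X) : `|h_dot u v| <= h_norm u * h_norm v.
Proof.
apply: (@semi_cauchy_schwarz R X setT (fun u v : X => h_dot u v)) => //; first exact: h_dotC.
  by move=> *; exact: h_dot_lin.
by move=> *; exact: h_dot_ge0.
Qed.

Lemma h_norm_sq (u : X) : h_norm u ^+ 2 = h_dot u u.
Proof. by rewrite sqr_sqrtr// h_dot_ge0. Qed.

Lemma h_norm_ge0 (u : X) : 0 <= h_norm u.
Proof. exact: sqrtr_ge0. Qed.

Lemma h_norm_le_sum (u : X) : h_norm u <= \sum_(i < d)
  snorm (@L2dot _ (borel R d) R sigma S) (fun x => h_grad u x 0 i).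
Proof.
pose s (i : 'I_d) := snorm (@L2dot _ (borel R d) R sigma S) (fun x => h_grad u x 0 i).
rewrite -[leRHS]/(\sum_i s i); have s0 i : 0 <= s i by exact: snorm_ge0.
have S0 : 0 <= \sum_i s i by apply: sumr_ge0.
rewrite -(@ler_pXn2r _ 2)// ?nnegrE ?h_norm_ge0// h_norm_sq h_dotE expr2 mulr_suml.
apply: ler_sum => i _; rewrite -L2norm_sq; last exact: sob_grad_L2.
by rewrite -[snorm _ _]/(s i) expr2 ler_wpM2l// (bigD1 i)//= lerDl sumr_ge0.
Qed.

Hypothesis hP : poincare sigma k S.

(** Asking for c >= 1 allows dividing by it. *)
Lemma poincare_ge1 : exists2 c : R, 1 <= c & forall u : X,
  snorm (@L2dot _ (borel R d) R sigma S) (h_val u) <= c * h_norm u.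
Proof.
have [c hc] := hP; exists (`|c| + 1); first by rewrite lerDr.
move=> u; apply: (le_trans (hc u)); rewrite ler_wpM2r ?sqrtr_ge0//.
by rewrite (le_trans (ler_norm _))// lerDl.
Qed.

Lemma sob_valB (v w : X) : h_val (v - w : X) = h_val v - h_val w.
Proof. by apply/funext => x; rewrite sob_valD -scaleN1r sob_valZ mulN1r. Qed.

Lemma sob_gradB (v w : X) i : (fun x => h_grad (v - w : X) x 0 i) =
  (fun x => h_grad v x 0 i) - (fun x => h_grad w x 0 i).
Proof.
by apply/funext => x; rewrite sob_gradD -scaleN1r sob_gradZ !mxE mulN1r.
Qed.

(** By Poincare's inequality the values are Cauchy as soon as the gradients are;
    division by its constant makes both rapidly Cauchy. *)
Lemma sob_complete (u : nat -> X) : (forall n, h_norm (u n.+1 - u n : X) <= 2^-1 ^+ n) ->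
  exists w : X, forall e : R, 0 < e -> exists N, forall n, (N <= n)%N -> h_norm (w - u n : X) <= e.
Proof.
move=> hu; have [c c1 hc] := poincare_ge1.
have c0 : 0 < c by exact: lt_le_trans c1.
pose v n : X := c^-1 *: u n.
have hv n : h_norm (v n.+1 - v n : X) <= c^-1 * 2^-1 ^+ n.
  by rewrite -scalerBr h_normZ gtr0_norm ?invr_gt0// ler_wpM2l// invr_ge0 ltW.
have v1 n : snorm (@L2dot _ (borel R d) R sigma S) (h_val (v n.+1) - h_val (v n)) <= 2^-1 ^+ n.
  rewrite -sob_valB (le_trans (hc _))//; apply: (le_trans (ler_wpM2l (ltW c0) (hv n))).
  by rewrite mulVKf// gt_eqF.
have v2 n i : snorm (@L2dot _ (borel R d) R sigma S)
    ((fun x => h_grad (v n.+1) x 0 i) - (fun x => h_grad (v n) x 0 i)) <= 2^-1 ^+ n.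
  rewrite -sob_gradB (le_trans (grad_le_h_norm _ _))// (le_trans (hv n))//.
  by rewrite ler_piMl ?exprn_ge0// invf_le1.
have [f [g [hfg gg]]] := isH10_complete hS hsigma (fun n => H10_isH10 (v n)) v1 v2.
exists (c *: mkH10 hfg) => e e0.
have [N hN] := half_pow_small (c * (d%:R * 2)) e0; exists N => n /hN.
apply: le_trans; rewrite (_ : _ - _ = c *: (mkH10 hfg - v n)); last first.
  by rewrite scalerBr scalerA mulfV ?gt_eqF// scale1r.
rewrite h_normZ gtr0_norm// -mulrA ler_wpM2l ?(ltW c0)// (le_trans (h_norm_le_sum _))//.
rewrite -mulrA mulr_natl -[X in _ *+ X]card_ord -sumr_const; apply: ler_sum => i _.
by rewrite sob_gradB mkH10_grad.
Qed.

End SobolevLmodule.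

(** * Spectral towers *)

(** N k and al k stand for |x k| and |A (x k)| / beta, multiplied by beta^(2k),
    where x k is close to A^* A (x k.+1). If N 0 were larger, the ratio al / N
    would stay below 1/2, and the first inequality would make N double at each
    step. *)
Lemma growth_dichotomy (R : realType) (N al : nat -> R) (ep K : R) :
  0 <= ep -> (forall k, 0 <= N k) -> (forall k, 0 <= al k) ->
  (forall k, N k ^+ 2 <= al k * al k.+1 + ep * N k) ->
  (forall k, al k.+1 ^+ 2 <= N k.+1 * (N k + ep)) ->
  (forall k, N k <= K) ->
  N 0%N <= 4 * al 0%N + 8 * ep.
Proof.
move=> ep0 N0 al0 h1 h2 NK; rewrite leNgt; apply/negP => hN.
have N0p : 0 < N 0%N by apply: le_lt_trans hN; rewrite addr_ge0 ?mulr_ge0.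
have hep : 8 * ep <= N 0%N by apply/ltW/(le_lt_trans _ hN); rewrite lerDr mulr_ge0.
have hal : 4 * al 0%N <= N 0%N by apply/ltW/(le_lt_trans _ hN); rewrite lerDl mulr_ge0.
(* The ratio keeps a margin of relative size 2^-k / 2 below 1/2; the error ep, at
   most 2^-k N k / 8, costs no more than half of it at each step. *)
have inv k : N 0%N <= 2^-1 ^+ k * N k /\
    al k <= 2^-1 * (1 - 2^-1 ^+ k / 2) * N k.
  elim: k => [|k [IH1 IH2]]; first by rewrite expr0 !mul1r; split => //; lra.
  rewrite exprS; set t := 2^-1 ^+ k in IH1 IH2 *.
  have t0 : 0 < t by rewrite exprn_gt0.
  have t1 : t <= 1 by rewrite exprn_ile1// invf_le1// ler1n.
  have Nk : 0 < N k by rewrite -(pmulr_rgt0 _ t0); exact: lt_le_trans IH1.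
  have ept : ep <= t / 8 * N k by lra.
  have [r rE] : exists r, r = 2^-1 * (1 - t / 2) by eexists.
  rewrite -rE in IH2; have r0 : 0 <= r by rewrite rE; lra.
  have e1 : N k - ep <= r * al k.+1.
    rewrite -(ler_pM2l Nk).
    have : al k * al k.+1 <= r * N k * al k.+1 by rewrite ler_wpM2r.
    have := h1 k; rewrite expr2; lra.
  have Nep : (1 - t / 8) * N k <= N k - ep by lra.
  have t8 : 0 < 1 - t / 8 by lra.
  have alp : 0 < al k.+1.
    rewrite lt_neqAle al0 andbT; apply/eqP => al_0.
    by move: (lt_le_trans (mulr_gt0 t8 Nk) (le_trans Nep e1)); rewrite -al_0 mulr0 ltxx.
  have e2 : al k.+1 * (N k - ep) <= r * (N k.+1 * (N k + ep)).
    apply: (le_trans (ler_wpM2l (ltW alp) e1)); rewrite mulrCA -expr2.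
    by rewrite ler_wpM2l.
  have e3 : al k.+1 * (1 - t / 8) <= r * N k.+1 * (1 + t / 8).
    rewrite -(ler_pM2r Nk) -!mulrA.
    apply: (le_trans (ler_wpM2l (ltW alp) Nep)); apply: (le_trans e2).
    rewrite ler_wpM2l// ler_wpM2l//; lra.
  have e4 : al k.+1 <= 2^-1 * (1 - 2^-1 * t / 2) * N k.+1.
    rewrite -(ler_pM2r t8); apply: (le_trans e3).
    have : 0 <= N k.+1 * t ^+ 2 by rewrite mulr_ge0// sqr_ge0.
    rewrite rE expr2; have := N0 k.+1; set n := N k.+1; lra.
  split => //.
  have e5 : r * al k.+1 <= 2^-1 * (2^-1 * N k.+1).
    apply: ler_pM => //; first by rewrite rE; lra.
    apply: (le_trans e4); rewrite ler_wpM2r//; lra.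
  have e6 : 2 * N k <= N k.+1.
    have := le_trans Nep (le_trans e1 e5).
    have : 2^-1 * N k <= (1 - t / 8) * N k by rewrite ler_wpM2r ?N0//; lra.
    lra.
  apply: (le_trans IH1); rewrite [2^-1 * t]mulrC -mulrA ler_wpM2l ?(ltW t0)//.
  lra.
have [n hn] := half_pow_small K (divr_gt0 N0p (ltr0n R 2)).
have [i1 _] := inv n; have := hn n (leqnn n).
have : 2^-1 ^+ n * N n <= K * 2^-1 ^+ n by rewrite mulrC ler_wpM2r ?exprn_ge0.
lra.
Qed.

Section Abstract.
Context {R : realType} (X Y : lmodType R) (ip : X -> X -> R) (DY : set Y) (ipY : Y -> Y -> R).
Hypotheses (ipC : forall x y, ip x y = ip y x)
  (ip_lin : forall a x y z, ip (a *: x + y) z = a * ip x z + ip y z)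
  (ip_ge0 : forall x, 0 <= ip x x).
Hypotheses (DY_lin : forall a x y, DY x -> DY y -> DY (a *: x + y)) (DY0 : DY 0)
  (ipYC : forall x y, ipY x y = ipY y x)
  (ipY_lin : forall a x y z, DY x -> DY y -> DY z -> ipY (a *: x + y) z = a * ipY x z + ipY y z)
  (ipY_ge0 : forall x, DY x -> 0 <= ipY x x).
Local Notation nX := (snorm ip).
Local Notation nY := (snorm ipY).

Let ip_linT a x y z : setT x -> setT y -> setT z -> ip (a *: x + y) z = a * ip x z + ip y z.
Proof. by move=> _ _ _; exact: ip_lin. Qed.
Let ip_ge0T x : setT x -> 0 <= ip x x. Proof. by move=> _; exact: ip_ge0. Qed.

Let nX_ge0 x : 0 <= nX x. Proof. exact: snorm_ge0. Qed.
Let csX x y : `|ip x y| <= nX x * nX y.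
Proof. by apply: (@semi_cauchy_schwarz _ _ setT ip). Qed.
Let nXD x y : nX (x + y) <= nX x + nX y.
Proof. by apply: (@ler_snormD _ _ setT ip). Qed.
Let nXB x y : nX (x - y) <= nX x + nX y.
Proof. by apply: (@ler_snormB _ _ setT ip). Qed.
Let nXZ a x : nX (a *: x) = `|a| * nX x.
Proof. by apply: (@snormZ _ _ setT ip). Qed.
Let nXsq x : nX x ^+ 2 = ip x x.
Proof. by apply: (@snorm_sq _ _ setT ip). Qed.
Let csY x y : DY x -> DY y -> `|ipY x y| <= nY x * nY y.
Proof. exact: semi_cauchy_schwarz. Qed.
Let nYD x y : DY x -> DY y -> nY (x + y) <= nY x + nY y.
Proof. exact: ler_snormD. Qed.
Let nYB x y : DY x -> DY y -> nY (x - y) <= nY x + nY y.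
Proof. exact: ler_snormB. Qed.
Let nYZ a x : DY x -> nY (a *: x) = `|a| * nY x.
Proof. exact: snormZ. Qed.
Let nYsq x : DY x -> nY x ^+ 2 = ipY x x.
Proof. exact: snorm_sq. Qed.
Let DYB x y : DY x -> DY y -> DY (x - y). Proof. exact: semi_D_sub. Qed.
Let DYD x y : DY x -> DY y -> DY (x + y). Proof. exact: semi_D_add. Qed.
Let DYZ a x : DY x -> DY (a *: x). Proof. exact: semi_D_scale. Qed.
Let ipDl x y z : ip (x + y) z = ip x z + ip y z.
Proof. by apply: (@semi_ipDl _ _ setT ip). Qed.
Let ipZl a x z : ip (a *: x) z = a * ip x z.
Proof. by apply: (@semi_ipZl _ _ setT ip). Qed.
Let ipBr x y z : ip z (x - y) = ip z x - ip z y.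
Proof. by rewrite ipC ipDl -scaleN1r ipZl mulN1r !(ipC z). Qed.
Let ipYDl x y z : DY x -> DY y -> DY z -> ipY (x + y) z = ipY x z + ipY y z.
Proof. exact: semi_ipDl. Qed.
Let ipYZl a x z : DY x -> DY z -> ipY (a *: x) z = a * ipY x z.
Proof. exact: semi_ipZl. Qed.
Let ipYBl x y z : DY x -> DY y -> DY z -> ipY (x - y) z = ipY x z - ipY y z.
Proof. by move=> Dx Dy Dz; rewrite ipYDl// -scaleN1r ?ipYZl ?mulN1r//; exact: DYZ. Qed.
Let ipYBr x y z : DY x -> DY y -> DY z -> ipY z (x - y) = ipY z x - ipY z y.
Proof. by move=> Dx Dy Dz; rewrite ipYC ipYBl// !(ipYC z). Qed.

Definition bounded_op (A : X -> Y) (kap : R) : Prop :=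
  [/\ forall a u v, A (a *: u + v) = a *: A u + A v, forall u, DY (A u) &
      forall u, nY (A u) <= kap * nX u].

Lemma bounded_opB A kap u v : bounded_op A kap -> A (u - v) = A u - A v.
Proof.
by case=> lA _ _; rewrite addrC -scaleN1r lA scaleN1r addrC.
Qed.

Lemma bounded_opZ A kap a u : bounded_op A kap -> A (a *: u) = a *: A u.
Proof.
case=> lA _ _; have A0 : A 0 = 0.
  have := lA 1 0 0; rewrite !scale1r addr0 => /(congr1 (fun y => y - A 0)).
  by rewrite addrK subrr => <-.
by rewrite -[a *: u]addr0 lA A0 !addr0.
Qed.

(** A backward orbit of A^* A, with the bounds that hold on a span of eigenvectors
    for eigenvalues above beta^2. The adjoint enters only through the identity
    which defines it. *)
Definition tower (A : X -> Y) (beta : R) (us : nat -> X) : Prop :=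
  forall k, [/\ forall phi, ip phi (us k) = ipY (A phi) (A (us k.+1)),
                beta ^+ 2 * nX (us k.+1) <= nX (us k) &
                beta * nX (us k) <= nY (A (us k))].

Lemma tower_shift A beta us : tower A beta us -> tower A beta (fun k => us k.+1).
Proof. by move=> h k; exact: h. Qed.

(** Only ip and A see the bottom of a tower. This allows for vectors which are
    equal almost everywhere. *)
Lemma tower_head A beta us u : tower A beta us ->
  (forall phi, ip phi u = ip phi (us 0%N)) -> A u = A (us 0%N) ->
  tower A beta (fun k => if k is k'.+1 then us k else u).
Proof.
move=> h iu Au; have nu : nX u = nX (us 0%N) by rewrite /snorm iu ipC iu.
case=> [|k]; last exact: (h k.+1).
have [h1 h2 h3] := h 0%N; split; last 2 first.
- by rewrite nu.
- by rewrite nu Au.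
by move=> phi; rewrite iu; exact: h1.
Qed.

Lemma tower_scale A kap beta us a : bounded_op A kap -> tower A beta us ->
  tower A beta (fun k => a *: us k).
Proof.
move=> bA h k; have [h1 h2 h3] := h k; have [_ DA _] := bA; split.
- by move=> phi; rewrite ipC ipZl ipC h1 (bounded_opZ _ _ bA) [RHS]ipYC ipYZl// ipYC.
- by rewrite !nXZ mulrCA ler_wpM2l.
- by rewrite nXZ (bounded_opZ _ _ bA) nYZ// mulrCA ler_wpM2l.
Qed.

Lemma tower_bound A beta us k : 0 < beta -> tower A beta us ->
  (beta ^+ 2) ^+ k * nX (us k) <= nX (us 0%N).
Proof.
move=> b0 h; elim: k => [|k IH]; first by rewrite expr0 mul1r.
have [_ h2 _] := h k; apply: le_trans IH.
by rewrite exprSr -mulrA ler_wpM2l// exprn_ge0// sqr_ge0.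
Qed.

Section TwoTowers.
Variables (A A' : X -> Y) (kap del beta : R) (us vs : nat -> X).
Hypotheses (b0 : 0 < beta) (k0 : 0 <= kap) (d0 : 0 <= del).
Hypotheses (bA : bounded_op A kap) (bA' : bounded_op A' kap).
Hypothesis AA' : forall phi, nY (A phi - A' phi) <= del * nX phi.
Hypotheses (tu : tower A beta us) (tv : tower A' beta vs).

(** The differences of two towers form a backward orbit up to an error of the
    order of the distance of the operators. *)
Lemma tower_error phi k :
  `|ip phi (us k - vs k) - ipY (A phi) (A (us k.+1 - vs k.+1))| <=
  2 * kap * del * nX (vs k.+1) * nX phi.
Proof.
have [hu _ _] := tu k; have [hv _ _] := tv k.
have [_ DA nA] := bA; have [_ DA' nA'] := bA'.
rewrite ipBr hu hv (bounded_opB _ _ bA) ipYBr//.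
rewrite (_ : _ - _ = ipY (A phi - A' phi) (A (vs k.+1)) +
    ipY (A' phi) (A (vs k.+1) - A' (vs k.+1))); last first.
  by rewrite ipYBl// ipYBr//; ring.
apply: (le_trans (ler_normD _ _)).
have e1 : `|ipY (A phi - A' phi) (A (vs k.+1))| <= del * nX phi * (kap * nX (vs k.+1)).
  apply: (le_trans (csY (DYB (DA _) (DA' _)) (DA _))).
  by apply: ler_pM; rewrite ?snorm_ge0.
have e2 : `|ipY (A' phi) (A (vs k.+1) - A' (vs k.+1))| <= kap * nX phi * (del * nX (vs k.+1)).
  apply: (le_trans (csY (DA' _) (DYB (DA _) (DA' _)))).
  by apply: ler_pM; rewrite ?snorm_ge0.
apply: (le_trans (lerD e1 e2)); rewrite le_eqVlt; apply/orP; left; apply/eqP; ring.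
Qed.

(** u - v is controlled by its image under A and by the distance of the two
    operators. Were A = A', the sequence x k = us k - vs k would satisfy
    x k = T (x k.+1) with T = A^* A; a small ratio |A x| / |x| would then stay
    small and make |x k| outgrow beta^(-2k), which towers forbid. *)
Lemma tower_gap : nX (us 0%N - vs 0%N) <=
  4 / beta * nY (A (us 0%N - vs 0%N)) + 16 * kap * del / beta ^+ 2 * nX (vs 0%N).
Proof.
have b20 : 0 < beta ^+ 2 by rewrite exprn_gt0.
pose x k := us k - vs k.
pose N k := (beta ^+ 2) ^+ k * nX (x k).
pose al k := (beta ^+ 2) ^+ k * nY (A (x k)) / beta.
pose ep := 2 * kap * del / beta ^+ 2 * nX (vs 0%N).
have [_ DA nA] := bA.
have bk k : 0 < (beta ^+ 2) ^+ k by rewrite exprn_gt0.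
have ep0 : 0 <= ep by rewrite !mulr_ge0 ?invr_ge0 ?snorm_ge0// ltW.
have eb k : (beta ^+ 2) ^+ k * (2 * kap * del * nX (vs k.+1)) <= ep.
  have := tower_bound k.+1 b0 tv; rewrite exprS -mulrA -ler_pdivlMl// => h.
  by rewrite mulrCA /ep -[leRHS]mulrA ler_wpM2l ?mulr_ge0.
have := @growth_dichotomy R N al ep (nX (us 0%N) + nX (vs 0%N)) ep0.
rewrite /N /al !expr0 !mul1r => h.
apply: (le_trans (h _ _ _ _ _)) => [k|k|k|k|k|].
- by rewrite mulr_ge0 ?snorm_ge0// ltW.
- by rewrite !mulr_ge0 ?invr_ge0 ?snorm_ge0// ltW.
- have := tower_error (x k) k; rewrite ler_norml => /andP[_].
  rewrite -/(x k) -/(x k.+1) -nXsq => e1.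
  have e2 : ipY (A (x k)) (A (x k.+1)) <= nY (A (x k)) * nY (A (x k.+1)).
    by apply: le_trans (csY (DA _) (DA _)); exact: ler_norm.
  have e3 : nX (x k) ^+ 2 <= nY (A (x k)) * nY (A (x k.+1)) +
      2 * kap * del * nX (vs k.+1) * nX (x k) by lra.
  rewrite exprMn; apply: (le_trans (ler_wpM2l (sqr_ge0 _) e3)).
  rewrite mulrDr; apply: lerD.
    rewrite le_eqVlt; apply/orP; left; apply/eqP; rewrite [(beta ^+ 2) ^+ k.+1]exprS.
    move: (nY (A (x k))) (nY (A (x k.+1))) ((beta ^+ 2) ^+ k) => a a' c.
    rewrite (_ : _ / beta * _ = c ^+ 2 * (a * a') * (beta / beta) * (beta / beta)).
      by rewrite mulfV ?gt_eqF// !mulr1.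
    by ring.
  rewrite [leLHS](_ : _ = ((beta ^+ 2) ^+ k * (2 * kap * del * nX (vs k.+1))) *
     ((beta ^+ 2) ^+ k * nX (x k))); last by ring.
  by rewrite ler_wpM2r// mulr_ge0 ?snorm_ge0// ltW.
- have := tower_error (x k.+1) k; rewrite ler_norml => /andP[e1 _].
  rewrite -/(x k) -/(x k.+1) -nYsq// in e1.
  have e2 : ip (x k.+1) (x k) <= nX (x k.+1) * nX (x k).
    by apply: le_trans (csX _ _); exact: ler_norm.
  have e3 : nY (A (x k.+1)) ^+ 2 <= nX (x k.+1) * (nX (x k) +
      2 * kap * del * nX (vs k.+1)) by lra.
  have := eb k; move: (2 * kap * del * nX (vs k.+1)) e3 (nX_ge0 (x k.+1)) (bk k) => er.
  rewrite [(beta ^+ 2) ^+ k.+1]exprS.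
  move: (nX (x k.+1)) (nX (x k)) (nY (A (x k.+1))) ((beta ^+ 2) ^+ k).
  move=> n' n a c e3 n'0 c0 e4.
  rewrite (_ : (_ / beta) ^+ 2 = (c * beta) ^+ 2 * a ^+ 2 * (beta / beta) ^+ 2); last by ring.
  rewrite mulfV ?gt_eqF// expr1n mulr1; apply: (le_trans (ler_wpM2l (sqr_ge0 _) e3)).
  rewrite (_ : _ * (n' * _) = beta ^+ 2 * c * n' * (c * n + c * er)); last by ring.
  by rewrite ler_wpM2l ?lerD2l// !mulr_ge0// ltW.
- have hu := tower_bound k b0 tu; have hv := tower_bound k b0 tv.
  apply: le_trans (lerD hu hv); rewrite -mulrDr.
  by apply: ler_wpM2l; [exact: ltW|exact: nXB].
- rewrite /ep /x; lra.
Qed.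

End TwoTowers.

(** The same control for A^* A inverted once, from the difference of the bottom
    vectors. *)
Lemma tower_gap_next A A' kap del beta us vs :
  0 < beta -> 0 <= kap -> 0 <= del -> bounded_op A kap -> bounded_op A' kap ->
  (forall phi, nY (A phi - A' phi) <= del * nX phi) ->
  tower A beta us -> tower A' beta vs ->
  nX (us 1%N - vs 1%N) <=
  64 / beta ^+ 2 * nX (us 0%N - vs 0%N) + 160 * kap * del / beta ^+ 2 * nX (vs 1%N).
Proof.
move=> b0 k0 d0 bA bA' AA' tu tv; have [_ DA nA] := bA.
have := tower_gap b0 k0 d0 bA bA' AA' (tower_shift tu) (tower_shift tv).
have := tower_error bA bA' AA' tu tv (us 1%N - vs 1%N) 0.
rewrite -nYsq//= ler_norml => /andP[e1 _].
have e2 : ip (us 1%N - vs 1%N) (us 0%N - vs 0%N) <= nX (us 1%N - vs 1%N) * nX (us 0%N - vs 0%N).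
  by apply: le_trans (csX _ _); exact: ler_norm.
have : nY (A (us 1%N - vs 1%N)) ^+ 2 <= nX (us 1%N - vs 1%N) *
    (nX (us 0%N - vs 0%N) + 2 * kap * del * nX (vs 1%N)) by lra.
clear e1 e2.
have n0 := nX_ge0 (us 1%N - vs 1%N); have n'0 := nX_ge0 (us 0%N - vs 0%N).
have a0 : 0 <= nY (A (us 1%N - vs 1%N)) by exact: snorm_ge0.
have kd : 0 <= kap * del * nX (vs 1%N) by rewrite !mulr_ge0 ?snorm_ge0.
move: (nX (us 1%N - vs 1%N)) (nX (us 0%N - vs 0%N)) (nY _) (nX (vs 1%N)) n0 n'0 a0 kd.
move=> n n' a v n0 n'0 a0 kd h1 h2.
have bi : 0 < beta^-1 by rewrite invr_gt0.
have b2i : beta ^- 2 = beta^-1 ^+ 2 by rewrite exprVn.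
rewrite b2i in h2 *; move: (beta^-1) bi h2 {b2i} => c c0 h2.
pose E := kap * del * v; have E0 : 0 <= E by [].
have c20 : 0 <= c ^+ 2 by rewrite sqr_ge0.
have cE : 0 <= c ^+ 2 * E by rewrite mulr_ge0.
have cn' : 0 <= c ^+ 2 * n' by rewrite mulr_ge0.
rewrite (_ : 160 * kap * del * _ * v = 160 * (c ^+ 2 * E)); last by rewrite /E; ring.
rewrite (_ : 16 * kap * del * _ * v = 16 * (c ^+ 2 * E)) in h2; last by rewrite /E; ring.
rewrite (_ : n' + 2 * kap * del * v = n' + 2 * E) in h1; last by rewrite /E; ring.
(* If the error term does not dominate n, it is absorbed and n <= 8 c a; h1
   bounds a in turn by n, n' and the error. *)
have [n32|n32] := leP n (32 * (c ^+ 2 * E)); first by lra.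
have h3 : n <= 8 * c * a by lra.
have np : 0 < n by apply: le_lt_trans n32; rewrite mulr_ge0.
have h4 : n * n <= n * (64 * (c ^+ 2 * n') + 128 * (c ^+ 2 * E)).
  apply: (@le_trans _ _ (64 * c ^+ 2 * a ^+ 2)).
    rewrite -[n * n]expr2 (_ : 64 * c ^+ 2 * a ^+ 2 = (8 * c * a) ^+ 2); last by ring.
    by rewrite ler_pXn2r// nnegrE// !mulr_ge0// ltW.
  apply: (le_trans (ler_wpM2l _ h1)); first by rewrite mulr_ge0.
  by rewrite le_eqVlt; apply/orP; left; apply/eqP; ring.
move: h4; rewrite ler_pM2l//; lra.
Qed.

Lemma lin_form_sum n (l : X -> R) (a : 'I_n -> R) (e : 'I_n -> X) :
  (forall c u v, l (c *: u + v) = c * l u + l v) ->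
  l (\sum_i a i *: e i) = \sum_i a i * l (e i).
Proof.
move=> ll; have l0 : l 0 = 0 by have := ll 1 0 0; rewrite scale1r addr0 mul1r; lra.
apply: (big_ind2 (fun (u : X) (r : R) => l u = r)) => //.
- by move=> u r v s <- <-; have := ll 1 u v; rewrite scale1r mul1r.
- by move=> i _; have := ll (a i) (e i) 0; rewrite addr0 l0 addr0.
Qed.

Lemma ip_sum_sum n (a b : 'I_n -> R) (e : 'I_n -> X) :
  ip (\sum_i a i *: e i) (\sum_j b j *: e j) = \sum_i \sum_j a i * b j * ip (e i) (e j).
Proof.
rewrite (@lin_form_sum _ (fun u => ip u _)) => [|c u v]; last exact: ip_lin.
apply: eq_bigr => i _; rewrite ipC (@lin_form_sum _ (fun u => ip u (e i))) => [|c u v].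
  by rewrite mulr_sumr; apply: eq_bigr => j _; rewrite mulrA ipC.
exact: ip_lin.
Qed.

(** The form is the squared norm of the sum of the a i * sqrt (g i) *: e i, because
    g i = g j wherever the Gram matrix does not vanish. *)
Lemma gram_ge0 n (g a : 'I_n -> R) (e : 'I_n -> X) : (forall i, 0 <= g i) ->
  (forall i j, g i * ip (e i) (e j) = g j * ip (e i) (e j)) ->
  0 <= \sum_i \sum_j a i * a j * (g j * ip (e i) (e j)).
Proof.
move=> g0 gG; have := ip_ge0 (\sum_i (a i * Num.sqrt (g i)) *: e i).
rewrite ip_sum_sum; congr (_ <= _); apply: eq_bigr => i _; apply: eq_bigr => j _.
have [->|G0] := eqVneq (ip (e i) (e j)) 0; first by rewrite !mulr0.
have -> : g i = g j by exact: (mulIf G0).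
rewrite -[in RHS](@sqr_sqrtr _ (g j))//; ring.
Qed.

(** No orthonormal basis is chosen: eigenvectors with different eigenvalues are
    orthogonal, which is all that gram_ge0 asks for. *)
Lemma eigen_tower n (lam c : 'I_n -> R) (e : 'I_n -> X) A kap beta : bounded_op A kap -> 0 < beta ->
  (forall i, beta ^+ 2 < lam i) ->
  (forall i phi, ipY (A phi) (A (e i)) = lam i * ip phi (e i)) ->
  tower A beta (fun k => \sum_i (c i * (lam i)^-1 ^+ k) *: e i).
Proof.
move=> bA b0 hlam he; have [lA DA nA] := bA.
have b20 : 0 < beta ^+ 2 by rewrite exprn_gt0.
have l0 i : 0 < lam i by exact: lt_trans (hlam i).
have lG i j : lam i * ip (e i) (e j) = lam j * ip (e i) (e j).
  by rewrite -he ipYC he ipC.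
have AS phi a : ipY (A phi) (A (\sum_i a i *: e i)) = \sum_i a i * (lam i * ip phi (e i)).
  rewrite (@lin_form_sum _ (fun u => ipY (A phi) (A u))).
    by apply: eq_bigr => i _; rewrite he.
  by move=> a' u v; rewrite lA ipYC ipY_lin// !(ipYC (A phi)).
move=> k; split.
- move=> phi; rewrite AS ipC (@lin_form_sum _ (fun u => ip u phi)) => [|a u v]; last exact: ip_lin.
  apply: eq_bigr => i _; rewrite exprS ipC [RHS]mulrA; congr (_ * _).
  have li : lam i != 0 by rewrite gt_eqF.
  by rewrite -mulrA; congr (_ * _); rewrite mulrAC mulVf// mul1r.
- pose a i := c i * (lam i)^-1 ^+ k.+1.
  rewrite -(@ler_pXn2r _ 2)// ?nnegrE ?nX_ge0//; last by rewrite mulr_ge0 ?nX_ge0// ltW.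
  rewrite exprMn !nXsq -subr_ge0.
  have -> : \sum_i (c i * (lam i)^-1 ^+ k) *: e i = \sum_i (a i * lam i) *: e i.
    apply: eq_bigr => i _; congr (_ *: _); rewrite /a exprS -!mulrA; congr (_ * _).
    by rewrite mulrCA mulVf ?gt_eqF// mulr1.
  rewrite -[X in _ - _ * ip X _]/(\sum_i a i *: e i) -[X in _ - _ * ip _ X]/(\sum_i a i *: e i).
  rewrite !ip_sum_sum mulr_sumr -sumrB.
  have h := @gram_ge0 n (fun i => lam i ^+ 2 - (beta ^+ 2) ^+ 2) a e.
  have {}h := h _ _; apply: (le_trans (h _ _)) => [i|i j|].
  + by rewrite subr_ge0 ler_pXn2r ?nnegrE ?ltW.
  + by rewrite !mulrBl !expr2 -!mulrA lG [lam i * (lam j * _)]mulrCA lG.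
  rewrite le_eqVlt; apply/orP; left; apply/eqP; apply: eq_bigr => i _.
  rewrite mulr_sumr -sumrB; apply: eq_bigr => j _.
  rewrite (_ : a i * lam i * (a j * lam j) * _ = a i * a j * (lam j * (lam i * ip (e i) (e j)))).
    by rewrite lG; ring.
  by ring.
- pose a i := c i * (lam i)^-1 ^+ k.
  have aN : 0 <= nY (A (\sum_i a i *: e i)) by exact: snorm_ge0.
  rewrite -(@ler_pXn2r _ 2)// ?nnegrE//; last by rewrite mulr_ge0 ?nX_ge0// ltW.
  rewrite exprMn nXsq nYsq// -[X in ipY (A X) (A X)]/(\sum_i a i *: e i).
  rewrite -[X in ip X X]/(\sum_i a i *: e i) AS ip_sum_sum -subr_ge0 mulr_sumr.
  have h := @gram_ge0 n (fun i => lam i - beta ^+ 2) a e.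
  have {}h := h _ _; apply: (le_trans (h _ _)) => [i|i j|].
  + by rewrite subr_ge0 ltW.
  + by rewrite !mulrBl lG.
  rewrite exchange_big/= -sumrB le_eqVlt; apply/orP; left; apply/eqP; apply: eq_bigr => j _.
  rewrite (@lin_form_sum _ (fun u => ip u (e j))) => [|a' u v]; last exact: ip_lin.
  rewrite !mulr_sumr -sumrB; apply: eq_bigr => i _.
  by rewrite (ipC (e j) (e i)); ring.
Qed.

(** ** Compactness along an ultrafilter *)
Section Compactness.
Context (U : set_system nat) {UU : UltraFilter U}.

Definition ucauchyX (w : nat -> X) : Prop :=
  forall e : R, 0 < e -> \forall n \near U, \forall l \near U, nX (w n - w l) <= e.
Definition ulimX (w : nat -> X) (x : X) : Prop :=
  forall e : R, 0 < e -> \forall n \near U, nX (w n - x) <= e.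
Definition ulim_op (L : nat -> X -> Y) (K : X -> Y) : Prop :=
  forall e : R, 0 < e -> \forall n \near U, forall phi, nY (L n phi - K phi) <= e * nX phi.
Definition ucompact_op (K : X -> Y) : Prop :=
  forall (f : nat -> X) (r : R), (forall n, nX (f n) <= r) ->
  forall e : R, 0 < e -> \forall n \near U, \forall l \near U, nY (K (f n) - K (f l)) <= e.
Definition ucauchy_form (l : nat -> X -> R) : Prop :=
  forall e : R, 0 < e -> \forall n \near U, \forall p \near U,
    forall phi, `|l n phi - l p phi| <= e * nX phi.

Hypothesis X_complete : forall u : nat -> X, (forall n, nX (u n.+1 - u n) <= 2^-1 ^+ n) ->
  exists w, forall e : R, 0 < e -> exists N, forall n, (N <= n)%N -> nX (w - u n) <= e.

(** A term w (s j) is within 2^-j / 2 of almost all others along U; the sequence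
    of these terms is rapidly Cauchy. *)
Lemma ucauchy_lim w : ucauchyX w -> exists x, ulimX w x.
Proof.
move=> hw.
have /choice [s hs] : forall j : nat, exists n, \forall l \near U, nX (w n - w l) <= 2^-1 * 2^-1 ^+ j.
  move=> j; have j0 : 0 < 2^-1 * 2^-1 ^+ j :> R by rewrite mulr_gt0 ?exprn_gt0 ?invr_gt0.
  exact: (filter_ex (hw _ j0)).
have nXC x y : nX (x - y) = nX (y - x).
  by rewrite -[LHS]mul1r -(normrN1 R) -nXZ scaleN1r opprB.
have [j|x hx] := X_complete (u := fun j => w (s j)).
  have [l [h1 h2]] := filter_ex (filterI (hs j) (hs j.+1)).
  rewrite (_ : _ - _ = (w (s j.+1) - w l) - (w (s j) - w l)); last by rewrite opprB addrA subrK.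
  apply: (le_trans (nXB _ _)); apply: (le_trans (lerD h2 h1)).
  have : 0 <= 2^-1 ^+ j :> R by rewrite exprn_ge0.
  rewrite exprS; lra.
exists x => e e0; have e20 : 0 < e / 2 by rewrite divr_gt0.
have [N1 h1] := half_pow_small (2^-1 : R) e20; have [N2 h2] := hx _ e20.
set j := maxn N1 N2.
apply: filterS (hs j) => l hl.
rewrite (_ : w l - x = - (w (s j) - w l) - (x - w (s j))); last first.
  by rewrite !opprB subrKA.
rewrite (splitr e) (le_trans (nXB _ _))// lerD//.
  by rewrite -scaleN1r nXZ normrN1 mul1r (le_trans hl)// h1// leq_maxl.
by apply: h2; rewrite leq_maxr.
Qed.

(** The form is tested on w n - w p. *)
Lemma ucauchy_of_form w : ucauchy_form (fun n phi => ip phi (w n)) -> ucauchyX w.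
Proof.
move=> h e e0; apply: filterS (h e e0) => n; apply: filterS => p hp.
have := hp (w n - w p); rewrite -ipBr -nXsq ger0_norm ?sqr_ge0// expr2.
have [->|n0] := eqVneq (nX (w n - w p)) 0; first by move=> _; exact: ltW.
by rewrite ler_pM2r// lt_neqAle eq_sym n0 nX_ge0.
Qed.

Lemma ucauchy_formD l l' : ucauchy_form l -> ucauchy_form l' ->
  ucauchy_form (fun n phi => l n phi + l' n phi).
Proof.
move=> h h' e e0; have e20 : 0 < e / 2 by rewrite divr_gt0.
apply: (filterS _ (filterI (h _ e20) (h' _ e20))) => n [h1 h2].
apply: filterS (filterI h1 h2) => p [h3 h4] phi.
rewrite (_ : _ - _ = (l n phi - l p phi) + (l' n phi - l' p phi)); last by ring.
by rewrite (le_trans (ler_normD _ _))// [in leRHS](splitr e) mulrDl lerD.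
Qed.

(** Here compactness acts: N (f n) is Cauchy, and L n, M n are close to K, N. *)
Lemma ucauchy_product (L M : nat -> X -> Y) (K N : X -> Y) (kap r : R) (f : nat -> X) :
  0 <= kap -> 0 <= r ->
  (forall n, bounded_op (L n) kap) -> (forall n, bounded_op (M n) kap) -> bounded_op K kap -> bounded_op N kap ->
  ulim_op L K -> ulim_op M N -> ucompact_op N -> (forall n, nX (f n) <= r) ->
  ucauchy_form (fun n phi => ipY (L n phi) (M n (f n))).
Proof.
move=> k0 r0 bL bM bK bN LK MN cN fr e e0.
have [_ DK nK] := bK; have [_ DN nN] := bN.
pose c := kap * r + 1 + kap * (r + 1).
have c1 : 0 < c by rewrite /c ltr_wpDr ?mulr_ge0 ?addr_ge0// ltr_wpDl// mulr_ge0.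
have [d d0 dc] : exists2 d, 0 < d & 4 * (d * c) = e.
  exists (e / (4 * c)); first by rewrite divr_gt0// mulr_gt0.
  by rewrite mulrCA divfK// gt_eqF// mulr_gt0.
have close n : (forall phi, nY (L n phi - K phi) <= d * nX phi) ->
    (forall phi, nY (M n phi - N phi) <= d * nX phi) ->
    forall phi, `|ipY (L n phi) (M n (f n)) - ipY (K phi) (N (f n))| <= d * c * nX phi.
  move=> h1 h2 phi; have [_ DL nL] := bL n; have [_ DM nM] := bM n.
  rewrite (_ : _ - _ = ipY (L n phi - K phi) (M n (f n)) + ipY (K phi) (M n (f n) - N (f n))).
    2: by rewrite ipYBl// ipYBr//; ring.
  apply: (le_trans (ler_normD _ _)).
  have e1 : `|ipY (L n phi - K phi) (M n (f n))| <= d * nX phi * (kap * r).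
    apply: (le_trans (csY (DYB (DL _) (DK _)) (DM _))).
    apply: ler_pM; rewrite ?snorm_ge0//; apply: (le_trans (nM _)).
    by rewrite ler_wpM2l.
  have e2 : `|ipY (K phi) (M n (f n) - N (f n))| <= kap * nX phi * (d * r).
    apply: (le_trans (csY (DK _) (DYB (DM _) (DN _)))).
    apply: ler_pM; rewrite ?snorm_ge0//; apply: (le_trans (h2 _)).
    by rewrite ler_wpM2l// ltW.
  apply: (le_trans (lerD e1 e2)).
  rewrite (_ : _ + _ = (d * nX phi) * (kap * r + kap * r)); last by ring.
  rewrite (_ : d * c * _ = (d * nX phi) * c); last by ring.
  apply: ler_wpM2l; first by rewrite mulr_ge0 ?snorm_ge0 ?(ltW d0).
  rewrite /c mulrDr mulr1; lra.
have h1 := LK _ d0; have h2 := MN _ d0; have h3 := cN f r fr _ d0.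
apply: filterS (filterI (filterI h1 h2) h3) => n [[n1 n2] n3].
apply: filterS (filterI (filterI h1 h2) n3) => p [[p1 p2] p3] phi.
have q1 := close _ n1 n2 phi; have q2 := close _ p1 p2 phi.
rewrite distrC in q2.
rewrite (_ : _ - _ = (ipY (L n phi) (M n (f n)) - ipY (K phi) (N (f n))) +
   (ipY (K phi) (N (f p)) - ipY (L p phi) (M p (f p))) + ipY (K phi) (N (f n) - N (f p))).
  2: by rewrite ipYBr//; ring.
have q3 : `|ipY (K phi) (N (f n) - N (f p))| <= kap * nX phi * d.
  apply: (le_trans (csY (DK _) (DYB (DN _) (DN _)))).
  by apply: ler_pM; rewrite ?snorm_ge0.
apply: (le_trans (ler_normD _ _)); apply: (le_trans (lerD (ler_normD _ _) q3)).
apply: (le_trans (lerD (lerD q1 q2) (lexx _))).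
rewrite -dc (_ : kap * nX phi * d = d * kap * nX phi); last by ring.
rewrite -!mulrDl; rewrite ler_wpM2r ?snorm_ge0//.
have : 0 <= d * c by rewrite mulr_ge0 ?ltW.
have : d * kap <= d * c by rewrite ler_wpM2l ?(ltW d0)// /c mulrDr mulr1; have := mulr_ge0 k0 r0; lra.
lra.
Qed.

Lemma ulim_apply (L : nat -> X -> Y) (K : X -> Y) (kap r : R) (w : nat -> X) x :
  0 <= kap -> 0 <= r ->
  (forall n, bounded_op (L n) kap) -> bounded_op K kap -> ulim_op L K -> ulimX w x -> (forall n, nX (w n) <= r) ->
  forall e : R, 0 < e -> \forall n \near U, nY (L n (w n) - K x) <= e.
Proof.
move=> k0 r0 bL bK LK wx wr e e0; have [_ DK nK] := bK.
have e20 : 0 < e / 2 by rewrite divr_gt0.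
have d1 : 0 < e / 2 / (r + 1) by rewrite divr_gt0// ltr_wpDl.
have d2 : 0 < e / 2 / (kap + 1) by rewrite divr_gt0// ltr_wpDl.
apply: filterS (filterI (LK _ d1) (wx _ d2)) => n [h1 h2]; have [_ DL nL] := bL n.
rewrite (_ : _ - _ = (L n (w n) - K (w n)) + K (w n - x)).
  2: by rewrite (bounded_opB _ _ bK) addrA subrK.
apply: (le_trans (nYD (DYB (DL _) (DK _)) (DK _))).
rewrite (splitr e) lerD//.
  apply: (le_trans (h1 _)); apply: (@le_trans _ _ (r * (e / 2 / (r + 1)))).
    by rewrite mulrC ler_wpM2r ?(ltW d1).
  rewrite mulrA ler_pdivrMr ?ltr_wpDl// mulrC ler_wpM2l ?(ltW e20)// lerDl//.
apply: (le_trans (nK _)); apply: (le_trans (ler_wpM2l k0 h2)).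
by rewrite mulrA ler_pdivrMr ?ltr_wpDl// mulrC ler_wpM2l ?(ltW e20)// lerDl.
Qed.

Section Sequences.
Variables (beta kap r : R).
Hypotheses (b0 : 0 < beta) (k0 : 0 <= kap) (r0 : 0 <= r).

Lemma tower_next_bound A us s : tower A beta us -> nX (us 0%N) <= s ->
  nX (us 1%N) <= s / beta ^+ 2.
Proof.
move=> tu us0; have [_ h _] := tu 0%N.
by rewrite ler_pdivlMr ?exprn_gt0// mulrC (le_trans h).
Qed.

(** Since <phi, us n 0> = <A n phi, A n (us n 1)> with us n 1 bounded, compactness
    makes the bottoms converge in norm; no weak limit intervenes. *)
Lemma tower_ulim (A_ : nat -> X -> Y) A us : (forall n, bounded_op (A_ n) kap) -> bounded_op A kap ->
  ulim_op A_ A -> ucompact_op A -> (forall n, tower (A_ n) beta (us n)) ->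
  (forall n, nX (us n 0%N) <= r) -> exists u, ulimX (fun n => us n 0%N) u.
Proof.
move=> bA_ bA AA cA tu ur; apply: ucauchy_lim; apply: ucauchy_of_form.
have -> : (fun n phi => ip phi (us n 0%N)) = fun n phi => ipY (A_ n phi) (A_ n (us n 1%N)).
  by apply/funext => n; apply/funext => phi; have [h _ _] := tu n 0%N.
apply: (ucauchy_product (r := r / beta ^+ 2) k0 _ bA_ bA_ bA bA AA AA cA) => [|n].
  by rewrite divr_ge0// exprn_ge0// ltW.
exact: tower_next_bound (tu n) (ur n).
Qed.

(** Paired with phi, the difference quotient splits as the derivative of a
    product does, into three terms of the form of ucauchy_product. The quotients
    h n of the next level which occur in them are bounded by tower_gap_next. *)
Lemma quotient_ulim (A_ A'_ D_ : nat -> X -> Y) (A A' D : X -> Y) (del : nat -> R)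
    (us vs : nat -> nat -> X) :
  (forall n, bounded_op (A_ n) kap) -> (forall n, bounded_op (A'_ n) kap) -> (forall n, bounded_op (D_ n) kap) ->
  bounded_op A kap -> bounded_op A' kap -> bounded_op D kap ->
  ulim_op A_ A -> ulim_op A'_ A' -> ulim_op D_ D -> ucompact_op A -> ucompact_op D ->
  (forall n, 0 < del n) -> (forall n phi, A_ n phi - A'_ n phi = del n *: D_ n phi) ->
  (forall n, tower (A_ n) beta (us n)) -> (forall n, tower (A'_ n) beta (vs n)) ->
  (forall n, nX (vs n 0%N) <= r) -> (forall n, nX (us n 0%N - vs n 0%N) <= r * del n) ->
  exists w, ulimX (fun n => (del n)^-1 *: (us n 0%N - vs n 0%N)) w.
Proof.
move=> bA_ bA'_ bD_ bA bA' bD AA AA' DD cA cD d0 AD tu tv vr uvr.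
have b20 : 0 < beta ^+ 2 by rewrite exprn_gt0.
have v1 n : nX (vs n 1%N) <= r / beta ^+ 2 by exact: tower_next_bound (tv n) (vr n).
pose h n := (del n)^-1 *: (us n 1%N - vs n 1%N).
pose r' := 64 / beta ^+ 2 * r + 160 * kap * kap / beta ^+ 2 * (r / beta ^+ 2) + r / beta ^+ 2.
have rb : 0 <= r / beta ^+ 2 by rewrite divr_ge0// ltW.
have c64 : 0 <= 64 / beta ^+ 2 by rewrite divr_ge0// ltW.
have c160 : 0 <= 160 * kap * kap / beta ^+ 2 by rewrite !mulr_ge0 ?invr_ge0// ltW.
have r'0 : 0 <= r' by rewrite /r' !addr_ge0// mulr_ge0.
have hr n : nX (h n) <= r'.
  have dk : 0 <= kap * del n by rewrite mulr_ge0// ltW.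
  have AA'n phi : nY (A_ n phi - A'_ n phi) <= kap * del n * nX phi.
    have [_ DD_ nD_] := bD_ n; rewrite AD nYZ// gtr0_norm// mulrAC [leRHS]mulrC.
    by rewrite ler_wpM2l// ltW.
  have := tower_gap_next b0 k0 dk (bA_ n) (bA'_ n) AA'n (tu n) (tv n).
  rewrite /h nXZ gtr0_norm ?invr_gt0// ler_pdivrMl// => /le_trans; apply.
  rewrite (_ : 160 * kap * (kap * del n) / beta ^+ 2 * _ =
    160 * kap * kap / beta ^+ 2 * (nX (vs n 1%N) * del n)); last by ring.
  have e1 := ler_wpM2l c64 (uvr n).
  have e2 := ler_wpM2l c160 (ler_wpM2r (ltW (d0 n)) (v1 n)).
  have e3 := mulr_ge0 rb (ltW (d0 n)).
  rewrite (_ : del n * r' = 64 / beta ^+ 2 * (r * del n) +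
    160 * kap * kap / beta ^+ 2 * (r / beta ^+ 2 * del n) + r / beta ^+ 2 * del n); last first.
    by rewrite /r'; ring.
  by apply: ler_wpDr => //; exact: lerD.
have gr n : nX (vs n 1%N) <= r'.
  by apply: (le_trans (v1 n)); rewrite /r' lerDr addr_ge0// mulr_ge0.
apply: ucauchy_lim; apply: ucauchy_of_form.
have -> : (fun n phi => ip phi ((del n)^-1 *: (us n 0%N - vs n 0%N))) = fun n phi =>
    ipY (A_ n phi) (A_ n (h n)) + ipY (D_ n phi) (A_ n (vs n 1%N)) +
    ipY (A'_ n phi) (D_ n (vs n 1%N)).
  apply/funext => n; apply/funext => phi.
  have [hu _ _] := tu n 0%N; have [hv _ _] := tv n 0%N.
  have [_ DA _] := bA_ n; have [_ DA' _] := bA'_ n; have [_ DD_ _] := bD_ n.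
  have dn : del n != 0 by rewrite gt_eqF.
  rewrite ipC ipZl -(ipC phi) ipBr hu hv.
  have -> : A_ n (h n) = (del n)^-1 *: (A_ n (us n 1%N) - A_ n (vs n 1%N)).
    by rewrite /h (bounded_opZ _ _ (bA_ n)) (bounded_opB _ _ (bA_ n)).
  rewrite [ipY (A_ n phi) (_ *: _)]ipYC ipYZl//; last exact: DYB.
  rewrite [ipY (_ - _) (A_ n phi)]ipYC ipYBr//.
  have -> : D_ n phi = (del n)^-1 *: (A_ n phi - A'_ n phi).
    by rewrite AD scalerA mulVf// scale1r.
  have -> : D_ n (vs n 1%N) = (del n)^-1 *: (A_ n (vs n 1%N) - A'_ n (vs n 1%N)).
    by rewrite AD scalerA mulVf// scale1r.
  rewrite ipYZl//; last exact: DYB.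
  rewrite ipYBl// [ipY (A'_ n phi) (_ *: _)]ipYC ipYZl//; last exact: DYB.
  rewrite [ipY (_ - _) (A'_ n phi)]ipYC ipYBr//; ring.
apply: ucauchy_formD; first apply: ucauchy_formD.
- exact: (ucauchy_product k0 r'0 bA_ bA_ bA bA AA AA cA hr).
- exact: (ucauchy_product k0 r'0 bD_ bA_ bD bA DD AA cA gr).
- exact: (ucauchy_product k0 r'0 bA'_ bD_ bA' bD AA' DD cD gr).
Qed.

End Sequences.

Section Equation.
Variables (beta kap r : R).
Hypotheses (b0 : 0 < beta) (k0 : 0 <= kap) (r0 : 0 <= r).

(** The limit of (A n (us n) - A' n (vs n)) / del n, which is the sum of A n
    applied to the difference quotient and of D n (vs n). *)
Lemma quotient_equation (A_ A'_ D_ : nat -> X -> Y) (A A' D : X -> Y) (del eta : nat -> R)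
    (us vs : nat -> nat -> X) v :
  (forall n, bounded_op (A_ n) kap) -> (forall n, bounded_op (A'_ n) kap) -> (forall n, bounded_op (D_ n) kap) ->
  bounded_op A kap -> bounded_op A' kap -> bounded_op D kap ->
  ulim_op A_ A -> ulim_op A'_ A' -> ulim_op D_ D -> ucompact_op A -> ucompact_op D ->
  (forall n, 0 < del n) -> (forall n phi, A_ n phi - A'_ n phi = del n *: D_ n phi) ->
  (forall n, tower (A_ n) beta (us n)) -> (forall n, tower (A'_ n) beta (vs n)) ->
  (forall n, nX (vs n 0%N) <= r) -> ulimX (fun n => vs n 0%N) v ->
  (forall n, eta n <= 1) -> (forall e, 0 < e -> \forall n \near U, eta n <= e) ->
  (forall n, nY (A_ n (us n 0%N) - A'_ n (vs n 0%N)) <= eta n * del n) ->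
  exists w, nY (A w + D v) = 0.
Proof.
move=> bA_ bA'_ bD_ bA bA' bD AA AA' DD cA cD d0 AD tu tv vr vv eta1 eta0 uv.
have b20 : 0 < beta ^+ 2 by rewrite exprn_gt0.
pose s := 4 / beta * (1 + kap * r) + 16 * kap * kap / beta ^+ 2 * r + r.
have kr : 0 <= kap * r by rewrite mulr_ge0.
have c4 : 0 <= 4 / beta by rewrite divr_ge0// ltW.
have c16 : 0 <= 16 * kap * kap / beta ^+ 2 by rewrite !mulr_ge0 ?invr_ge0// ltW.
have s0 : 0 <= s by rewrite /s !addr_ge0// mulr_ge0// addr_ge0.
have Fn n : A_ n (us n 0%N - vs n 0%N) = (A_ n (us n 0%N) - A'_ n (vs n 0%N)) -
    del n *: D_ n (vs n 0%N).
  by rewrite -AD (bounded_opB _ _ (bA_ n)) opprB addrA subrK.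
have uvr n : nX (us n 0%N - vs n 0%N) <= s * del n.
  have [_ DA _] := bA_ n; have [_ DA' _] := bA'_ n; have [_ DD_ nD_] := bD_ n.
  have dk : 0 <= kap * del n by rewrite mulr_ge0// ltW.
  have AA'n phi : nY (A_ n phi - A'_ n phi) <= kap * del n * nX phi.
    by rewrite AD nYZ// gtr0_norm// mulrAC [leRHS]mulrC ler_wpM2l// ltW.
  have := tower_gap b0 k0 dk (bA_ n) (bA'_ n) AA'n (tu n) (tv n).
  rewrite (_ : 16 * kap * (kap * del n) / beta ^+ 2 * _ =
    16 * kap * kap / beta ^+ 2 * (nX (vs n 0%N) * del n)); last by ring.
  have e0 : nY (A_ n (us n 0%N - vs n 0%N)) <= (1 + kap * r) * del n.
    rewrite Fn (le_trans (nYB (DYB (DA _) (DA' _)) (DYZ _ (DD_ _))))//.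
    rewrite mulrDl; apply: lerD.
      by apply: (le_trans (uv n)); rewrite ler_wpM2r// ltW.
    rewrite nYZ// gtr0_norm// mulrC ler_wpM2r ?(ltW (d0 n))// (le_trans (nD_ _))//.
    by rewrite ler_wpM2l.
  have e1 := ler_wpM2l c4 e0.
  have e2 := ler_wpM2l c16 (ler_wpM2r (ltW (d0 n)) (vr n)).
  have e3 := mulr_ge0 r0 (ltW (d0 n)).
  rewrite (_ : s * del n = 4 / beta * ((1 + kap * r) * del n) +
    16 * kap * kap / beta ^+ 2 * (r * del n) + r * del n); last by rewrite /s; ring.
  by move=> /le_trans; apply; apply: ler_wpDr => //; exact: lerD.
have rs : r <= s by rewrite /s lerDr addr_ge0// mulr_ge0// addr_ge0.
have vr' n : nX (vs n 0%N) <= s by exact: le_trans rs.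
have [w hw] := quotient_ulim b0 k0 s0 bA_ bA'_ bD_ bA bA' bD AA AA' DD cA cD d0 AD tu tv vr' uvr.
exists w; apply/eqP; rewrite eq_le snorm_ge0 andbT; apply/ler_addgt0Pr => e e0; rewrite add0r.
have e30 : 0 < e / 3 by rewrite divr_gt0.
have wr n : nX ((del n)^-1 *: (us n 0%N - vs n 0%N)) <= s.
  by rewrite nXZ gtr0_norm ?invr_gt0// ler_pdivrMl// mulrC.
have h1 := ulim_apply k0 s0 bA_ bA AA hw wr e30.
have h2 := ulim_apply k0 s0 bD_ bD DD vv vr' e30.
have [n [[n1 n2] n3]] := filter_ex (filterI (filterI h1 h2) (eta0 _ e30)).
have [_ DA _] := bA_ n; have [_ DA' _] := bA'_ n; have [_ DD_ nD_] := bD_ n.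
have [_ DAw _] := bA; have [_ DDw _] := bD.
rewrite (_ : A w + D v = (del n)^-1 *: (A_ n (us n 0%N) - A'_ n (vs n 0%N)) -
  ((A_ n ((del n)^-1 *: (us n 0%N - vs n 0%N)) - A w) + (D_ n (vs n 0%N) - D v))); last first.
  rewrite (bounded_opZ _ _ (bA_ n)) Fn scalerBr scalerA mulVf ?gt_eqF// scale1r.
  set a := _ *: _; set b := D_ n _.
  by rewrite [a - b - A w]addrAC subrKA -addrA -opprD subKr.
apply: (le_trans (nYB (DYZ _ (DYB (DA _) (DA' _))) (DYD (DYB (DA _) (DAw _)) (DYB (DD_ _) (DDw _))))).
have h3 := nYD (DYB (DA ((del n)^-1 *: (us n 0%N - vs n 0%N))) (DAw w)) (DYB (DD_ (vs n 0%N)) (DDw v)).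
have h4 : nY ((del n)^-1 *: (A_ n (us n 0%N) - A'_ n (vs n 0%N))) <= e / 3.
  rewrite nYZ; last exact: DYB.
  rewrite gtr0_norm ?invr_gt0// ler_pdivrMl// (le_trans (uv n))// mulrC.
  by rewrite ler_wpM2l// ltW.
lra.
Qed.

End Equation.
End Compactness.
End Abstract.

(** * Integral operators with continuous kernels *)

Lemma near_forall_seq (T : Type) (Z : eqType) (F : set_system T) (s : seq Z) (P : Z -> T -> Prop) :
  Filter F -> (forall z, z \in s -> \forall n \near F, P z n) ->
  \forall n \near F, forall z, z \in s -> P z n.
Proof.
move=> FF; elim: s => [|z s IH] h; first by apply: filterE.
have h1 := h z (mem_head _ _).
have h2 := IH (fun y ys => h y (mem_behead (s := z :: s) ys)).
apply: filterS (filterI h1 h2) => n [p1 p2] y; rewrite inE => /orP[/eqP->//|]; exact: p2.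
Qed.

Section Kernel.
Context {R : realType} {d : nat} (kS kV : nat) (S V : set 'rV[R]_d).
Variables (sigma sigma' : {measure set (borel R d) -> \bar R}).
Hypotheses (hS : compact_submanifold kS S) (hsigma : surface_measure kS S sigma).
Hypotheses (hV : compact_submanifold kV V) (hsigma' : surface_measure kV V sigma').
Hypothesis hP : poincare sigma kS S.
Local Notation X := (sobolev hS hsigma).
Local Notation Y := ('rV[R]_d -> R).
Local Notation ip := (fun u v : X => h_dot u v).
Local Notation DY := (@L2 _ (borel R d) R sigma' V).
Local Notation ipY := (@L2dot _ (borel R d) R sigma' V).
Local Notation nX := (snorm ip).
Local Notation nY := (snorm ipY).
Implicit Types (K : 'rV[R]_d -> 'rV[R]_d -> R) (u v : X).

Let mS : measurable (S : set (borel R d)). Proof. exact: submanifold_measurable hS. Qed.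
Let mV : measurable (V : set (borel R d)). Proof. exact: submanifold_measurable hV. Qed.
Let finS : (sigma S < +oo)%E. Proof. exact: surface_measure_fin hS hsigma. Qed.
Let finV : (sigma' V < +oo)%E. Proof. exact: surface_measure_fin hV hsigma'. Qed.
Let cS : compact S. Proof. by case: hS. Qed.
Let cV : compact V. Proof. by case: hV. Qed.
Let clS : closed S. Proof. by apply: compact_closed => //; exact: norm_hausdorff. Qed.

Definition sqrt_vol : R := Num.sqrt (fine (sigma' V)).

Lemma sqrt_vol_ge0 : 0 <= sqrt_vol. Proof. exact: sqrtr_ge0. Qed.

(** Bounded kernels act on L^1, whose norm the gradient norm controls by
    Poincare's inequality. *)
Lemma l1_bound : exists2 c1 : R, 0 <= c1 & forall u : X,
  \int[sigma]_(y in (S : set (borel R d))) `|h_val u y| <= c1 * nX u.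
Proof.
have [c c1 hc] := poincare_ge1 hS hsigma hP.
exists (Num.sqrt (fine (sigma S)) * c).
  by rewrite mulr_ge0 ?sqrtr_ge0// (le_trans _ c1).
move=> u; apply: (le_trans (L1_le_L2 mS finS (sob_L2 u))).
by rewrite -mulrA ler_wpM2l ?sqrtr_ge0//; exact: hc.
Qed.

Definition l1_cst : R := sval (cid2 l1_bound).
Lemma l1_cst_ge0 : 0 <= l1_cst. Proof. by rewrite /l1_cst; case: cid2. Qed.
Lemma l1_cstP u : \int[sigma]_(y in (S : set (borel R d))) `|h_val u y| <= l1_cst * nX u.
Proof. by rewrite /l1_cst; case: cid2. Qed.

Local Notation I a u := (\int[sigma]_(y in (S : set (borel R d))) (a y * h_val u y)).

Lemma integrable_pair (a : 'rV[R]_d -> R) u : {within S, continuous a} ->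
  sigma.-integrable (S : set (borel R d)) (EFin \o (fun y => a y * h_val u y)).
Proof.
move=> ca; apply: (L2_mul mS); first exact: within_continuous_L2 hS hsigma _ ca.
exact: sob_L2.
Qed.

Lemma pair_lin_fun (a b : 'rV[R]_d -> R) (c : R) u : {within S, continuous a} ->
  {within S, continuous b} -> I (fun y => c * a y + b y) u = c * I a u + I b u.
Proof.
move=> ca cb; rewrite -RintegralZl//; last exact: integrable_pair.
rewrite -RintegralD//; last 2 first.
  by have := integrableZl mS c (integrable_pair u ca).
  exact: integrable_pair.
by apply: eq_Rintegral => y _; ring.
Qed.

Lemma pair_lin_vec (a : 'rV[R]_d -> R) (c : R) u v : {within S, continuous a} ->
  I a (c *: u + v : X) = c * I a u + I a v.
Proof.
move=> ca; rewrite -RintegralZl//; last exact: integrable_pair.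
rewrite -RintegralD//; last 2 first.
  by have := integrableZl mS c (integrable_pair u ca).
  exact: integrable_pair.
by apply: eq_Rintegral => y _; rewrite sob_valD sob_valZ; ring.
Qed.

Lemma pair_bound (a : 'rV[R]_d -> R) (e : R) u : {within S, continuous a} ->
  0 <= e -> (forall y, S y -> `|a y| <= e) -> `|I a u| <= e * l1_cst * nX u.
Proof.
move=> ca e0 ae; apply: (le_trans (le_normr_Rintegral mS (integrable_pair u ca))).
rewrite -mulrA; apply: (le_trans _ (ler_wpM2l e0 (l1_cstP u))).
have iu := integrable_norm (L2_integrable mS finS (sob_L2 u)).
rewrite -RintegralZl//.
apply: le_Rintegral => //.
- exact: (integrable_norm (integrable_pair u ca)).
- by have := integrableZl mS e iu.
- by move=> y Sy; rewrite normrM ler_wpM2r// ae.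
Qed.

Lemma pair_diff (a b : 'rV[R]_d -> R) (e : R) u : {within S, continuous a} ->
  {within S, continuous b} -> 0 <= e -> (forall y, S y -> `|a y - b y| <= e) ->
  `|I a u - I b u| <= e * l1_cst * nX u.
Proof.
move=> ca cb e0 abe.
rewrite (_ : I a u - I b u = I (fun y => (-1) * b y + a y) u).
  apply: pair_bound => //.
    exact: (@within_continuous_lin R _ R S (-1) b a cb ca).
  by move=> y Sy; rewrite mulN1r addrC abe.
by rewrite pair_lin_fun// mulN1r addrC.
Qed.

Definition ckernel K : Prop := {within V `*` S, continuous (fun z => K z.1 z.2)}.

Lemma ckernel_fiber K x : ckernel K -> V x -> {within S, continuous (K x)}.
Proof. exact: within_continuous_fiber. Qed.

Lemma ckernel_lin K K' (c : R) : ckernel K -> ckernel K' -> ckernel (fun x y => c * K x y + K' x y).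
Proof. by move=> gK gK'; exact: (@within_continuous_lin R _ R _ c _ _ gK gK'). Qed.

Lemma ckernel_bounded K : ckernel K -> exists2 b : R, 0 <= b & forall x y, V x -> S y -> `|K x y| <= b.
Proof.
move=> gK; have [b b0 hb] := compact_within_bounded (compact_setX cV cS) gK.
by exists b => // x y Vx Sy; exact: (hb (x, y)).
Qed.

Lemma ckernel_unif (W : normedModType R) (K : 'rV[R]_d -> 'rV[R]_d -> W) :
  {within V `*` S, continuous (fun z => K z.1 z.2)} ->
  forall e : R, 0 < e -> exists2 r : R, 0 < r &
  forall x x' y, V x -> V x' -> S y -> `|x - x'| < r -> `|K x y - K x' y| <= e.
Proof.
move=> gK e e0; have [r r0 hr] := compact_unif (compact_setX cV cS) gK e0.
exists r => // x x' y Vx Vx' Sy xx'; apply: ltW.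
apply: (hr (x, y) (x', y)) => //; split => /=; last exact: ballxx.
by rewrite mx_norm_ball.
Qed.

(** Extended by 0 outside V, where nothing is assumed of the kernel. *)
Definition kernel_op K u : Y := fun x => if pselect (V x) then I (K x) u else 0.

Lemma kernel_opE K u x : V x -> kernel_op K u x = I (K x) u.
Proof. by rewrite /kernel_op; case: pselect. Qed.

Lemma kernel_op_out K u x : ~ V x -> kernel_op K u x = 0.
Proof. by rewrite /kernel_op; case: pselect. Qed.

Lemma kernel_op_lin K a u v : ckernel K -> kernel_op K (a *: u + v) = a *: kernel_op K u + kernel_op K v.
Proof.
move=> gK; apply/funext => x; rewrite -[RHS]/(a * kernel_op K u x + kernel_op K v x).
have [Vx|Vx] := pselect (V x); last by rewrite !kernel_op_out// mulr0 addr0.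
by rewrite !kernel_opE// pair_lin_vec//; exact: ckernel_fiber.
Qed.

Lemma kernel_op_linK K K' (a : R) u : ckernel K -> ckernel K' ->
  kernel_op (fun x y => a * K x y + K' x y) u = a *: kernel_op K u + kernel_op K' u.
Proof.
move=> gK gK'; apply/funext => x; rewrite -[RHS]/(a * kernel_op K u x + kernel_op K' u x).
have [Vx|Vx] := pselect (V x); last by rewrite !kernel_op_out// mulr0 addr0.
by rewrite !kernel_opE// pair_lin_fun//; exact: ckernel_fiber.
Qed.

Lemma kernel_op_continuous K u : ckernel K -> {within V, continuous (kernel_op K u)}.
Proof.
move=> gK; apply/(subspace_continuousP V (kernel_op K u)) => x Vx.
apply/cvgrPdist_le => e e0; rewrite near_withinE.
have c0 : 0 <= l1_cst * nX u by rewrite mulr_ge0 ?l1_cst_ge0 ?snorm_ge0.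
have e'0 : 0 < e / (l1_cst * nX u + 1) by rewrite divr_gt0// ltr_wpDl.
have [r r0 hr] := ckernel_unif gK e'0.
apply: filterS (ball_norm_nbhs x r0) => x' xx' Vx'.
rewrite !kernel_opE//; apply: (le_trans (pair_diff u (ckernel_fiber gK Vx) (ckernel_fiber gK Vx') (ltW e'0) _)).
  by move=> y Sy; apply: hr => //; rewrite distrC.
by rewrite -mulrA mulrC mul_div_le// ltW.
Qed.

Lemma kernel_op_DY K u : ckernel K -> DY (kernel_op K u).
Proof. by move=> gK; apply: (within_continuous_L2 hV hsigma'); exact: kernel_op_continuous. Qed.

Lemma nY_le_cst (f : Y) (b : R) : measurable_fun (V : set (borel R d)) (f : borel R d -> R) ->
  0 <= b -> (forall x, V x -> `|f x| <= b) -> nY f <= sqrt_vol * b.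
Proof. by move=> mf b0 fb; exact: (L2norm_le_cst mV finV mf b0 fb). Qed.

Lemma kernel_op_norm K (b : R) u : ckernel K -> 0 <= b -> (forall x y, V x -> S y -> `|K x y| <= b) ->
  nY (kernel_op K u) <= sqrt_vol * l1_cst * b * nX u.
Proof.
move=> gK b0 Kb; rewrite (_ : _ * nX u = sqrt_vol * (b * l1_cst * nX u)); last by ring.
apply: nY_le_cst; first exact: (kernel_op_DY u gK).1.
  by rewrite !mulr_ge0 ?l1_cst_ge0 ?snorm_ge0.
by move=> x Vx; rewrite kernel_opE//; apply: pair_bound => //; [exact: ckernel_fiber|move=> y Sy; exact: Kb].
Qed.

Lemma kernel_op_bop K (b kap : R) : ckernel K -> 0 <= b -> (forall x y, V x -> S y -> `|K x y| <= b) ->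
  sqrt_vol * l1_cst * b <= kap -> bounded_op ip DY ipY (kernel_op K) kap.
Proof.
move=> gK b0 Kb bk; split.
- by move=> a u v; exact: kernel_op_lin.
- by move=> u; exact: kernel_op_DY.
- move=> u; apply: (le_trans (kernel_op_norm u gK b0 Kb)).
  by rewrite ler_wpM2r ?snorm_ge0.
Qed.

Lemma kernel_op_sub K K' u : ckernel K -> ckernel K' ->
  kernel_op K u - kernel_op K' u = kernel_op (fun x y => (-1) * K' x y + K x y) u.
Proof. by move=> gK gK'; rewrite kernel_op_linK// scaleN1r addrC. Qed.

Lemma kernel_op_diff_norm K K' (e : R) u : ckernel K -> ckernel K' -> 0 <= e ->
  (forall x y, V x -> S y -> `|K x y - K' x y| <= e) ->
  nY (kernel_op K u - kernel_op K' u) <= sqrt_vol * l1_cst * e * nX u.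
Proof.
move=> gK gK' e0 KK'; rewrite kernel_op_sub//; apply: kernel_op_norm => //; first exact: ckernel_lin.
by move=> x y Vx Sy; rewrite mulN1r addrC KK'.
Qed.

Section Ultra.
Context (U : set_system nat) {UU : UltraFilter U}.

Lemma kernel_op_ulim (K_ : nat -> 'rV[R]_d -> 'rV[R]_d -> R) K : (forall n, ckernel (K_ n)) -> ckernel K ->
  (forall e : R, 0 < e -> \forall n \near U, forall x y, V x -> S y -> `|K_ n x y - K x y| <= e) ->
  ulim_op ip ipY U (fun n => kernel_op (K_ n)) (kernel_op K).
Proof.
move=> gK_ gK h e e0.
have c0 : 0 <= sqrt_vol * l1_cst by rewrite mulr_ge0 ?l1_cst_ge0 ?sqrt_vol_ge0.
have e'0 : 0 < e / (sqrt_vol * l1_cst + 1) by rewrite divr_gt0// ltr_wpDl.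
apply: filterS (h _ e'0) => n hn phi.
apply: (le_trans (kernel_op_diff_norm phi (gK_ n) gK (ltW e'0) hn)).
by rewrite ler_wpM2r ?snorm_ge0// mul_div_le// ltW.
Qed.

(** Equicontinuity reduces uniform convergence on V to convergence at the points
    of a finite net. *)
Lemma kernel_op_compact K : ckernel K -> ucompact_op ip ipY U (kernel_op K).
Proof.
move=> gK f r fr e e0.
have r0 : 0 <= r by apply: le_trans (fr 0%N); exact: snorm_ge0.
have [b b0 Kb] := ckernel_bounded gK.
have cr : 0 <= l1_cst * r by rewrite mulr_ge0 ?l1_cst_ge0.
have [e' e'0 he'] : exists2 e', 0 < e' & sqrt_vol * (4 * e') <= e.
  exists (e / (4 * sqrt_vol + 1)); first by rewrite divr_gt0// ltr_wpDl// mulr_ge0 ?sqrt_vol_ge0.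
  by rewrite mulrA [sqrt_vol * 4]mulrC mul_div_le ?mulr_ge0 ?sqrt_vol_ge0// ltW.
have et0 : 0 < e' / (l1_cst * r + 1) by rewrite divr_gt0// ltr_wpDl.
have [rho rho0 hrho] := ckernel_unif gK et0.
have [s [sV hs]] := compact_net cV rho0.
have eq n x x' : V x -> V x' -> `|x - x'| < rho -> `|kernel_op K (f n) x - kernel_op K (f n) x'| <= e'.
  move=> Vx Vx' xx'; rewrite !kernel_opE//.
  apply: (le_trans (pair_diff (f n) (ckernel_fiber gK Vx) (ckernel_fiber gK Vx') (ltW et0) _)).
    by move=> y Sy; exact: hrho.
  apply: (@le_trans _ _ (e' / (l1_cst * r + 1) * (l1_cst * r))).
    by rewrite -mulrA ler_wpM2l ?(ltW et0)// ler_wpM2l ?l1_cst_ge0.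
  by rewrite mulrC mul_div_le// ltW.
have lim x : x \in s -> exists l : R, \forall n \near U, `|kernel_op K (f n) x - l| <= e'.
  move=> /sV Vx; have [n|l hl] := @ultra_bounded R U UU (fun n => kernel_op K (f n) x) (b * l1_cst * r).
    rewrite kernel_opE//; apply: (le_trans (pair_bound (f n) (ckernel_fiber gK Vx) b0 _)).
      by move=> y Sy; exact: Kb.
    by rewrite ler_wpM2l ?mulr_ge0 ?l1_cst_ge0.
  exists l; have /cvgrPdist_le /(_ _ e'0) := hl.
  by apply: filterS => n; rewrite distrC.
have /choice [l hl] : forall x, exists l : R, x \in s -> \forall n \near U, `|kernel_op K (f n) x - l| <= e'.
  move=> x; have [xs|xs] := boolP (x \in s); last by exists 0.
  by have [l hl] := lim x xs; exists l.
have hn : \forall n \near U, forall z, z \in s -> `|kernel_op K (f n) z - l z| <= e'.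
  by apply: near_forall_seq hl.
apply: filterS (hn) => n h1; apply: filterS (hn) => p h2.
apply: le_trans he'; apply: nY_le_cst; first by apply: measurable_funB; exact: (kernel_op_DY _ gK).1.
  by rewrite mulr_ge0// ltW.
move=> x Vx; have [y ys yx] := hs x Vx; have Vy := sV y ys.
have {}yx : `|x - y| < rho by move: yx; rewrite mx_norm_ball /ball_/= distrC.
have a1 := eq n x y Vx Vy yx; have a2 := h1 y ys; have a3 := h2 y ys; have a4 := eq p x y Vx Vy yx.
rewrite -[_ x]/(kernel_op K (f n) x - kernel_op K (f p) x).
move: a1 a2 a3 a4; rewrite !ler_norml => /andP[? ?] /andP[? ?] /andP[? ?] /andP[? ?].
by apply/andP; split; lra.
Qed.

End Ultra.
End Kernel.

(** * Dependence on a parameter *)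

Lemma derivable_near (R : realType) (T W : normedModType R) (g : T -> W) x v :
  derivable g x v -> forall e : R, 0 < e -> \forall h \near (0 : R),
    `|g (x + h *: v) - g x - h *: 'D_v g x| <= e * `|h|.
Proof.
move=> dg e e0; have /cvgrPdist_le /(_ _ e0) := dg; rewrite near_withinE.
apply: filterS => h hh; have [->|h0] := eqVneq h 0.
  by rewrite !scale0r addr0 subrr sub0r oppr0 !normr0 mulr0.
have := hh h0; rewrite -[lim _]/('D_v g x) => h1.
rewrite (_ : _ - _ = - (h *: ('D_v g x - h^-1 *: (g (h *: v + x) - g x)))).
  by rewrite normrN normrZ mulrC ler_wpM2r.
by rewrite scalerBr scalerA mulfV// scale1r opprB [x + _]addrC.
Qed.

Lemma derivable_segment (R : realType) (T W : normedModType R) (g : T -> W) x v a (c e : R) :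
  0 <= e -> (forall t : R, 0 <= t <= 1 -> derivable g (x + (t * c) *: v) v /\
    `|'D_v g (x + (t * c) *: v) - a| <= e) ->
  `|g (x + c *: v) - g x - c *: a| <= e * `|c|.
Proof.
move=> e0 hg; pose h (t : R) := g (x + (t * c) *: v) - (t * c) *: a.
have := @lipschitz_segment R W h (e * `|c|).
rewrite /h !mul1r !mul0r !scale0r addr0 subr0 => hh.
rewrite addrAC; apply: hh => t eta t01 eta0.
have [dt Dt] := hg t t01; have e'0 : 0 < eta / (`|c| + 1) by rewrite divr_gt0// ltr_wpDl.
have /nbhs_normP[r r0 hr] := derivable_near dt e'0.
have r'0 : 0 < r / (`|c| + 1) by rewrite divr_gt0// ltr_wpDl.
apply/nbhs_normP; exists (r / (`|c| + 1)) => // s /= st s01.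
have ec : `|(s - t) * c| < r.
  rewrite normrM distrC; apply: (@le_lt_trans _ _ (`|t - s| * (`|c| + 1))).
    by rewrite ler_wpM2l// lerDl.
  by rewrite -ltr_pdivlMr// ltr_wpDl.
have := hr ((s - t) * c); rewrite /= sub0r normrN => /(_ ec).
have -> : x + (t * c) *: v + ((s - t) * c) *: v = x + (s * c) *: v.
  by rewrite -addrA -scalerDl -mulrDl (addrC t) subrK.
set D := 'D_v g _ in Dt *; set gs := g _; set gt := g _ => h1.
rewrite (_ : _ - _ = (gs - gt - ((s - t) * c) *: D) + ((s - t) * c) *: (D - a)).
  2: by rewrite scalerBr addrA subrK mulrBl scalerBl !opprB [LHS]addrACA [RHS]addrACA; congr (_ + _); rewrite addrC.
apply: (le_trans (ler_normD _ _)); rewrite normrZ.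
have h2 : `|(s - t) * c| * `|D - a| <= `|(s - t) * c| * e by rewrite ler_wpM2l.
apply: (le_trans (lerD h1 h2)); rewrite normrM.
have h3 : eta / (`|c| + 1) * `|c| <= eta by rewrite mulrC mul_div_le// ltW.
have h4 := ler_wpM2r (normr_ge0 (s - t)) h3; lra.
Qed.

(** The mean value inequality along the coordinate path joining the points. *)
Lemma partials_box (R : realType) (p : nat) (W : normedModType R) (g : 'rV[R]_p -> W)
    (m : 'rV[R]_p) (r e : R) (a : 'I_p -> W) : 0 <= e ->
  (forall i m', `|m' - m| < r -> derivable g m' (delta_mx 0 i) /\
     `|'D_(delta_mx 0 i) g m' - a i| <= e) ->
  forall m1 m2, `|m1 - m| < r -> `|m2 - m| < r ->
  `|g m1 - g m2 - \sum_i (m1 - m2) 0 i *: a i| <= e * \sum_i `|(m1 - m2) 0 i|.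
Proof.
move=> e0 hg m1 m2 h1 h2.
pose w j : 'rV[R]_p := \row_i (if (i < j)%N then m1 0 i else m2 0 i).
have w0 : w 0%N = m2 by apply/rowP => i; rewrite mxE.
have wp : w p = m1 by apply/rowP => i; rewrite mxE ltn_ord.
have wS (j : 'I_p) : w j.+1 = w j + (m1 - m2) 0 j *: delta_mx 0 j.
  apply/rowP => i; rewrite !mxE eqxx/= ltnS leq_eqVlt.
  have [->|ij] := eqVneq i j; first by rewrite eqxx ltnn/= mulr1 addrCA subrr addr0.
  by rewrite -val_eqE in ij; rewrite (negbTE ij)/= mulr0 addr0.
have r0 : 0 < r by exact: le_lt_trans h1.
have wr (j : 'I_p) (t : R) : 0 <= t <= 1 ->
    `|w j + (t * (m1 - m2) 0 j) *: delta_mx 0 j - m| < r.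
  move=> /andP[t0 t1]; pose r1 := Num.max `|m1 - m| `|m2 - m|.
  apply: (@le_lt_trans _ _ r1); last by rewrite gt_max h1.
  apply/rV_norm_le => [|i]; first by rewrite le_max normr_ge0.
  have a1 : `|(m1 - m) 0 i| <= r1 by rewrite le_max rV_norm_coord.
  have a2 : `|(m2 - m) 0 i| <= r1 by rewrite le_max rV_norm_coord orbT.
  move: a1 a2; rewrite !mxE eqxx/=; have [->|ij] := eqVneq i j.
    rewrite ltnn mulr1 !ler_norml => /andP[p1 p2] /andP[p3 p4].
    have e1 : m2 0 j + t * (m1 0 j - m2 0 j) - m 0 j =
      t * (m1 0 j - m 0 j) + (1 - t) * (m2 0 j - m 0 j) by ring.
    rewrite e1; move: (m1 0 j - m 0 j) (m2 0 j - m 0 j) p1 p2 p3 p4 => b1 b2 p1 p2 p3 p4.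
    by apply/andP; split; nra.
  by rewrite mulr0 addr0; case: ifP.
have -> : g m1 - g m2 - \sum_i (m1 - m2) 0 i *: a i =
    \sum_(i < p) (g (w i.+1) - g (w i) - (m1 - m2) 0 i *: a i).
  rewrite sumrB; congr (_ - _).
  by rewrite -(big_mkord xpredT (fun i => g (w i.+1) - g (w i))) telescope_sumr// w0 wp.
rewrite mulr_sumr; apply: (le_trans (ler_norm_sum _ _ _)); apply: ler_sum => i _.
by rewrite wS; apply: derivable_segment => // t t01; exact: hg (wr _ _ t01).
Qed.

Section ParameterDependence.
Context {R : realType} {p : nat} {Z : topologicalType} {W : normedModType R}.
Variables (K : set Z).
Hypothesis cK : compact K.
Implicit Types (B : set 'rV[R]_p) (G : 'rV[R]_p -> Z -> W).

(** The tube lemma makes continuity at m uniform over the compact K. *)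
Lemma param_near G B m : {within B `*` K, continuous (fun z => G z.1 z.2)} -> B m ->
  forall e : R, 0 < e -> \forall m' \near m, B m' -> forall z, K z -> `|G m' z - G m z| <= e.
Proof.
move=> cG Bm e e0; have e20 : 0 < e / 2 by rewrite divr_gt0.
have /compact_near_coveringP/(_ _ (within B (nbhs m))
  (fun m' z => K z -> `|G m' z - G m z| <= e) _) h := cK.
have : \forall m' \near within B (nbhs m), K `<=` (fun z => K z -> `|G m' z - G m z| <= e).
  apply: h => z Kz.
  have := (subspace_continuousP _ _).1 cG (m, z) (conj Bm Kz).
  move=> /cvgrPdist_le /(_ _ e20); rewrite near_withinE => -[[N1 N2] [/= n1 n2] N12].
  exists (N2, [set m' | B m' /\ N1 m']) => /=.
    by split => //; apply: filterS n1 => m' N1m' Bm'.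
  move=> [z' m'] [/= z'2 [Bm' m'1]] Kz'.
  have a1 := N12 (m', z') (conj m'1 z'2) (conj Bm' Kz').
  have a2 := N12 (m, z') (conj (nbhs_singleton n1) z'2) (conj Bm Kz').
  rewrite /= in a1 a2; rewrite -(subrKA (G m z)) (splitr e).
  rewrite (_ : _ + _ = (G m z - G m z') - (G m z - G m' z')).
    by rewrite (le_trans (ler_normB _ _))// lerD.
  by rewrite opprB [RHS]addrC.
by rewrite near_withinE; apply: filterS => m' hm' Bm' z Kz; exact: hm'.
Qed.

Section Local.
Variables (B' : set 'rV[R]_p) (G : 'rV[R]_p -> Z -> W) (DG : 'I_p -> 'rV[R]_p -> Z -> W).
Hypotheses (oB' : open B')
  (dG : forall i m z, B' m -> K z -> derivable (fun m' => G m' z) m (delta_mx 0 i))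
  (DGE : forall i m z, 'D_(delta_mx 0 i) (fun m' => G m' z) m = DG i m z)
  (cDG : forall i, {within B' `*` K, continuous (fun z => DG i z.1 z.2)}).

(** Differentiability at m is strict, since the partial derivatives are
    continuous, and uniform in z, since K is compact. *)
Lemma param_local m : B' m -> forall e : R, 0 < e -> exists2 r : R, 0 < r &
  forall m1 m2 z, `|m1 - m| < r -> `|m2 - m| < r -> K z ->
  `|G m1 z - G m2 z - \sum_i (m1 - m2) 0 i *: DG i m z| <= e * \sum_i `|(m1 - m2) 0 i|.
Proof.
move=> B'm e e0.
have h : \forall m' \near m, B' m' /\ forall i, i \in index_enum 'I_p -> forall z, K z ->
    `|DG i m' z - DG i m z| <= e.
  have hB : \forall m' \near m, B' m' by exact: open_nbhs_nbhs.
  have hD : \forall m' \near m, forall i, i \in index_enum 'I_p -> B' m' -> forall z, K z ->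
      `|DG i m' z - DG i m z| <= e.
    apply: (near_forall_seq (F := nbhs m) (P := fun i m' => B' m' -> forall z, K z ->
      `|DG i m' z - DG i m z| <= e)) => i _.
    have h := param_near (@cDG i) B'm e0.
    by apply: filterS h => m'.
  by apply: filterS (filterI hB hD) => m' [b d']; split => // i /d'; exact.
have /nbhs_normP[r r0 hr] := h.
exists r => // m1 m2 z h1 h2 Kz.
apply: (partials_box (g := fun m' => G m' z) (m := m) (r := r) (ltW e0)) => // i m' m'r.
have [|Bm' hi] := hr m'; first by rewrite /ball_/= distrC.
split; first exact: dG.
by rewrite DGE; apply: hi => //; rewrite mem_index_enum.
Qed.

(** A radius common to all points of B is found by compactness; at larger
    distances G is merely bounded. *)
Lemma param_lipschitz B : compact B -> B `<=` B' ->
  {within B `*` K, continuous (fun z => G z.1 z.2)} ->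
  exists2 L : R, 0 <= L & forall m1 m2 z, B m1 -> B m2 -> K z ->
    `|G m1 z - G m2 z| <= L * enorm (m1 - m2).
Proof.
move=> cB BB' cG; have [b b0 hb] := compact_within_bounded (compact_setX cB cK) cG.
have /compact_near_coveringP/(_ _ (nbhs \oo) (fun n m => forall m1 m2 z, `|m1 - m| < 2 * n.+1%:R^-1 ->
  `|m2 - m| < 2 * n.+1%:R^-1 -> K z -> `|G m1 z - G m2 z| <= n%:R * enorm (m1 - m2)) _) h := cB.
have [m Bm|n _ hn] := h _.
  have [r r0 hr] := param_local (BB' _ Bm) ltr01.
  have [c c0 hc] : exists2 c : R, 0 <= c & forall i z, K z -> `|DG i m z| <= c.
    have /choice [b' hb'] i : exists c : R, 0 <= c /\ forall z, K z -> `|DG i m z| <= c.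
      have cf := within_continuous_fiber (@cDG i) (BB' _ Bm).
      by have [c c0 hc] := compact_within_bounded cK cf; exists c.
    exists (\sum_i b' i); first by apply: sumr_ge0 => i _; case: (hb' i).
    move=> i z Kz; have [_ hi] := hb' i; apply: (le_trans (hi z Kz)).
    rewrite (bigD1 i)//= lerDl; apply: sumr_ge0 => j _; by case: (hb' j).
  pose x := 4 / r + (1 + c) * p%:R.
  have r40 : 0 <= 4 / r by rewrite divr_ge0// ltW.
  have cp0 : 0 <= (1 + c) * p%:R by rewrite mulr_ge0// addr_ge0.
  have x0 : 0 <= x by rewrite addr_ge0.
  have r20 : 0 < r / 2 by rewrite divr_gt0.
  exists ([set m' | `|m' - m| < r / 2], [set n | (Num.bound x <= n)%N]) => /=.
    by split; [exact: ball_norm_nbhs|exists (Num.bound x)].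
  move=> [m' n] [/= m'r xn] m1 m2 z h1 h2 Kz.
  have xn' : x <= n%:R.
    by apply/ltW/(lt_le_trans (archi_boundP x0)); rewrite ler_nat.
  have rn : 2 * n.+1%:R^-1 <= r / 2 :> R.
    rewrite ler_pdivrMr// mulrAC ler_pdivlMr// -ler_pdivrMl//.
    apply: (@le_trans _ _ n%:R); last by rewrite ler_nat.
    by apply: le_trans xn'; rewrite /x; lra.
  have near m3 : `|m3 - m'| < 2 * n.+1%:R^-1 -> `|m3 - m| < r.
    move=> h3; rewrite -(subrKA m') (splitr r) (le_lt_trans (ler_normD _ _))// ltrD//.
      exact: lt_le_trans rn.
  have {}h := hr _ _ _ (near _ h1) (near _ h2) Kz.
  set s := \sum_i (m1 - m2) 0 i *: _ in h; rewrite -(subrK s (_ - _)).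
  apply: (le_trans (ler_normD _ _)).
  have hs : `|s| <= c * \sum_i `|(m1 - m2) 0 i|.
    rewrite mulr_sumr; apply: (le_trans (ler_norm_sum _ _ _)); apply: ler_sum => i _.
    by rewrite normrZ mulrC ler_wpM2r// hc.
  apply: (le_trans (lerD h hs)); rewrite -mulrDl.
  have q0 := enorm_ge0 (m1 - m2).
  have c10 : 0 <= 1 + c by rewrite addr_ge0.
  have hq : \sum_i `|(m1 - m2) 0 i| <= p%:R * enorm (m1 - m2).
    rewrite mulr_natl -[X in _ *+ X]card_ord -sumr_const; apply: ler_sum => i _.
    exact: coord_enorm.
  apply: (le_trans (ler_wpM2l c10 hq)); rewrite mulrA ler_wpM2r//.
  by apply: le_trans xn'; rewrite /x lerDr.
have {}hn := hn n (leqnn n).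
exists (n%:R + 2 * b * n.+1%:R) => [|m1 m2 z B1 B2 Kz].
  by rewrite addr_ge0// !mulr_ge0.
have q0 := enorm_ge0 (m1 - m2); rewrite mulrDl.
have [h12|h12] := ltP `|m1 - m2| (2 * n.+1%:R^-1).
  apply: ler_wpDr; first by rewrite !mulr_ge0.
  by apply: (hn _ B2) => //; rewrite subrr normr0 mulr_gt0.
apply: ler_wpDl; first by rewrite mulr_ge0.
apply: (le_trans (ler_normB _ _)); apply: (le_trans (lerD (hb (m1, z) _) (hb (m2, z) _))) => //.
have h1 : 2 * n.+1%:R^-1 <= enorm (m1 - m2) by apply: (le_trans h12); exact: norm_le_enorm.
have n0 : 0 < n.+1%:R :> R by [].
have h2 : 2 <= n.+1%:R * enorm (m1 - m2).
  by move: h1; rewrite ler_pdivrMr// mulrC.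
by rewrite -mulrA; have := ler_wpM2l b0 h2; lra.
Qed.

End Local.
End ParameterDependence.

(** * Tangential gradients of integrals *)

Section Gradient.
Context {R : realType} {d : nat} (kS kV : nat) (S V : set 'rV[R]_d).
Variables (sigma : {measure set (borel R d) -> \bar R}).
Hypotheses (hS : compact_submanifold kS S) (hsigma : surface_measure kS S sigma).
Hypotheses (hV : compact_submanifold kV V).
Hypothesis hP : poincare sigma kS S.
Local Notation X := (sobolev hS hsigma).
Local Notation ip := (fun u v : X => h_dot u v).
Local Notation nX := (snorm ip).
Local Notation l1_cst := (l1_cst hS hsigma hP).
Local Notation I a u := (\int[sigma]_(y in (S : set (borel R d))) (a y * h_val u y)).
Implicit Types (K : 'rV[R]_d -> 'rV[R]_d -> R) (G : 'rV[R]_d -> 'rV[R]_d -> 'rV[R]_d) (u v : X).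

Definition pair_vec (g : 'rV[R]_d -> 'rV[R]_d) u : 'rV[R]_d := \row_j I (fun y => g y 0 j) u.

Lemma pair0 (a : 'rV[R]_d -> R) u : (forall y, S y -> a y = 0) -> I a u = 0.
Proof. by move=> a0; rewrite /Rintegral integral0_eq// => y Sy; rewrite a0// mul0r. Qed.

Lemma pair_edot (g : 'rV[R]_d -> 'rV[R]_d) (a : 'rV[R]_d) u : {within S, continuous g} ->
  {within S, continuous (fun y => edot a (g y))} /\
  I (fun y => edot a (g y)) u = edot a (pair_vec g u).
Proof.
move=> cg; rewrite /edot; elim: (index_enum _) => [|i s [IHc IHi]].
  under eq_fun do rewrite big_nil.
  rewrite big_nil; split; first by move=> x; exact: cvg_cst.
  by apply: pair0 => y _; rewrite big_nil.
have cgi := within_continuous_coord (i := i) cg.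
under eq_fun do rewrite big_cons; rewrite big_cons mxE -IHi; split.
  exact: (@within_continuous_lin R _ R S (a 0 i) _ _ cgi IHc).
rewrite -(pair_lin_fun (a 0 i) u cgi IHc).
by apply: eq_Rintegral => y _; rewrite big_cons.
Qed.

Lemma expands_edot (M : set 'rV[R]_d) (a x : 'rV[R]_d) : expands M (edot a) x a.
Proof.
move=> e e0; apply/nbhs_normP; exists (1 : R); first exact: ltr01.
by move=> y _ _; rewrite edotBr subrr normr0 mulr_ge0 ?enorm_ge0 ?(ltW e0).
Qed.

Section OneKernel.
Variables (K : 'rV[R]_d -> 'rV[R]_d -> R) (G : 'rV[R]_d -> 'rV[R]_d -> 'rV[R]_d).
Hypotheses (gK : ckernel S V K) (cG : {within V `*` S, continuous (fun z => G z.1 z.2)})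
  (KG : forall x y, V x -> S y -> is_tgrad kV V (fun x' => K x' y) x (G x y)).

(** The first order expansions of the kernel are uniform in y, by the mean value
    inequality applied to the kernel minus its linear part. *)
Lemma kernel_expansion x (e : R) : V x -> 0 < e -> exists2 r : R, 0 < r & forall x' y, V x' ->
  S y -> `|x' - x| < r -> `|K x' y - K x y - edot (G x y) (x' - x)| <= e * `|x' - x|.
Proof.
move=> Vx e0; have [r0 [L [r00 L1 hL]]] := local_mvt hV Vx.
have L0 : 0 < L by exact: lt_le_trans L1.
have eta0 : 0 < e / L by rewrite divr_gt0.
have eta'0 : 0 < e / L / (d%:R + 1) by rewrite divr_gt0// ltr_wpDl.
have [r1 r10 hr1] := ckernel_unif hS hV cG eta'0.
pose rho := Num.min r0 (r1 / L).
have rho0 : 0 < rho by rewrite lt_min r00 divr_gt0.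
exists rho => // x' y Vx' Sy xx'.
have := hL rho (e / L) (fun x' => (-1) * edot (G x y) x' + K x' y)
  (fun x' => (-1) *: G x y + G x' y) _ (ltW eta0) _ x' Vx' xx'.
rewrite divfK ?gt_eqF// edotBr => h.
rewrite (_ : _ - _ = -1 * edot (G x y) x' + K x' y - (-1 * edot (G x y) x + K x y)).
  2: by ring.
apply: h; first by rewrite rho0 ge_min lexx.
move=> z Vz zx; split.
  by apply: expands_lin; [exact: expands_edot|exact: (KG Vz Sy).2].
rewrite scaleN1r addrC; apply: (le_trans (enorm_le_norm _)).
apply: (le_trans (ler_wpM2l (ler0n _ _) (hr1 z x y Vz Vx Sy _))).
  by apply: (lt_le_trans zx); rewrite mulrC -ler_pdivlMr// ge_min lexx orbT.
by rewrite mul_div_le// ltW.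
Qed.

(** Tangency at x is the vanishing of linear forms read in one and the same chart
    for all y, and linear forms commute with the integral. *)
Lemma pair_vec_tangent x u : V x -> tangent kV V x (pair_vec (G x) u).
Proof.
move=> Vx; have cGx := within_continuous_fiber cG Vx.
have [/andP[kV0 kVd] _ hch] := hV.
have [U [phi [sc Ux]]] := hch x Vx.
exists U, phi; split => // i ki.
have dphi : differentiable phi x by case: sc => W [psi [_ _ /(_ x Ux)[]]].
pose a : 'rV[R]_d := \row_j ('D_(delta_mx 0 j) phi x) 0 i.
have aE (w : 'rV[R]_d) : ('D_w phi x) 0 i = edot a w.
  rewrite deriveE// [in LHS](matrix_sum_delta w) big_ord1 linear_sum/= summxE.
  by apply: eq_bigr => j _; rewrite mxE linearZ/= mxE deriveE// mulrC.
rewrite aE; have [_ <-] := pair_edot a u cGx.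
apply: pair0 => y Sy.
have d0 : (0 < d)%N by exact: leq_trans kVd.
by rewrite -aE (tangent_chart d0 Vx (KG Vx Sy).1 sc Ux ki).
Qed.

(** The expansion of the kernel, uniform in y, is integrated against u. *)
Lemma kernel_op_tgrad u x : V x -> is_tgrad kV V (kernel_op V K u) x (pair_vec (G x) u).
Proof.
move=> Vx; split; first exact: pair_vec_tangent.
move=> e e0; have cGx := within_continuous_fiber cG Vx.
have e'0 : 0 < e / (l1_cst * nX u + 1) by rewrite divr_gt0// ltr_wpDl// mulr_ge0 ?l1_cst_ge0 ?snorm_ge0.
have [r r0 hr] := kernel_expansion Vx e'0.
apply: filterS (ball_norm_nbhs x r0) => x' xx' Vx'.
have [c [E]] := pair_edot (x' - x) u cGx.
have gx := ckernel_fiber gK Vx; have gx' := ckernel_fiber gK Vx'.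
rewrite !kernel_opE// edotC -E.
have cd := @within_continuous_lin R _ R S (-1) _ _ gx gx'.
have cdd := @within_continuous_lin R _ R S (-1) _ _ c cd.
have := @pair_bound R d kS S sigma hS hsigma hP _ (e / (l1_cst * nX u + 1) * `|x' - x|) u cdd.
rewrite (pair_lin_fun (-1) u c cd) (pair_lin_fun (-1) u gx gx').
rewrite !mulN1r [- _ + _]addrC [- I (K x) u + _]addrC => h.
apply: (le_trans (h _ _)).
- by rewrite mulr_ge0// ltW.
- move=> y Sy; have := hr x' y Vx' Sy xx'; rewrite edotC -[_ *: K x y]/(-1 * K x y).
  rewrite -[_ *: edot _ _]/(-1 * edot (x' - x) (G x y)) => h2; apply: le_trans h2.
  by rewrite le_eqVlt; apply/orP; left; apply/eqP; congr `|_|; ring.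
have n0 := norm_le_enorm (x' - x).
rewrite (_ : _ * nX u = (l1_cst * nX u) * (e / (l1_cst * nX u + 1)) * `|x' - x|); last by ring.
have cn0 : 0 <= l1_cst * nX u by rewrite mulr_ge0 ?l1_cst_ge0 ?snorm_ge0.
apply: ler_pM => //; last by rewrite mul_div_le// ltW.
by rewrite mulr_ge0// ltW.
Qed.

Lemma pair_vec_continuous u : {within V, continuous (fun x => pair_vec (G x) u)}.
Proof.
apply/(subspace_continuousP V (fun x => pair_vec (G x) u)) => x Vx.
apply/cvgrPdist_le => e e0; rewrite near_withinE.
have c0 : 0 <= l1_cst * nX u by rewrite mulr_ge0 ?l1_cst_ge0 ?snorm_ge0.
have e'0 : 0 < e / (l1_cst * nX u + 1) by rewrite divr_gt0// ltr_wpDl.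
have [r r0 hr] := ckernel_unif hS hV cG e'0.
apply: filterS (ball_norm_nbhs x r0) => x' xx' Vx'.
apply: rV_norm_le => [|j]; first exact: ltW.
have cc z : V z -> {within S, continuous (fun y => G z y 0 j)}.
  by move=> Vz; apply: within_continuous_coord; exact: within_continuous_fiber Vz.
rewrite !mxE; apply: (le_trans (pair_diff hP u (cc _ Vx) (cc _ Vx') (ltW e'0) _)).
  move=> y Sy; have := hr x x' y Vx Vx' Sy; rewrite distrC => /(_ xx').
  by apply: le_trans; have := rV_norm_coord (G x y - G x' y) j; rewrite !mxE.
by rewrite -mulrA mulrC mul_div_le// ltW.
Qed.

End OneKernel.
End Gradient.

(** * The inverse problem *)

Lemma within_continuous_assoc (T1 T2 T3 W : topologicalType) (A1 : set T1) (A2 : set T2)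
    (A3 : set T3) (f : T1 -> T2 -> T3 -> W) :
  {within A1 `*` A2 `*` A3, continuous (fun z => f z.1.1 z.1.2 z.2)} ->
  {within A1 `*` (A2 `*` A3), continuous (fun z => f z.1 z.2.1 z.2.2)}.
Proof.
move=> cf; apply/(subspace_continuousP _ (fun z : T1 * (T2 * T3) => f z.1 z.2.1 z.2.2)).
move=> [x1 [x2 x3]] [/= A1x [A2x A3x]] N hN.
have [[N12 N3] [/= [[N1 N2] [/= n1 n2] h12] n3] h] :=
  (subspace_continuousP _ _).1 cf ((x1, x2), x3) (conj (conj A1x A2x) A3x) N hN.
exists (N1, N2 `*` N3); first by split => //; exists (N2, N3).
move=> [y1 [y2 y3]] [/= h1 [/= h2 h3]] [/= a1 [a2 a3]].
exact: (h ((y1, y2), y3) (conj (h12 (y1, y2) (conj h1 h2)) h3) (conj (conj a1 a2) a3)).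
Qed.

Lemma ae_on_imp (R : realType) (d : nat) (mu : {measure set (borel R d) -> \bar R})
    (M : set 'rV[R]_d) (P Q : 'rV[R]_d -> Prop) :
  (forall x, M x -> P x -> Q x) -> ae_on mu M P -> ae_on mu M Q.
Proof. by move=> PQ; rewrite /ae_on; apply: filterS => x h Mx; apply: PQ => //; exact: h. Qed.

Lemma splitr3 (R : realType) (x : R) : x = x / 3 + x / 3 + x / 3.
Proof. by field. Qed.

Lemma sup_bound (R : realType) (T : Type) (f : T -> R) (D : set T) (s : R) : D !=set0 ->
  (forall x, D x -> 0 <= f x <= s) -> 0 <= sup [set f x | x in D] <= s.
Proof.
move=> [x Dx] h; have hs : sup [set f x | x in D] <= s.
  by apply: ge_sup => [|_ [y Dy <-]]; [exists (f x); exists x|case/andP: (h y Dy)].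
rewrite hs andbT; apply: (@le_trans _ _ (f x)); first by case/andP: (h x Dx).
by apply: ub_le_sup; [exists s => _ [y Dy <-]; case/andP: (h y Dy)|exists x].
Qed.

Lemma powR_small (R : realType) (M : nat -> nat) (k : nat) (e : R) : (0 < k)%N -> 0 < e ->
  (forall n, (0 < M n < M n.+1)%N) ->
  exists N, forall n, (N < n)%N -> (M n)%:R `^ (- (k%:R)^-1) <= e.
Proof.
move=> k0 e0 hM.
have Mn n : (n < M n)%N.
  by elim: n => [|n IH]; [case/andP: (hM 0%N)|case/andP: (hM n) => _; exact: leq_trans].
have i0 : 0 <= e^-1 by rewrite invr_ge0 ltW.
exists (Num.bound (e^-1 ^+ k)) => n Nn.
have h1 : e^-1 ^+ k <= (M n)%:R.
  apply/ltW/(lt_trans (archi_boundP (exprn_ge0 _ i0))); rewrite ltr_nat.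
  exact: ltn_trans Nn (Mn n).
rewrite powRN; set y := _ `^ _.
have yk : y ^+ k = (M n)%:R.
  by rewrite -powR_mulrn ?powR_ge0// -powRrM mulVf ?pnatr_eq0 -?lt0n// powRr1.
have y0 : 0 <= y by exact: powR_ge0.
have h2 : e^-1 <= y by rewrite -(@ler_pXn2r _ k) ?nnegrE// yk.
rewrite -[leRHS]invrK lef_pV2 ?posrE ?invr_gt0//.
by apply: lt_le_trans h2; rewrite invr_gt0.
Qed.

Section Problem.
Context {R : realType} {d p : nat} (kS kV : nat) (S V : set 'rV[R]_d).
Hypotheses (hS : compact_submanifold kS S) (hV : compact_submanifold kV V).
Variables (sigma sigma' : {measure set (borel R d) -> \bar R}).
Hypotheses (hsigma : surface_measure kS S sigma) (hsigma' : surface_measure kV V sigma').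
Hypothesis hP : poincare sigma kS S.
Variables (B B' : set 'rV[R]_p).
Hypotheses (hB : compact B) (hB' : open B') (hBB' : B `<=` B').
Variable H : 'rV[R]_p -> 'rV[R]_d -> 'rV[R]_d -> R.
Hypotheses (hreg1 : regular1 H kV V S B) (hreg2 : regular2 H kV V S B').
Local Notation X := (sobolev hS hsigma).
Local Notation Y := ('rV[R]_d -> R).
Local Notation ip := (fun u v : X => h_dot u v).
Local Notation DY := (@L2 _ (borel R d) R sigma' V).
Local Notation ipY := (@L2dot _ (borel R d) R sigma' V).
Local Notation nX := (snorm ip).
Local Notation nY := (snorm ipY).
Local Notation l1_cst := (l1_cst hS hsigma hP).
Local Notation A := (fun m => @kernel_op R d kS S V sigma hS hsigma (H m)).
Local Notation bounded_op := (bounded_op ip DY ipY).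
Local Notation tower := (tower ip ipY).
Implicit Types (u v w : X).

Let mV : measurable (V : set (borel R d)). Proof. exact: submanifold_measurable hV. Qed.
Let mS : measurable (S : set (borel R d)). Proof. exact: submanifold_measurable hS. Qed.
Let finV : (sigma' V < +oo)%E. Proof. exact: surface_measure_fin hV hsigma'. Qed.
Let cS : compact S. Proof. by case: hS. Qed.
Let cV : compact V. Proof. by case: hV. Qed.
Let cVS : compact (V `*` S). Proof. exact: compact_setX. Qed.

Let ipC u v : ip u v = ip v u. Proof. exact: h_dotC. Qed.
Let ip_lin a u v w : ip (a *: u + v) w = a * ip u w + ip v w. Proof. exact: h_dot_lin. Qed.
Let ip_ge0 u : 0 <= ip u u. Proof. exact: h_dot_ge0. Qed.
Let DY_lin a (f g : Y) : DY f -> DY g -> DY (a *: f + g). Proof. exact: L2_lin. Qed.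
Let DY0 : DY 0. Proof. exact: L2_0. Qed.
Let ipYC (f g : Y) : ipY f g = ipY g f. Proof. exact: L2dotC. Qed.
Let ipY_lin a (f g h : Y) : DY f -> DY g -> DY h -> ipY (a *: f + g) h = a * ipY f h + ipY g h.
Proof. exact: L2dot_lin. Qed.
Let ipY_ge0 (f : Y) : DY f -> 0 <= ipY f f. Proof. exact: L2dot_ge0. Qed.
Let nX_ge0 u : 0 <= nX u. Proof. exact: snorm_ge0. Qed.
Let nXZ a u : nX (a *: u) = `|a| * nX u. Proof. exact: h_normZ. Qed.
Let nXD u v : nX (u + v) <= nX u + nX v. Proof. exact: ler_h_normD. Qed.

Lemma kernel_continuous :
  {within B `*` (V `*` S), continuous (fun z => H z.1 z.2.1 z.2.2)}.
Proof. by case: hreg1 => c _ _; exact: within_continuous_assoc c. Qed.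

Lemma xgrad_continuous :
  {within B `*` (V `*` S), continuous (fun z => xgrad H kV V z.1 z.2.1 z.2.2)}.
Proof. by case: hreg1 => _ _ c; exact: within_continuous_assoc c. Qed.

Lemma mpartial_continuous i :
  {within B' `*` (V `*` S), continuous (fun z => mpartial H i z.1 z.2.1 z.2.2)}.
Proof. by case: hreg2 => _ /(_ i)[_ c _ _]; exact: within_continuous_assoc c. Qed.

Lemma mpartial_xgrad_continuous i :
  {within B' `*` (V `*` S), continuous (fun z => mpartial_xgrad H kV V i z.1 z.2.1 z.2.2)}.
Proof. by case: hreg2 => _ /(_ i)[_ _ _ c]; exact: within_continuous_assoc c. Qed.

Lemma ckernel_H m : B m -> ckernel S V (H m).
Proof. by move=> Bm; exact: (within_continuous_fiber (G := fun m z => H m z.1 z.2) kernel_continuous Bm). Qed.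

Lemma xgrad_fiber m : B m -> {within V `*` S, continuous (fun z => xgrad H kV V m z.1 z.2)}.
Proof. by move=> Bm; exact: (within_continuous_fiber (G := fun m z => xgrad H kV V m z.1 z.2) xgrad_continuous Bm). Qed.

Lemma xgradP m x y : B m -> V x -> S y -> is_tgrad kV V (fun x' => H m x' y) x (xgrad H kV V m x y).
Proof. by case: hreg1 => _ h _ Bm Vx Sy; apply: is_tgrad_tgrad; exact: h. Qed.

Lemma ckernel0 : ckernel S V (fun _ _ => 0).
Proof. by move=> x; exact: cvg_cst. Qed.

Lemma ckernel_mdir q m : B' m -> ckernel S V (mdir H q m).
Proof.
move=> Bm; rewrite /ckernel /mdir; elim: (index_enum _) => [|i s IH].
  by under eq_fun do rewrite big_nil; exact: ckernel0.
under eq_fun do rewrite big_cons mulrC.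
apply: (@within_continuous_lin R _ R (V `*` S) (q 0 i)) => //.
exact: (within_continuous_fiber (G := fun m z => mpartial H i m z.1 z.2) (@mpartial_continuous i) Bm).
Qed.

Lemma kernel_bounds : exists b : R, [/\ 0 <= b,
  forall m x y, B m -> V x -> S y -> `|H m x y| <= b /\ `|xgrad H kV V m x y| <= b &
  forall m m' x y, B m -> B m' -> V x -> S y -> `|H m x y - H m' x y| <= b * enorm (m - m') /\
    `|xgrad H kV V m x y - xgrad H kV V m' x y| <= b * enorm (m - m')].
Proof.
have [b1 b10 h1] := compact_within_bounded (compact_setX hB cVS) kernel_continuous.
have [b2 b20 h2] := compact_within_bounded (compact_setX hB cVS) xgrad_continuous.
have [||b3 b30 h3] := param_lipschitz cVS (G := fun m z => H m z.1 z.2)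
    (DG := fun i m z => mpartial H i m z.1 z.2) hB' _ _ mpartial_continuous hB hBB' kernel_continuous.
- by move=> i m [x y] B'm [Vx Sy]; case: hreg2 => _ /(_ i)[h _ _ _]; exact: h.
- by [].
have [||b4 b40 h4] := param_lipschitz cVS (G := fun m z => xgrad H kV V m z.1 z.2)
    (DG := fun i m z => mpartial_xgrad H kV V i m z.1 z.2) hB' _ _ mpartial_xgrad_continuous hB hBB' xgrad_continuous.
- by move=> i m [x y] B'm [Vx Sy]; case: hreg2 => _ /(_ i)[_ _ h _]; exact: h.
- by [].
exists (b1 + b2 + b3 + b4); split; first by rewrite !addr_ge0.
- move=> m x y Bm Vx Sy; split.
    by have := h1 (m, (x, y)) (conj Bm (conj Vx Sy)); rewrite /=; lra.
  by have := h2 (m, (x, y)) (conj Bm (conj Vx Sy)); rewrite /=; lra.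
- move=> m m' x y Bm Bm' Vx Sy; have n0 := enorm_ge0 (m - m'); split.
    apply: (le_trans (h3 m m' (x, y) Bm Bm' (conj Vx Sy))); rewrite ler_wpM2r//; lra.
  apply: (le_trans (h4 m m' (x, y) Bm Bm' (conj Vx Sy))); rewrite ler_wpM2r//; lra.
Qed.

Lemma h_grad0_norm u : ae_on sigma S (fun x => h_grad u x = 0) -> nX u = 0.
Proof.
move=> h; rewrite /snorm/= h_dotE big1 ?sqrtr0// => i _.
apply: L2_ae0_dot => //; [exact: sob_grad_L2|exact: sob_grad_L2|].
by apply: ae_on_imp h => x Sx ->; rewrite mxE.
Qed.

Lemma L2norm0_ae_on (f : Y) : DY f -> nY f = 0 -> ae_on sigma' V (fun x => f x = 0).
Proof. by move=> Df f0; exact: (L2norm0_ae mV Df f0). Qed.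

Lemma ip_null u v : nX u = 0 -> ip v u = 0.
Proof.
move=> u0; have := h_dot_cs v u; rewrite -[h_norm u]/(nX u) u0 mulr0 normr_le0.
by move=> /eqP.
Qed.

Lemma kernel_op_null (K : 'rV[R]_d -> 'rV[R]_d -> R) u : ckernel S V K -> nX u = 0 -> kernel_op V K u = 0.
Proof.
move=> gK u0; have [b b0 Kb] := ckernel_bounded hS hV gK.
apply/funext => x; rewrite -[RHS]/(0 : R).
have [Vx|Vx] := pselect (V x); last by rewrite kernel_op_out.
rewrite kernel_opE//; apply/eqP; rewrite -normr_le0.
apply: (le_trans (pair_bound hP u (ckernel_fiber gK Vx) b0 _)) => [y Sy|]; first exact: Kb.
by rewrite u0 mulr0.
Qed.

Lemma bounded_op_A m (b kap : R) : B m -> 0 <= b -> (forall x y, V x -> S y -> `|H m x y| <= b) ->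
  sqrt_vol V sigma' * l1_cst * b <= kap -> bounded_op (A m) kap.
Proof. by move=> Bm b0 Hb bk; exact: (kernel_op_bop hV hsigma' (ckernel_H Bm) b0 Hb bk). Qed.

Lemma integral_opE K u x : V x -> integral_op sigma S K u x = kernel_op V K u x.
Proof. by move=> Vx; rewrite kernel_opE. Qed.

(** Members of the span agree with combinations of eigenvectors only almost
    everywhere, whence tower_head. *)
Lemma span_tower m kap beta u : B m -> bounded_op (A m) kap -> 0 < beta ->
  eigenspan_above sigma' V (integral_op sigma S (H m)) (beta ^+ 2) u ->
  exists us, us 0%N = u /\ tower (A m) beta us.
Proof.
move=> Bm bA b0 [n [lam [c [e0 [he hu]]]]]; pose e i : X := e0 i.
have gH := ckernel_H Bm.
have AE (f g : X) : l2dot sigma' V (integral_op sigma S (H m) f) (integral_op sigma S (H m) g) =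
    ipY (A m f) (A m g).
  by apply: eq_Rintegral => x /set_mem Vx; rewrite !integral_opE.
have eig i phi : ipY (A m phi) (A m (e i)) = lam i * ip phi (e i).
  have [_ [_ [w [adj hw]]]] := he i; rewrite -AE adj.
  have w0 : nX ((w : X) - lam i *: e i) = 0.
    apply: h_grad0_norm; apply: ae_on_imp hw => x Sx [_].
    rewrite big_ord1 => gx; apply/rowP => j.
    have := congr1 (fun f => f x) (sob_gradB (w : X) (lam i *: e i) j).
    move=> /= ->; rewrite -[LHS]/(h_grad w x 0 j - h_grad (lam i *: e i : X) x 0 j).
    by rewrite sob_gradZ gx !mxE subrr.
  have := ip_null phi w0.
  rewrite h_dotC -scaleNr addrC h_dot_lin mulNr -(h_dotC phi) -(h_dotC phi).
  by rewrite addrC => /eqP; rewrite subr_eq0 => /eqP.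
have tw := eigen_tower ipC ip_lin ip_ge0 ipYC ipY_lin ipY_ge0 c bA b0 (fun i => (he i).1) eig.
set tt := fun k : nat => _ in tw.
have t0 : tt 0%N = \sum_i c i *: e i by apply: eq_bigr => i _; rewrite expr0 mulr1.
have u0 : nX ((u : X) - tt 0%N) = 0.
  apply: h_grad0_norm; apply: ae_on_imp hu => x Sx [_ gx]; apply/rowP => j.
  have := congr1 (fun f => f x) (sob_gradB (u : X) (tt 0%N) j).
  rewrite t0 /= => ->; rewrite -[LHS]/(h_grad u x 0 j - h_grad (\sum_i c i *: e i : X) x 0 j).
  by rewrite sob_grad_sum gx subrr mxE.
exists (fun k => if k is k'.+1 then tt k else u); split; first by [].
apply: (tower_head ipC tw) => [phi|].
  have := ip_null phi u0; rewrite h_dotC -scaleN1r addrC h_dot_lin mulN1r -!(h_dotC phi).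
  by rewrite addrC => /eqP; rewrite subr_eq0 => /eqP.
have := kernel_op_null gH u0; rewrite (bounded_opB _ _ bA) => /eqP; rewrite subr_eq0 => /eqP; exact.
Qed.

(** The kernel of the difference quotient of the operators. *)
Definition kquot (m m' : 'rV[R]_p) x y : R :=
  (enorm (m - m'))^-1 * H m x y + (- (enorm (m - m'))^-1 * H m' x y + 0).

Lemma ckernel_kquot m m' : B m -> B m' -> ckernel S V (kquot m m').
Proof.
move=> Bm Bm'; apply: ckernel_lin; first exact: ckernel_H.
by apply: ckernel_lin; [exact: ckernel_H|exact: ckernel0].
Qed.

Lemma kquotE m m' u : 0 < enorm (m - m') -> B m -> B m' ->
  A m u - A m' u = enorm (m - m') *: kernel_op V (kquot m m') u.
Proof.
move=> d0 Bm Bm'; apply/eqP; rewrite subr_eq; apply/eqP.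
rewrite -kernel_op_linK; last 2 first.
- exact: ckernel_kquot.
- exact: ckernel_H.
congr (kernel_op V _ u); apply/funext => x; apply/funext => y; rewrite /kquot addr0.
by move: (enorm _) d0 (H m x y) (H m' x y) => e e0 a b; field; rewrite gt_eqF.
Qed.

Section Limits.
Context (U : set_system nat) {UU : UltraFilter U}.

(** As both parameters tend to m, the strict differentiability of param_local is
    what is needed. *)
Lemma kquot_ulim (m_ m'_ : nat -> 'rV[R]_p) (m q : 'rV[R]_p) : B m ->
  (forall n, 0 < enorm (m_ n - m'_ n)) ->
  (forall e : R, 0 < e -> \forall n \near U, `|m_ n - m| < e) ->
  (forall e : R, 0 < e -> \forall n \near U, `|m'_ n - m| < e) ->
  (forall i (e : R), 0 < e -> \forall n \near U,
     `|(enorm (m_ n - m'_ n))^-1 * (m_ n - m'_ n) 0 i - q 0 i| <= e) ->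
  forall e : R, 0 < e -> \forall n \near U, forall x y, V x -> S y ->
    `|kquot (m_ n) (m'_ n) x y - mdir H q m x y| <= e.
Proof.
move=> Bm d0 hm hm' hq e e0.
have e20 : 0 < e / 2 by rewrite divr_gt0.
have ep0 : 0 < e / 2 / (p%:R + 1) by rewrite divr_gt0// ltr_wpDl.
have B'm := hBB' Bm.
have /choice [bi hbi] i : exists c : R, 0 <= c /\ forall z, (V `*` S) z -> `|mpartial H i m z.1 z.2| <= c.
  have cf := within_continuous_fiber (G := fun m z => mpartial H i m z.1 z.2) (@mpartial_continuous i) B'm.
  by have [c c0 hc] := compact_within_bounded cVS cf; exists c.
have [r r0 hr] := param_local cVS (G := fun m z => H m z.1 z.2)
    (DG := fun i m z => mpartial H i m z.1 z.2) hB'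
    (fun i m z => (fun B'm Kz => let: And4 h _ _ _ := hreg2.2 i in h m z.1 z.2 B'm Kz.1 Kz.2))
    (fun i m z => erefl) mpartial_continuous B'm ep0.
pose sb := \sum_i bi i.
have sb0 : 0 <= sb by apply: sumr_ge0 => i _; case: (hbi i).
have es0 : 0 < e / 2 / (sb + 1) by rewrite divr_gt0// ltr_wpDl.
have hq' : \forall n \near U, forall i, i \in index_enum 'I_p ->
    `|(enorm (m_ n - m'_ n))^-1 * (m_ n - m'_ n) 0 i - q 0 i| <= e / 2 / (sb + 1).
  by apply: (near_forall_seq (F := U) (P := fun i n => 
    `|(enorm (m_ n - m'_ n))^-1 * (m_ n - m'_ n) 0 i - q 0 i| <= _)) => i _; exact: hq.
apply: filterS (filterI (filterI (hm _ r0) (hm' _ r0)) hq') => n [[n1 n2] n3] x y Vx Sy.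
have := hr (m_ n) (m'_ n) (x, y) n1 n2 (conj Vx Sy); rewrite /=.
set D := _ - _ - _ => hD.
have dn := d0 n; have dn' : (enorm (m_ n - m'_ n))^-1 * enorm (m_ n - m'_ n) = 1.
  by rewrite mulVf// gt_eqF.
have -> : kquot (m_ n) (m'_ n) x y - mdir H q m x y = (enorm (m_ n - m'_ n))^-1 * D +
   \sum_i ((enorm (m_ n - m'_ n))^-1 * (m_ n - m'_ n) 0 i - q 0 i) * mpartial H i m x y.
  rewrite /kquot addr0 /D [X in _ = _ + X](eq_bigr (fun i =>
    (enorm (m_ n - m'_ n))^-1 * ((m_ n - m'_ n) 0 i *: mpartial H i m x y) -
    mpartial H i m x y * q 0 i)); last first.
    by move=> i _; rewrite mulrBl -mulrA [q 0 i * _]mulrC.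
  by rewrite sumrB -mulr_sumr /mdir; ring.
apply: (le_trans (ler_normD _ _)); rewrite [leRHS]splitr; apply: lerD.
  rewrite normrM gtr0_norm ?invr_gt0//.
  have i0 : 0 <= (enorm (m_ n - m'_ n))^-1 by rewrite invr_ge0 ltW.
  apply: (le_trans (ler_wpM2l i0 hD)).
  have hs : \sum_i `|(m_ n - m'_ n) 0 i| <= p%:R * enorm (m_ n - m'_ n).
    rewrite mulr_natl -[X in _ *+ X]card_ord -sumr_const; apply: ler_sum => i _.
    exact: coord_enorm.
  apply: (le_trans (ler_wpM2l i0 (ler_wpM2l (ltW ep0) hs))).
  rewrite [leLHS](_ : _ = (p%:R * (e / 2 / (p%:R + 1))) *
     ((enorm (m_ n - m'_ n))^-1 * enorm (m_ n - m'_ n))); last by ring.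
  by rewrite dn' mulr1 mul_div_le// ltW.
apply: (le_trans (ler_norm_sum _ _ _)).
apply: (@le_trans _ _ (\sum_i e / 2 / (sb + 1) * bi i)).
  apply: ler_sum => i _; rewrite normrM; apply: ler_pM => //.
    by apply: n3; rewrite mem_index_enum.
  by have [_ h] := hbi i; exact: (h (x, y)).
by rewrite -mulr_sumr -/sb mulrC mul_div_le// ltW.
Qed.

End Limits.

Let nYB_le (f g : Y) : DY f -> DY g -> nY (f - g) <= nY f + nY g.
Proof. exact: ler_snormB. Qed.
Let nYD_le (f g : Y) : DY f -> DY g -> nY (f + g) <= nY f + nY g.
Proof. exact: ler_snormD. Qed.
Let DYB (f g : Y) : DY f -> DY g -> DY (f - g). Proof. exact: semi_D_sub. Qed.
Let nYZ a (f : Y) : DY f -> nY (a *: f) = `|a| * nY f. Proof. exact: snormZ. Qed.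
Let X_complete (u : nat -> X) : (forall n, nX (u n.+1 - u n) <= 2^-1 ^+ n) ->
  exists w, forall e : R, 0 < e -> exists N, forall n, (N <= n)%N -> nX (w - u n) <= e.
Proof. exact: sob_complete. Qed.

Local Notation I a u := (\int[sigma]_(y in (S : set (borel R d))) (a y * h_val u y)).

(** A change of the kernel and a change of the density are measured together by
    |u - v| + del |v|. *)
Lemma pair_two (a a' : 'rV[R]_d -> R) (b del : R) u v : {within S, continuous a} ->
  {within S, continuous a'} -> 0 <= b -> 0 <= del -> (forall y, S y -> `|a y| <= b) ->
  (forall y, S y -> `|a y - a' y| <= b * del) ->
  `|I a u - I a' v| <= b * l1_cst * (nX (u - v) + del * nX v).
Proof.
move=> ca ca' b0 d0 ab aa'.
rewrite (_ : I a u = I a (u - v) + I a v).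
  2: by have := pair_lin_vec 1 (u - v) v ca; rewrite scale1r subrK mul1r.
rewrite -addrA; apply: (le_trans (ler_normD _ _)); rewrite mulrDr; apply: lerD.
  exact: pair_bound.
apply: (le_trans (pair_diff hP v ca ca' _ aa')); first by rewrite mulr_ge0.
by rewrite le_eqVlt; apply/orP; left; apply/eqP; ring.
Qed.

Lemma span_towers beta m u : 0 < beta -> B m ->
  eigenspan_above sigma' V (integral_op sigma S (H m)) (beta ^+ 2) u ->
  exists us, us 0%N = u /\ tower (A m) beta us.
Proof.
move=> be0 Bm; have [b [b0 hb1 _]] := kernel_bounds.
apply: (span_tower Bm (bounded_op_A Bm b0 _ (lexx _)) be0) => x y Vx Sy.
by have [] := hb1 m x y Bm Vx Sy.
Qed.

Lemma tower_gap_op beta : 0 < beta -> exists2 c : R, 0 <= c & forall m m' us vs, B m -> B m' ->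
  tower (A m) beta us -> tower (A m') beta vs ->
  nX (us 0%N - vs 0%N) <= 4 / beta * nY (A m (us 0%N) - A m' (vs 0%N)) +
    c * (enorm (m - m') * nX (vs 0%N)).
Proof.
move=> be0; have [b [b0 hb1 hb2]] := kernel_bounds.
pose kap := sqrt_vol V sigma' * l1_cst * b.
have kap0 : 0 <= kap by rewrite !mulr_ge0 ?l1_cst_ge0 ?sqrt_vol_ge0.
have c0 : 0 <= 4 / beta by rewrite divr_ge0// ltW.
have c'0 : 0 <= 16 * kap ^+ 2 / beta ^+ 2.
  by rewrite divr_ge0 ?sqr_ge0// mulr_ge0// sqr_ge0.
exists (4 / beta * kap + 16 * kap ^+ 2 / beta ^+ 2).
  by rewrite addr_ge0// mulr_ge0.
move=> m m' us vs Bm Bm' tu tv.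
have bA m1 (B1 : B m1) : bounded_op (A m1) kap.
  apply: (bounded_op_A B1 b0 _ (lexx _)) => x y Vx Sy; by have [] := hb1 m1 x y B1 Vx Sy.
have e0 := enorm_ge0 (m - m').
have k0 : 0 <= kap * enorm (m - m') by rewrite mulr_ge0.
have AA' phi : nY (A m phi - A m' phi) <= kap * enorm (m - m') * nX phi.
  have := kernel_op_diff_norm hV hsigma' hP phi (ckernel_H Bm) (ckernel_H Bm')
    (mulr_ge0 b0 e0) (fun x y Vx Sy => (hb2 m m' x y Bm Bm' Vx Sy).1).
  by rewrite mulrA.
have := tower_gap ipC ip_lin ip_ge0 DY_lin DY0 ipYC ipY_lin ipY_ge0 be0 kap0 k0
  (bA _ Bm) (bA _ Bm') AA' tu tv.
have DYA m1 u (B1 : B m1) : DY (A m1 u) by case: (bA m1 B1).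
have -> : A m (us 0%N - vs 0%N) = (A m (us 0%N) - A m' (vs 0%N)) - (A m (vs 0%N) - A m' (vs 0%N)).
  by rewrite (bounded_opB _ _ (bA _ Bm)) opprB addrA subrK.
set F := A m (us 0%N) - _; set D := A m (vs 0%N) - _.
have DF : DY F by apply: (semi_D_sub DY_lin); exact: DYA.
have DD : DY D by apply: (semi_D_sub DY_lin); exact: DYA.
have h1 : nY (F - D) <= nY F + kap * enorm (m - m') * nX (vs 0%N).
  apply: (le_trans (ler_snormB DY_lin DY0 ipYC ipY_lin ipY_ge0 DF DD)).
  by rewrite lerD2l; exact: AA'.
have h2 := ler_wpM2l c0 h1.
move=> h; apply: (le_trans h).
apply: (@le_trans _ _ (4 / beta * (nY F + kap * enorm (m - m') * nX (vs 0%N)) +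
   16 * kap * (kap * enorm (m - m')) / beta ^+ 2 * nX (vs 0%N))); first by rewrite lerD2r.
by rewrite le_eqVlt; apply/orP; left; apply/eqP; ring.
Qed.

Section Rule.
Variables (M : nat -> nat) (P : forall n, 'I_(M n) -> 'rV[R]_d) (C' : forall n, 'I_(M n) -> R).
Hypothesis hquad : quadrature sigma' kV V P C'.

(** With F = A_m u - A_m' v, the gradient of F^2 is 2 F grad F, and both factors
    are bounded by multiples of Q. *)
Lemma quad_sqr_error : exists2 c : R, 0 <= c & forall m m' u v k, B m -> B m' ->
  `|quad P C' k (fun x => (A m u - A m' v) x ^+ 2) - nY (A m u - A m' v) ^+ 2| <=
  c * (M k)%:R `^ (- (kV%:R)^-1) * (nX (u - v) + enorm (m - m') * nX v) ^+ 2.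
Proof.
have [b [b0 hb1 hb2]] := kernel_bounds.
have [M0 PV [a ha]] := hquad.
pose s := 2 * d%:R * (b * l1_cst) ^+ 2.
have c10 : 0 <= l1_cst by exact: l1_cst_ge0.
have s0 : 0 <= s by rewrite !mulr_ge0 ?sqr_ge0.
exists (`|a| * s); first by rewrite mulr_ge0.
move=> m m' u v k Bm Bm'; set F := A m u - A m' v; set Q := nX (u - v) + _.
have e0 := enorm_ge0 (m - m').
have Q0 : 0 <= Q by rewrite addr_ge0 ?mulr_ge0 ?nX_ge0.
have gm := ckernel_H Bm; have gm' := ckernel_H Bm'.
have xm := xgrad_fiber Bm; have xm' := xgrad_fiber Bm'.
pose G x := (-1) *: pair_vec (hS := hS) (hsigma := hsigma) (xgrad H kV V m' x) v +
  pair_vec (hS := hS) (hsigma := hsigma) (xgrad H kV V m x) u.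
have FE : F = fun x => (-1) * A m' v x + A m u x.
  by apply/funext => x; rewrite mulN1r addrC.
have tF x : V x -> is_tgrad kV V F x (G x).
  move=> Vx; rewrite FE; apply: is_tgrad_lin => //.
    by apply: (kernel_op_tgrad hV hP gm' xm') => // x' y' Vx' Sy'; exact: (xgradP Bm' Vx' Sy').
  by apply: (kernel_op_tgrad hV hP gm xm) => // x' y' Vx' Sy'; exact: (xgradP Bm Vx' Sy').
have bF x : V x -> `|F x| <= b * l1_cst * Q.
  move=> Vx; have -> : F x = I (H m x) u - I (H m' x) v.
    by rewrite -(kernel_opE (H m) u Vx) -(kernel_opE (H m') v Vx).
  apply: pair_two => //.
  - exact: ckernel_fiber.
  - exact: ckernel_fiber.
  - by move=> y Sy; have [] := hb1 m x y Bm Vx Sy.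
  - by move=> y Sy; have [] := hb2 m m' x y Bm Bm' Vx Sy.
have bG x : V x -> enorm (G x) <= d%:R * (b * l1_cst * Q).
  move=> Vx; apply: (le_trans (enorm_le_norm _)); rewrite ler_wpM2l//.
  apply: rV_norm_le => [|j]; first by rewrite !mulr_ge0.
  rewrite /G scaleN1r addrC !mxE; apply: pair_two => //.
  - by apply: within_continuous_coord; exact: within_continuous_fiber xm Vx.
  - by apply: within_continuous_coord; exact: within_continuous_fiber xm' Vx.
  - move=> y Sy; have [_] := hb1 m x y Bm Vx Sy; exact: le_trans (rV_norm_coord _ _).
  - move=> y Sy; have [_] := hb2 m m' x y Bm Bm' Vx Sy; apply: le_trans.
    by have := rV_norm_coord (xgrad H kV V m x y - xgrad H kV V m' x y) j; rewrite !mxE.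
have tF2 x : V x -> is_tgrad kV V (fun y => F y ^+ 2) x ((2 * F x) *: G x).
  by move=> Vx; apply: is_tgrad_sqr => //; exact: tF.
have [/andP[kV0 kVd] _ _] := hV; have d0 : (0 < d)%N by exact: leq_trans kVd.
have E x : V x -> tgrad kV V (fun y => F y ^+ 2) x = (2 * F x) *: G x.
  by move=> Vx; apply: tgradP (tF2 x Vx).
have cF : {within V, continuous F}.
  by apply: (tdiff_continuous (k := kV)) => x Vx; exists (G x); exact: tF.
have cG : {within V, continuous G}.
  have cv := pair_vec_continuous hV hP xm' (u := v).
  have cu := pair_vec_continuous hV hP xm (u := u).
  exact: (@within_continuous_lin R _ 'rV[R]_d V (-1) _ _ cv cu).
have C1F : C1_fun kV V (fun y => F y ^+ 2).
  split; first by move=> x Vx; exists ((2 * F x) *: G x); exact: tF2.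
  apply: (@within_continuous_eq _ _ _ (fun x => (2 * F x) *: G x)).
    by move=> x Vx; rewrite E.
  apply/(subspace_continuousP V (fun x => (2 * F x) *: G x)) => x Vx.
  apply: cvgZ; last exact: ((subspace_continuousP V G).1 cG x Vx).
  apply: cvgM; first exact: cvg_cst.
  exact: ((subspace_continuousP V F).1 cF x Vx).
have := ha k _ C1F; set T := _ `^ _.
have T0 : 0 <= T by exact: powR_ge0.
have V0 : V !=set0 by exists (P (Ordinal (proj1 (andP (M0 k))))); exact: PV.
have hb x : V x -> 0 <= enorm (tgrad kV V (fun y => F y ^+ 2) x) <= s * Q ^+ 2.
  move=> Vx; rewrite enorm_ge0 E//= enormZ normrM ger0_norm//.
  apply: (@le_trans _ _ (2 * (b * l1_cst * Q) * (d%:R * (b * l1_cst * Q)))).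
    apply: ler_pM; rewrite ?enorm_ge0 ?mulr_ge0//; last exact: bG.
    by rewrite ler_wpM2l// bF.
  by rewrite le_eqVlt; apply/orP; left; apply/eqP; rewrite /s; ring.
have /andP[s1 s2] := sup_bound V0 hb.
have DF : DY F by apply: (within_continuous_L2 hV hsigma').
rewrite (_ : nY F ^+ 2 = \int[sigma']_(x in (V : set (borel R d))) F x ^+ 2); last first.
  rewrite L2norm_sq//; by apply: eq_Rintegral => x _; rewrite expr2.
move=> h; apply: (le_trans h).
apply: (@le_trans _ _ (`|a| * T * (s * Q ^+ 2))).
  apply: (@le_trans _ _ (`|a| * T * sup [set enorm (tgrad kV V (fun y => F y ^+ 2) x) | x in V])).
    by rewrite ler_wpM2r// ler_wpM2r// ler_norm.
  by rewrite ler_wpM2l// mulr_ge0.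
by rewrite le_eqVlt; apply/orP; left; apply/eqP; ring.
Qed.

(** The second estimate is the first one for A_m v - A_m 0. *)
Lemma quad_sqr_errors : exists2 c : R, 0 <= c &
  (forall m m' u v k, B m -> B m' ->
    `|quad P C' k (fun x => (A m u - A m' v) x ^+ 2) - nY (A m u - A m' v) ^+ 2| <=
    c * (M k)%:R `^ (- (kV%:R)^-1) * (nX (u - v) + enorm (m - m') * nX v) ^+ 2) /\
  (forall m v k, B m -> `|quad P C' k (fun x => A m v x ^+ 2) - nY (A m v) ^+ 2| <=
    c * (M k)%:R `^ (- (kV%:R)^-1) * nX v ^+ 2).
Proof.
have [c c0 hc] := quad_sqr_error; exists c => //; split => // m v k Bm.
have A0 : A m 0 = 0.
  apply: (kernel_op_null (ckernel_H Bm)); apply: h_grad0_norm.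
  by apply/aeW => x _; rewrite sob_grad0.
have := hc m m v 0 k Bm Bm; rewrite A0 !subr0 subrr enorm0 mul0r addr0; exact.
Qed.

End Rule.
Variable beta : R.
Hypothesis beta0 : 0 < beta.

(** Failure of the constant 1 / n.+1. The normalisation passes to the limit, where
    it keeps v from vanishing. *)
Record counterex (n : nat) (m m' : 'rV[R]_p) (us vs : nat -> X) : Prop := Counterex {
  counterex_m : B m ; counterex_m' : B m' ; counterex_us : tower (A m) beta us ; counterex_vs : tower (A m') beta vs ;
  counterex_norm : nY (A m' (vs 0%N)) = 1 ;
  counterex_lt : nY (A m (us 0%N) - A m' (vs 0%N)) < n.+1%:R^-1 * enorm (m - m') }.

Hypothesis huniq1 : forall m m', B m -> B m' -> forall u v : H10 sigma kS S,
  ae_on sigma' V (fun x => integral_op sigma S (H m) u x = integral_op sigma S (H m') v x) ->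
  ~ h_eq0 u \/ ~ h_eq0 v -> m = m' /\ h_eq u v.
Hypothesis huniq2 : forall q m, enorm q = 1 -> B m -> forall u v : H10 sigma kS S,
  ae_on sigma' V (fun x => integral_op sigma S (mdir H q m) u x = integral_op sigma S (H m) v x) ->
  h_eq0 u /\ h_eq0 v.

Lemma h_eq0_norm u : h_eq0 u -> nX u = 0.
Proof. by move=> h; apply: h_grad0_norm; apply: ae_on_imp h => x _ []. Qed.

(** In the limit the first uniqueness assumption merges the parameters, after
    which the second one applies to the direction q in which they meet. *)
Lemma counterex_false (m_ m'_ : nat -> 'rV[R]_p) (us vs : nat -> nat -> X) :
  (forall n, counterex n (m_ n) (m'_ n) (us n) (vs n)) -> False.
Proof.
move=> hbad; have [b [b0 hb1 hb2]] := kernel_bounds.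
have [U UU sU] := free_ultrafilter.
have Bm_ n := counterex_m (hbad n); have Bm'_ n := counterex_m' (hbad n).
have tu n := counterex_us (hbad n); have tv n := counterex_vs (hbad n).
have [m Bm mlim] := ultra_compact hB Bm_.
have [m' Bm' m'lim] := ultra_compact hB Bm'_.
pose del n := enorm (m_ n - m'_ n).
have del0 n : 0 < del n.
  have := counterex_lt (hbad n); rewrite -/(del n).
  have : 0 <= nY (A (m_ n) (us n 0%N) - A (m'_ n) (vs n 0%N)) by exact: snorm_ge0.
  by move=> /le_lt_trans h /h; rewrite pmulr_rgt0.
have [b5 b50 hb5] : exists2 b : R, 0 <= b & forall m, B m -> `|m| <= b.
  by apply: (compact_within_bounded hB (f := id)); apply: continuous_subspaceT => x; exact: cvg_id.
pose Del := p%:R * (b5 + b5).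
have Del0 : 0 <= Del by rewrite mulr_ge0// addr_ge0.
have delb n : del n <= Del.
  apply: (le_trans (enorm_le_norm _)); rewrite ler_wpM2l// (le_trans (ler_normB _ _))//.
  by rewrite lerD// hb5.
have /choice [q_ hq] (i : 'I_p) : exists l : R, (fun n => (del n)^-1 * (m_ n - m'_ n) 0 i) @ U --> l.
  apply: (@ultra_bounded R U UU _ 1) => n.
  by rewrite normrM gtr0_norm ?invr_gt0// ler_pdivrMl// mulr1 coord_enorm.
pose q : 'rV[R]_p := \row_i q_ i.
have q1 : enorm q = 1.
  have c : (fun n => \sum_i ((del n)^-1 * (m_ n - m'_ n) 0 i) * ((del n)^-1 * (m_ n - m'_ n) 0 i)) @ U
      --> \sum_i q_ i * q_ i.
    by apply: (cvg_big add_continuous) => i _; apply: cvgM; exact: hq.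
  have E n : \sum_i ((del n)^-1 * (m_ n - m'_ n) 0 i) * ((del n)^-1 * (m_ n - m'_ n) 0 i) = 1.
    transitivity ((del n)^-1 ^+ 2 * del n ^+ 2).
      by rewrite /del enorm_sq mulr_sumr; apply: eq_bigr => i _; ring.
    by rewrite -exprMn mulVf ?expr1n// gt_eqF.
  rewrite /enorm /edot (_ : \sum_i _ = 1) ?sqrtr1//.
  under eq_bigr do rewrite mxE.
  apply/eqP; rewrite -subr_eq0 -normr_le0; apply/ler_addgt0Pr => e e0; rewrite add0r.
  by have /cvgrPdist_le /(_ e e0) /filter_ex[n] := c; rewrite E.
have [bD bD0 hbD] := ckernel_bounded hS hV (@ckernel_mdir q m (hBB' Bm)).
pose kap := sqrt_vol V sigma' * l1_cst * (b + bD).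
have vc0 : 0 <= sqrt_vol V sigma' * l1_cst by rewrite mulr_ge0 ?l1_cst_ge0 ?sqrt_vol_ge0.
have kap0 : 0 <= kap by rewrite mulr_ge0// addr_ge0.
have bopAm m1 : B m1 -> bounded_op (A m1) kap.
  move=> B1; apply: (bounded_op_A B1 b0) => [x y Vx Sy|]; first by have [] := hb1 m1 x y B1 Vx Sy.
  by rewrite ler_wpM2l// lerDl.
have cvgm (l_ : nat -> 'rV[R]_p) (l : 'rV[R]_p) : l_ @ U --> l -> forall e : R, 0 < e -> \forall n \near U, `|l_ n - l| < e.
  move=> h e e0; have /cvgrPdist_lt /(_ e e0) := h; apply: filterS => n; by rewrite distrC.
have limA (l_ : nat -> 'rV[R]_p) (l : 'rV[R]_p) : (forall n, B (l_ n)) -> B l -> l_ @ U --> l ->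
    ulim_op ip ipY U (fun n => A (l_ n)) (A l).
  move=> Bl_ Bl ll; apply: (kernel_op_ulim hS hsigma hV hsigma' hP) => [n||e e0]; [exact: ckernel_H|exact: ckernel_H|].
  have e'0 : 0 < e / (b * p%:R + 1) by rewrite divr_gt0// ltr_wpDl// mulr_ge0.
  apply: filterS (cvgm _ _ ll _ e'0) => n hn x y Vx Sy.
  have [h _] := hb2 (l_ n) l x y (Bl_ n) Bl Vx Sy; apply: (le_trans h).
  apply: (le_trans (ler_wpM2l b0 (enorm_le_norm _))); rewrite mulrA.
  have bp : 0 <= b * p%:R by rewrite mulr_ge0.
  apply: (le_trans (ler_wpM2l bp (ltW hn))).
  by rewrite mul_div_le// ltW.
have bi0 : 0 <= beta^-1 by rewrite invr_ge0 ltW.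
pose r := beta^-1 * (Del + 1).
have r0 : 0 <= r by rewrite mulr_ge0// addr_ge0.
have DYA m1 u : B m1 -> DY (A m1 u) by move=> /bopAm[].
have vr n : nX (vs n 0%N) <= r.
  have [_ _ h] := tv n 0%N; rewrite (counterex_norm (hbad n)) in h.
  by rewrite ler_pdivlMl// (le_trans h)// lerDr.
have Fn n : nY (A (m_ n) (us n 0%N) - A (m'_ n) (vs n 0%N)) <= n.+1%:R^-1 * del n.
  exact: ltW (counterex_lt (hbad n)).
have inv1 n : n.+1%:R^-1 <= 1 :> R by rewrite invf_le1// ler1n.
have ur n : nX (us n 0%N) <= r.
  have [_ _ h] := tu n 0%N; rewrite ler_pdivlMl// (le_trans h)//.
  rewrite -[A (m_ n) _](subrK (A (m'_ n) (vs n 0%N))).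
  apply: (le_trans (nYD_le (DYB (DYA _ _ (Bm_ n)) (DYA _ _ (Bm'_ n))) (DYA _ _ (Bm'_ n)))).
  rewrite (counterex_norm (hbad n)) lerD2r (le_trans (Fn n))//.
  by apply: le_trans (delb n); rewrite ler_piMl// ltW.
have eta0 (e : R) : 0 < e -> \forall n \near U, n.+1%:R^-1 <= e.
  move=> e0; apply: sU; apply: filterS (near_infty_natSinv_lt (PosNum e0)) => n; exact: ltW.
have A_ n := bopAm _ (Bm_ n); have A'_ n := bopAm _ (Bm'_ n).
have AA := limA _ _ Bm_ Bm mlim; have AA' := limA _ _ Bm'_ Bm' m'lim.
have bA := bopAm _ Bm; have bA' := bopAm _ Bm'.
have cA := kernel_op_compact (hS := hS) (hsigma := hsigma) hV hsigma' hP (UU := UU) (ckernel_H Bm).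
have cA' := kernel_op_compact (hS := hS) (hsigma := hsigma) hV hsigma' hP (UU := UU) (ckernel_H Bm').
have [u hu] := tower_ulim ipC ip_lin ip_ge0 DY_lin DY0 ipYC ipY_lin ipY_ge0 X_complete
  beta0 kap0 r0 A_ bA AA cA tu ur.
have [v hv] := tower_ulim ipC ip_lin ip_ge0 DY_lin DY0 ipYC ipY_lin ipY_ge0 X_complete
  beta0 kap0 r0 A'_ bA' AA' cA' tv vr.
have Au := ulim_apply DY_lin ipYC ipY_lin ipY_ge0 (UU := UU) kap0 r0 A_ bA AA hu ur.
have Av := ulim_apply DY_lin ipYC ipY_lin ipY_ge0 (UU := UU) kap0 r0 A'_ bA' AA' hv vr.
have v0 : ~ h_eq0 v.
  move=> /h_eq0_norm vn0.
  have h2 : 0 < 2^-1 :> R by rewrite invr_gt0.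
  have [n hn] := filter_ex (Av _ h2).
  move: hn; rewrite (kernel_op_null (ckernel_H Bm') vn0) subr0 (counterex_norm (hbad n)); lra.
have uv : nY (A m u - A m' v) = 0.
  apply/eqP; rewrite eq_le snorm_ge0 andbT; apply/ler_addgt0Pr => e e0; rewrite add0r.
  have e30 : 0 < e / 3 by rewrite divr_gt0.
  have ed0 : 0 < e / 3 / (Del + 1) by rewrite divr_gt0// ltr_wpDl.
  have [n [[n1 n2] n3]] := filter_ex (filterI (filterI (Au _ e30) (Av _ e30)) (eta0 _ ed0)).
  set An := A (m_ n) _ in n1; set An' := A (m'_ n) _ in n2.
  have D1 : DY An by exact: DYA. have D2 : DY An' by exact: DYA.
  have D3 := DYA _ u Bm. have D4 := DYA _ v Bm'.
  rewrite (_ : A m u - A m' v = (An - An') + (An' - A m' v) - (An - A m u)).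
    2: by rewrite opprB subrKA [RHS]addrC subrKA.
  apply: (le_trans (nYB_le (semi_D_add DY_lin (DYB D1 D2) (DYB D2 D4)) (DYB D1 D3))).
  have h1 := nYD_le (DYB D1 D2) (DYB D2 D4).
  have h2 : nY (An - An') <= e / 3.
    apply: (le_trans (Fn n)).
    have h3 := ler_wpM2r (ltW (del0 n)) n3; apply: (le_trans h3).
    have h4 := ler_wpM2l (ltW ed0) (delb n); apply: (le_trans h4).
    by rewrite mulrC mul_div_le// ltW.
  by rewrite [leRHS]splitr3 (le_trans (lerD (le_trans h1 (lerD h2 n2)) n1)).
have ae : ae_on sigma' V (fun x => integral_op sigma S (H m) u x = integral_op sigma S (H m') v x).
  apply: ae_on_imp (L2norm0_ae_on (DYB (DYA _ u Bm) (DYA _ v Bm')) uv) => x Vx.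
  by rewrite !integral_opE// => /eqP; rewrite subr_eq0 => /eqP.
have [mm' _] := huniq1 Bm Bm' ae (or_intror v0).
subst m'.
have hdir := kquot_ulim (UU := UU) Bm del0 (cvgm _ _ mlim) (cvgm _ _ m'lim).
have gq n := ckernel_kquot (Bm_ n) (Bm'_ n).
have bopD n : bounded_op (kernel_op V (kquot (m_ n) (m'_ n))) kap.
  apply: (kernel_op_bop hV hsigma' (gq n) b0) => [x y Vx Sy|]; last by rewrite ler_wpM2l// lerDl.
  have [h _] := hb2 _ _ x y (Bm_ n) (Bm'_ n) Vx Sy.
  rewrite /kquot addr0 mulNr -mulrBr normrM gtr0_norm ?invr_gt0 ?(del0 n)//.
  by rewrite ler_pdivrMl ?(del0 n)// mulrC.
have bopDm : bounded_op (kernel_op V (mdir H q m)) kap.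
  apply: (kernel_op_bop hV hsigma' (@ckernel_mdir q m (hBB' Bm)) bD0 hbD).
  by rewrite ler_wpM2l// lerDr.
have limD : ulim_op ip ipY U (fun n => kernel_op V (kquot (m_ n) (m'_ n))) (kernel_op V (mdir H q m)).
  apply: (kernel_op_ulim hS hsigma hV hsigma' hP) => [n||]; [exact: gq|exact: (@ckernel_mdir q m (hBB' Bm))|].
  apply: hdir => i e e0; have /cvgrPdist_le /(_ e e0) := hq i.
  by apply: filterS => n; rewrite distrC /q mxE.
have cD := kernel_op_compact (hS := hS) (hsigma := hsigma) hV hsigma' hP (UU := UU) (@ckernel_mdir q m (hBB' Bm)).
have [w hw] := quotient_equation ipC ip_lin ip_ge0 DY_lin DY0 ipYC ipY_lin ipY_ge0 X_complete
  beta0 kap0 r0 A_ A'_ bopD bA bA' bopDm AA AA' limD cA cD del0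
  (fun n phi => kquotE phi (del0 n) (Bm_ n) (Bm'_ n)) tu tv vr hv inv1 eta0 Fn.
have ae2 : ae_on sigma' V (fun x => integral_op sigma S (mdir H q m) v x =
    integral_op sigma S (H m) (- w : X) x).
  have Dv : DY (kernel_op V (mdir H q m) v) by case: bopDm.
  apply: ae_on_imp (L2norm0_ae_on (semi_D_add DY_lin (DYA _ w Bm) Dv) hw) => x Vx h.
  rewrite !integral_opE// -scaleN1r (bounded_opZ _ _ bA) scaleN1r.
  by apply/eqP; rewrite -addr_eq0 addrC; apply/eqP.
have [hv0 _] := huniq2 q1 Bm ae2.
exact: v0 hv0.
Qed.

(** If all constants 1 / n.+1 fail, dividing the towers by the norm of A_m' v turns
    the failures into counterexamples. *)
Lemma tower_lower_bound : exists2 C : R, 0 < C & forall m m' us vs, B m -> B m' ->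
  tower (A m) beta us -> tower (A m') beta vs ->
  C * nY (A m' (vs 0%N)) * enorm (m - m') <= nY (A m (us 0%N) - A m' (vs 0%N)).
Proof.
have [b [b0 hb1 hb2]] := kernel_bounds.
have bopAm m1 : B m1 -> bounded_op (A m1) (sqrt_vol V sigma' * l1_cst * b).
  move=> B1; apply: (bounded_op_A B1 b0) => // x y Vx Sy; by have [] := hb1 m1 x y B1 Vx Sy.
have DYA m1 u : B m1 -> DY (A m1 u) by move=> /bopAm[].
apply: contrapT => hno.
have /choice [z hz] n : exists z : ('rV[R]_p * 'rV[R]_p) * ((nat -> X) * (nat -> X)),
    counterex n z.1.1 z.1.2 z.2.1 z.2.2.
  apply: contrapT => hn; apply: hno; exists n.+1%:R^-1; first by rewrite invr_gt0.
  move=> m m' us vs Bm Bm' tu tv; rewrite leNgt; apply/negP => lt; apply: hn.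
  have nv0 : 0 < nY (A m' (vs 0%N)).
    rewrite lt_neqAle snorm_ge0 andbT eq_sym; apply/eqP => nv; move: lt.
    by rewrite nv mulr0 mul0r ltNge snorm_ge0.
  exists ((m, m'), ((fun k => (nY (A m' (vs 0%N)))^-1 *: us k),
                    (fun k => (nY (A m' (vs 0%N)))^-1 *: vs k))) => /=.
  have i0 : 0 < (nY (A m' (vs 0%N)))^-1 by rewrite invr_gt0.
  apply: Counterex; first exact: Bm.
  - exact: Bm'.
  - exact: (tower_scale ipC ip_lin DY_lin DY0 ipYC ipY_lin _ (bopAm _ Bm) tu).
  - exact: (tower_scale ipC ip_lin DY_lin DY0 ipYC ipY_lin _ (bopAm _ Bm') tv).
  - rewrite (bounded_opZ _ _ (bopAm _ Bm')) nYZ; last exact: DYA.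
    by rewrite gtr0_norm// mulVf// gt_eqF.
  - rewrite (bounded_opZ _ _ (bopAm _ Bm)) (bounded_opZ _ _ (bopAm _ Bm')) -scalerBr nYZ; last first.
      by apply: DYB; exact: DYA.
    rewrite gtr0_norm// ltr_pdivrMl//; apply: lt_le_trans lt _.
    by rewrite -mulrA mulrCA.
exact: counterex_false hz.
Qed.

End Problem.

(** The two relative errors are absorbed because (1/2)^2 * (5/4) <= 3/4. *)
Lemma discrete_bound (R : realType) (C n a del sd sv : R) : 0 < C -> 0 <= n -> 0 <= a ->
  0 <= del -> C * a * del <= n -> `|sd - n ^+ 2| <= n ^+ 2 / 4 -> `|sv - a ^+ 2| <= a ^+ 2 / 4 ->
  [/\ 0 <= sd, 0 <= sv & C / 2 * Num.sqrt sv * del <= Num.sqrt sd].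
Proof.
move=> C0 n0 a0 d0 h; rewrite !ler_norml => /andP[h1 h2] /andP[h3 h4].
have n20 : 0 <= n ^+ 2 by rewrite sqr_ge0.
have a20 : 0 <= a ^+ 2 by rewrite sqr_ge0.
have sd0 : 0 <= sd by lra.
have sv0 : 0 <= sv by lra.
split => //; rewrite -(@ler_pXn2r _ 2)// ?nnegrE ?sqrtr_ge0 ?mulr_ge0 ?sqrtr_ge0 ?invr_ge0 ?(ltW C0)//.
rewrite !exprMn !sqr_sqrtr//.
have h5 : (C * a * del) ^+ 2 <= n ^+ 2 by rewrite ler_pXn2r ?nnegrE// !mulr_ge0// ltW.
have cd : 0 <= (C * del) ^+ 2 by rewrite sqr_ge0.
have h6 : (C * del) ^+ 2 * sv <= (C * del) ^+ 2 * (5 / 4 * a ^+ 2) by rewrite ler_wpM2l//; lra.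
rewrite (_ : C ^+ 2 * _ * sv * _ = 4^-1 * ((C * del) ^+ 2 * sv)); last by field.
rewrite (_ : (C * del) ^+ 2 * (5 / 4 * a ^+ 2) = 5 / 4 * (C * a * del) ^+ 2) in h6; last by field.
move: ((C * del) ^+ 2 * sv) ((C * a * del) ^+ 2) h5 h6 => x y h5 h6; lra.
Qed.

(** Here n, a, w and x are |A_m u - A_m' v|, |A_m' v|, |v| and |u - v|. By the
    lower bound, del * w is at most n / (beta C); hence x + del * w is at most
    c2 n, and both quadrature errors are small multiples of the quantities
    which they approximate. *)
Lemma discrete_bound_of_errors (R : realType) (beta C c kap n a del x w T sd sv : R)
    (c2 := 4 / beta + (c + 1) / (beta * C))
    (kap' := kap * (c2 ^+ 2 + beta^-1 ^+ 2)) :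
  0 < beta -> 0 < C -> 0 <= c -> 0 <= kap -> 0 <= n -> 0 <= a -> 0 <= del -> 0 <= x -> 0 <= w ->
  0 <= T -> T <= 4^-1 / (kap' + 1) ->
  `|sv - a ^+ 2| <= kap * T * w ^+ 2 ->
  `|sd - n ^+ 2| <= kap * T * (x + del * w) ^+ 2 ->
  beta * w <= a -> x <= 4 / beta * n + c * (del * w) -> C * a * del <= n ->
  [/\ 0 <= sd, 0 <= sv & C / 2 * Num.sqrt sv * del <= Num.sqrt sd].
Proof.
move=> b0 C0 c0 k0 n0 a0 d0 x0 w0 T0 hT q2 q1 hw hx hC.
have bi0 : 0 <= beta^-1 by rewrite invr_ge0 ltW.
have c20 : 0 <= c2.
  by rewrite addr_ge0// divr_ge0// ?mulr_ge0 ?addr_ge0 ?(ltW b0) ?(ltW C0).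
have s20 : 0 <= c2 ^+ 2 + beta^-1 ^+ 2 by rewrite addr_ge0 ?sqr_ge0.
have kap'0 : 0 <= kap' by rewrite mulr_ge0.
have kT : kap' * T <= 4^-1.
  by apply: (le_trans (ler_wpM2l kap'0 hT)); rewrite mul_div_le// invr_ge0.
have dw0 : 0 <= del * w by rewrite mulr_ge0.
have dw : del * w <= n / (beta * C).
  rewrite ler_pdivlMr ?mulr_gt0//; apply: le_trans hC.
  rewrite (_ : _ * (beta * C) = C * del * (beta * w)); last by ring.
  by rewrite [leRHS]mulrAC ler_wpM2l// mulr_ge0// ltW.
have hQ : x + del * w <= c2 * n.
  have c10 : 0 <= c + 1 by rewrite addr_ge0.
  have -> : c2 * n = 4 / beta * n + (c + 1) * (n / (beta * C)) by rewrite /c2; ring.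
  have := ler_wpM2l c10 dw; rewrite [X in X <= _ -> _]mulrDl mul1r; lra.
have hw' : w <= beta^-1 * a by rewrite ler_pdivlMl.
have err (y z s : R) : 0 <= y -> 0 <= z -> y <= s * z -> s ^+ 2 <= c2 ^+ 2 + beta^-1 ^+ 2 ->
    kap * T * y ^+ 2 <= z ^+ 2 / 4.
  move=> y0 z0 yz hs; have kT0 : 0 <= kap * T by rewrite mulr_ge0.
  have h1 : y ^+ 2 <= (c2 ^+ 2 + beta^-1 ^+ 2) * z ^+ 2.
    apply: (@le_trans _ _ ((s * z) ^+ 2)).
      by rewrite ler_pXn2r ?nnegrE// (le_trans y0).
    by rewrite exprMn ler_wpM2r ?sqr_ge0.
  apply: (le_trans (ler_wpM2l kT0 h1)).
  rewrite (_ : _ * (_ * z ^+ 2) = z ^+ 2 * (kap' * T)); last by rewrite /kap'; ring.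
  by rewrite ler_wpM2l ?sqr_ge0.
apply: (discrete_bound C0 n0 a0 d0 hC).
  apply: (le_trans q1); apply: (err _ _ c2) => //; first by rewrite addr_ge0.
  by rewrite lerDl sqr_ge0.
by apply: (le_trans q2); apply: (err _ _ beta^-1) => //; rewrite lerDr sqr_ge0.
Qed.

Lemma l2norm_eq (R : realType) (d : nat) (mu : {measure set (borel R d) -> \bar R})
    (M : set 'rV[R]_d) f g : (forall x, M x -> f x = g x) -> l2norm mu M f = l2norm mu M g.
Proof.
by move=> fg; congr (Num.sqrt _); apply: eq_Rintegral => x /set_mem Mx; rewrite fg.
Qed.

Theorem theorem4p2 (R : realType) (d p : nat)
  (* the manifolds S (called R on paper) and V, with their surface measures *)
  (kS kV : nat) (S V : set 'rV[R]_d)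
  (hS : compact_submanifold kS S) (hV : compact_submanifold kV V)
  (sigma sigma' : {measure set (borel R d) -> \bar R})
  (hsigma : surface_measure kS S sigma) (hsigma' : surface_measure kV V sigma')
  (hpoincare : poincare sigma kS S)
  (B B' : set 'rV[R]_p) (hB : compact B) (hB' : open B') (hBB' : B `<=` B')
  (H : 'rV[R]_p -> 'rV[R]_d -> 'rV[R]_d -> R)
  (hreg1 : regular1 H kV V S B) (hreg2 : regular2 H kV V S B')
  (A := fun m : 'rV[R]_p => integral_op sigma S (H m))
  (dA := fun q m : 'rV[R]_p => integral_op sigma S (mdir H q m))
  (huniq1 : forall m m', B m -> B m' -> forall u v : H10 sigma kS S,
     ae_on sigma' V (fun x => A m u x = A m' v x) ->
     ~ h_eq0 u \/ ~ h_eq0 v -> m = m' /\ h_eq u v)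
  (huniq2 : forall q m, enorm q = 1 -> B m -> forall u v : H10 sigma kS S,
     ae_on sigma' V (fun x => dA q m u x = A m v x) -> h_eq0 u /\ h_eq0 v)
  (M : nat -> nat) (P : forall n, 'I_(M n) -> 'rV[R]_d)
  (C' : forall n, 'I_(M n) -> R) (hquad : quadrature sigma' kV V P C')
  (beta : R) (hbeta : 0 < beta)
  (hnorm : forall m, B m ->
     ((beta ^+ 2)%:E < normal_op_norm sigma kS S sigma' V (A m))%E)
  (E := fun m : 'rV[R]_p =>
     [set u : H10 sigma kS S | eigenspan_above sigma' V (A m) (beta ^+ 2) u]) :
  let lower_bound (C : R) : Prop :=
    forall m m', B m -> B m' -> forall u v, E m u -> E m' v ->
      C * l2norm sigma' V (A m' v) * enorm (m - m') <=
      l2norm sigma' V (fun x => A m u x - A m' v x) in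
  (exists C : R, 0 < C /\ lower_bound C) /\
  (forall C : R, 0 < C -> lower_bound C ->
   exists N : nat, forall m m', B m -> B m' -> forall u v, E m u -> E m' v ->
   forall k : nat, (N < k)%N ->
     let sq_diff := quad P C' k (fun x => `|A m u x - A m' v x| ^+ 2) in
     let sq_v := quad P C' k (fun x => `|A m' v x| ^+ 2) in
     (* the square roots are those of nonnegative numbers *)
     [/\ 0 <= sq_diff, 0 <= sq_v &
         C / 2 * Num.sqrt sq_v * enorm (m - m') <= Num.sqrt sq_diff]).
Proof.
pose X := sobolev hS hsigma.
pose K m : X -> 'rV[R]_d -> R := kernel_op V (H m).
pose nY := snorm (@L2dot _ (borel R d) R sigma' V).
have AK m (u : X) x : V x -> A m u x = K m u x by exact: integral_opE.
have nA m (v : X) : l2norm sigma' V (A m v) = nY (K m v).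
  by rewrite (l2norm_eq sigma' (g := K m v)) => // x Vx; exact: AK.
have nAB m m' (u v : X) : l2norm sigma' V (fun x => A m u x - A m' v x) = nY (K m u - K m' v).
  by rewrite (l2norm_eq sigma' (g := K m u - K m' v)) => // x Vx; rewrite !AK.
have towers m (u : X) : B m -> E m u -> exists us : nat -> X,
    us 0%N = u /\ tower (fun u v : X => h_dot u v) (@L2dot _ (borel R d) R sigma' V) (K m) beta us.
  by move=> Bm Eu; exact: (span_towers hV hsigma' hpoincare hB hB' hBB' hreg1 hreg2 hbeta Bm Eu).
move=> lower_bound; split.
  have [C C0 hC] := tower_lower_bound hS hV hsigma hsigma' hpoincare
    hB hB' hBB' hreg1 hreg2 hbeta huniq1 huniq2.
  exists C; split => // m m' Bm Bm' u v Eu Ev.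
  have [us [<- tu]] := towers m u Bm Eu; have [vs [<- tv]] := towers m' v Bm' Ev.
  rewrite (nA m' (vs 0%N)) (nAB m m' (us 0%N) (vs 0%N)).
  exact: (hC m m' us vs Bm Bm' tu tv).
move=> C C0 hC.
have [kap kap0 [hq hq']] := quad_sqr_errors hS hV hsigma hsigma' hpoincare
  hB hB' hBB' hreg1 hreg2 hquad.
have [c c0 hg] := tower_gap_op hS hV hsigma hsigma' hpoincare
  hB hB' hBB' hreg1 hreg2 hbeta.
pose c2 := 4 / beta + (c + 1) / (beta * C).
have c20 : 0 <= c2.
  by rewrite addr_ge0// divr_ge0// ?mulr_ge0 ?addr_ge0 ?(ltW hbeta) ?(ltW C0).
pose kap' := kap * (c2 ^+ 2 + beta^-1 ^+ 2).
have kap'0 : 0 <= kap' by rewrite mulr_ge0// addr_ge0 ?sqr_ge0.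
have e0 : 0 < 4^-1 / (kap' + 1) by rewrite divr_gt0 ?invr_gt0// ltr_wpDl.
have [hM PV _] := hquad; have [/andP[kV0 _] _ _] := hV.
have [N hN] := powR_small kV0 e0 hM.
exists N => m m' Bm Bm' u v Eu Ev k Nk sq_diff sq_v.
have sdE : sq_diff = quad P C' k (fun x => (K m (u : X) - K m' (v : X)) x ^+ 2).
  by apply: eq_bigr => j _; rewrite !AK// real_normK ?num_real.
have svE : sq_v = quad P C' k (fun x => K m' (v : X) x ^+ 2).
  by apply: eq_bigr => j _; rewrite !AK// real_normK ?num_real.
have := hC m m' Bm Bm' u v Eu Ev; rewrite (nA m' v) (nAB m m' u v).
have [us [u0 tu]] := towers m u Bm Eu; have [vs [v0 tv]] := towers m' v Bm' Ev.
have := hg m m' us vs Bm Bm' tu tv; rewrite u0 v0.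
have [_ _] := tv 0%N; rewrite v0.
have := hq m m' u v k Bm Bm'; have := hq' m' v k Bm'.
rewrite -sdE -svE.
have d0 := enorm_ge0 (m - m'); have T0 := powR_ge0 (M k)%:R (- (kV%:R)^-1 : R).
have hT := hN k Nk.
have n0 : 0 <= nY (K m u - K m' v) by exact: sqrtr_ge0.
have a0 : 0 <= nY (K m' v) by exact: sqrtr_ge0.
have w0 : 0 <= snorm (fun u v : X => h_dot u v) (v : X) by exact: sqrtr_ge0.
have x0 : 0 <= snorm (fun u v : X => h_dot u v) ((u : X) - (v : X)) by exact: sqrtr_ge0.
move=> q2 q1 hw hx hC'.
exact: (discrete_bound_of_errors hbeta C0 c0 kap0 n0 a0 d0 x0 w0 T0 hT q2 q1 hw hx hC').
Qed.
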